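(* Let $\xi\in(0,1)$. The solution space of Langer's equation $$\tilde y'''(\theta_2)=\theta_2\,\tilde y'(\theta_2)+(1-\xi)\,\tilde y(\theta_2),\qquad \theta_2\in\mathbb R,$$ is spanned by the following linearly independent solutions: $$\mathrm{La}_\xi(\theta_2)=\int_0^\infty \exp\!\left(-\tau^3/3+\theta_2\tau\right)\tau^{-\xi}\,d\tau,$$ $$\mathrm{Lb}_\xi(\theta_2)=\int_0^\infty\cos\!\left(\tau^3/3+\theta_2\tau+\xi\pi/2\right)\tau^{-\xi}\,d\tau,$$ $$\mathrm{Lc}_\xi(\theta_2)=\int_0^\infty\cos\!\left(\tau^3/3+\theta_2\tau-\xi\pi/2\right)\tau^{-\xi}\,d\tau .$$ Here $\operatorname{span}\{\mathrm{La}_\xi\}$ contains all non-oscillatory solutions of the equation for $\theta_2\to-\infty$. The solution $\mathrm{La}_\xi$ can be written in the following form for $\theta_2<0$: $$\mathrm{La}_\xi(\theta_2)=(-\theta_2)^{-(1-\xi)}E_2\big((-\theta_2)^{-3}\big),$$ with $E_2$ real analytic and satisfying $E_2(0)=\Gamma(1-\xi)$. The following asymptotics hold: $$\mathrm{La}_\xi(\theta_2)=\sqrt\pi\,\theta_2^{(1-\xi)/2-3/4}\exp\!\left(2\theta_2^{3/2}/3\right)(1+o(1)),$$ $$\mathrm{Lb}_\xi(\theta_2)=\frac{\sqrt\pi}{2}\,\theta_2^{(1-\xi)/2-3/4}\exp\!\left(-2\theta_2^{3/2}/3\right)(1+o(1)),$$ $$\mathrm{Lc}_\xi(\theta_2)=\sin(\xi\pi)\,\theta_2^{(1-\xi)/2-3/2}\,\Gamma(1-\xi)(1+o(1)),$$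 for $\theta_2\to\infty$, and $$\mathrm{La}_\xi(\theta_2)=(-\theta_2)^{-(1-\xi)}\Gamma(1-\xi)\big(1+\mathcal O(\theta_2^{-3})\big),$$ $$\mathrm{Lb}_\xi(\theta_2)=\sqrt{2\pi}\,(-\theta_2)^{(1-\xi)/2-3/4}\sin\!\left(\tfrac23(-\theta_2)^{3/2}(1+o(1))+\tfrac\pi4-\tfrac{\xi\pi}{2}\right)(1+o(1))+\sin(\xi\pi)\,\mathrm{La}_\xi(\theta_2),$$ $$\mathrm{Lc}_\xi(\theta_2)=\sqrt{2\pi}\,(-\theta_2)^{(1-\xi)/2-3/4}\sin\!\left(\tfrac23(-\theta_2)^{3/2}(1+o(1))+\tfrac\pi4+\tfrac{\xi\pi}{2}\right)(1+o(1)),$$ for $\theta_2\to-\infty$.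
   Context: $\Gamma(z)=\int_0^\infty t^{z-1}e^{-t}\,dt$ is the Gamma function. The independent variable is the real variable $\theta_2$, and primes denote derivatives with respect to $\theta_2$.
   Formalization: Lc for θ₂→∞ is proved with power −(1−ξ), as the printed (1−ξ)/2−3/2 is false; E₂ is real analytic for x>0 and only C^∞ on [0,∞), its Taylor series at 0 being divergent; ''non-oscillatory'' is read as eventually monotone as θ₂→−∞. *)

(* Defs.v *)
From Stdlib Require Import Reals.
From Coquelicot Require Import Coquelicot.

Open Scope R_scope.

(* Improper Riemann integrals over (0,+oo), with independent limits at both
   ends: tau^(-xi) is singular at 0, and the integrals defining Lb and Lc
   converge only conditionally at +oo. *)
Definition converges_pos (f : R -> R) : Prop :=
  ex_RInt_gen f (at_right 0) (Rbar_locally p_infty).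

Definition int_pos (f : R -> R) : R :=
  RInt_gen f (at_right 0) (Rbar_locally p_infty).

Definition Gamma (z : R) : R :=
  int_pos (fun t => Rpower t (z - 1) * exp (- t)).

Definition La_integrand (xi th tau : R) : R :=
  exp (- tau ^ 3 / 3 + th * tau) * Rpower tau (- xi).

Definition Lb_integrand (xi th tau : R) : R :=
  cos (tau ^ 3 / 3 + th * tau + xi * PI / 2) * Rpower tau (- xi).

Definition Lc_integrand (xi th tau : R) : R :=
  cos (tau ^ 3 / 3 + th * tau - xi * PI / 2) * Rpower tau (- xi).

Definition La (xi th : R) : R := int_pos (La_integrand xi th).
Definition Lb (xi th : R) : R := int_pos (Lb_integrand xi th).
Definition Lc (xi th : R) : R := int_pos (Lc_integrand xi th).

(* Existence of every derivative up to order 3 is required explicitly, since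
   Derive and Derive_n are total functions with unspecified values. *)
Definition langer_solution (xi : R) (y : R -> R) : Prop :=
  forall th : R,
    (forall k : nat, (k <= 3)%nat -> ex_derive_n y k th) /\
    Derive_n y 3 th = th * Derive y th + (1 - xi) * y th.

(* Non-oscillation is eventual monotonicity, not absence of zeros: for
   xi > 1/2 the oscillating part of La + Lc decays faster than La, so that
   La + Lc has no zeros near -oo although it keeps oscillating around La. *)
Definition non_oscillatory_minf (y : R -> R) : Prop :=
  exists M : R,
    (forall s t : R, s <= t -> t <= M -> y s <= y t) \/
    (forall s t : R, s <= t -> t <= M -> y t <= y s).

Definition real_analytic_at (f : R -> R) (x0 : R) : Prop :=
  exists (a : nat -> R) (r : R), 0 < r /\
    forall x : R, Rabs (x - x0) < r -> is_pseries a (x - x0) (f x).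

(* C^infinity on the closed half-line [0,+oo): D n is the n-th derivative,
   one-sided at 0. The function E_2(x) = int_0^oo exp(-s - x s^3/3) s^(-xi) ds is
   analytic for x > 0, but at 0 it is only smooth: its Taylor coefficients
   there, (-1)^n Gamma(3n+1-xi) / (3^n n!), give a divergent series. *)
Definition smooth_nonneg (f : R -> R) : Prop :=
  exists D : nat -> R -> R,
    (forall x : R, 0 <= x -> D 0%nat x = f x) /\
    (forall (n : nat) (x : R), 0 <= x ->
       filterlim (fun y => (D n y - D n x) / (y - x))
         (within (fun y => 0 <= y) (locally' x)) (locally (D (S n) x))).

(* Main.v *)
Require Import Defs.
From Stdlib Require Import Reals Lra Lia Psatz Factorial FunctionalExtensionality ZArith.
From Coquelicot Require Import Coquelicot.

Open Scope R_scope.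

(** Write F(z) = int_0^oo exp(- s^3/3 + z s) s^(-xi) ds and w = exp(2 i pi/3). Then La is F on
    the real axis, and turning the half-line of integration of Lb and Lc by the angle pi/6,
    where i tau^3/3 becomes - s^3/3, exhibits them as the real parts of unimodular constants
    times F(w th) ([has_integral_fresnel]). The integrals for F converge absolutely, with all
    derivatives in z. One integration by parts shows that the third derivative of F is z F'(z) +
    (1 - xi) F(z), and since w^3 = 1 the function F(w th) of th satisfies the same equation
    ([ray_integral_ode]). At th = 0 the n-th derivative of a La + b Lb + c Lc is a positive
    moment times a + Re(Z w^n), where Z is the combination of the two constants with
    coefficients b and c. The constants differ in argument by xi pi, which is not a multiple of
    pi; so (a, b, c) and the Cauchy data at 0 determine each other, which gives both
    independence and span.

    For the asymptotics of Lb and Lc the half-line is replaced by a segment of the imaginary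
    axis followed by a straight half-line on which the integrand is a Gaussian perturbed by a
    cubic. For th = a^2 the path is 0, i a, i a + oo, with i a the saddle point ([contour_up]);
    for th = - a^2 it is 0, - i a and then the line of slope 1 through the saddle a
    ([contour_down]). On the imaginary axis the integrand is a real function times a constant
    cosine. For th -> +oo this cosine is 0 for Lb, which leaves the recessive saddle term, and
    sin(xi pi) for Lc, which gives the algebraic term. For th -> -oo it is sin(xi pi) for Lb and
    0 for Lc, and the real function is the integrand of La. The saddle terms, and La itself for
    th -> +oo, are estimated by Laplace's method in the form [laplace_estimate], with a relative
    error of order a^(-3/2).

    For th -> -oo the oscillating parts have the amplitude sqrt pi a^(-xi - 1/2), smaller than
    the amplitude with sqrt (2 pi) in the asymptotic formulas. Those formulas hold because the
    o(1) inside the sine is multiplied by |th|^(3/2): the phase may be moved by any bounded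
    amount, and an arcsine expresses every function bounded by the stated amplitude in the
    stated form ([phase_absorption]). The same asymptotics decide which solutions are monotone
    near -oo: over a half period of the phase the oscillating part of a combination changes sign
    with size a^(-xi - 1/2), while La moves by O(a^(-2)), so a combination with a nonzero
    component along Lb or Lc is not ([comb_oscillates]).

    For th < 0 the substitution s = - th tau turns La into E_2(x) = int_0^oo exp(- s - x s^3/3)
    s^(-xi) ds with x = (- th)^(-3). Its n-th derivative is at most a constant times n! x^(-n),
    so its Taylor series converges on a neighbourhood of every x > 0; at x = 0 all one-sided
    derivatives exist. *)

(** * Comparison of integrals through primitives *)

Ltac nonneg :=
  first [ assumption | lra |
    lazymatch goal with
    | |- 0 < exp _ => apply exp_pos
    | |- 0 < Rpower _ _ => apply exp_pos
    | |- 0 < RIneq.pos _ => apply cond_pos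
    | |- 0 <= Rabs _ => apply Rabs_pos
    | |- 0 <= INR _ => apply pos_INR
    | |- 0 < _ * _ => apply Rmult_lt_0_compat; nonneg
    | |- 0 <= _ + _ => apply Rplus_le_le_0_compat; nonneg
    | |- 0 <= _ * _ => apply Rmult_le_pos; nonneg
    | |- 0 < _ / _ => apply Rdiv_lt_0_compat; nonneg
    | |- 0 <= _ / _ => apply Rmult_le_pos; nonneg
    | |- 0 < / _ => apply Rinv_0_lt_compat; nonneg
    | |- 0 < _ ^ _ => apply pow_lt; nonneg
    | |- 0 <= _ ^ _ => apply pow_le; nonneg
    | |- 0 < sqrt _ => apply sqrt_lt_R0; nonneg
    | |- 0 < ?x => unfold x; nonneg
    | |- 0 <= ?x => first [ unfold x; nonneg | apply Rlt_le; nonneg ]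
    end ].

Ltac mono_l := apply Rmult_le_compat_l; [nonneg|].
Ltac mono_r := apply Rmult_le_compat_r; [nonneg|].

(** The mean value theorem applied to E - B and E + B. With limits at the ends of the half-line
    it yields the comparisons of improper integrals below. *)
Lemma increment_le (B E b e : R -> R) (x y : R) :
  x <= y ->
  (forall t, x <= t <= y -> is_derive B t (b t)) ->
  (forall t, x <= t <= y -> is_derive E t (e t)) ->
  (forall t, x <= t <= y -> Rabs (b t) <= e t) ->
  Rabs (B y - B x) <= E y - E x.
Proof.
  intros Hxy HB HE Hbe.
  assert (H : forall s, (s = 1 \/ s = -1) -> 0 <= (E y - s * B y) - (E x - s * B x)).
  { intros s Hs.
    destruct (MVT_gen (fun t => E t - s * B t) x y (fun t => e t - s * b t))
      as [c [Hc ->]].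
    - intros t Ht. rewrite Rmin_left, Rmax_right in Ht by lra.
      apply (is_derive_minus (V := R_NormedModule) E (fun t => s * B t)).
      + apply HE; lra.
      + apply (is_derive_scal B). apply HB; lra.
    - intros t Ht. rewrite Rmin_left, Rmax_right in Ht by lra.
      apply derivable_continuous_pt. exists (e t - s * b t).
      apply is_derive_Reals.
      apply (is_derive_minus (V := R_NormedModule) E (fun t => s * B t)).
      + apply HE; lra.
      + apply (is_derive_scal B). apply HB; lra.
    - rewrite Rmin_left, Rmax_right in Hc by lra.
      specialize (Hbe c Hc). apply Rabs_le_between in Hbe.
      apply Rmult_le_pos; [destruct Hs; subst s; lra | lra]. }
  pose proof (H 1 (or_introl eq_refl)). pose proof (H (-1) (or_intror eq_refl)).
  apply Rabs_le. lra.
Qed.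

Lemma continuous_of_derivable (f : R -> R) (x : R) : ex_derive f x -> continuous f x.
Proof. apply (ex_derive_continuous (K := R_AbsRing) (V := R_NormedModule)). Qed.

Lemma filterlim_eps {T : Type} {F : (T -> Prop) -> Prop} {FF : Filter F} (f : T -> R) (l : R) :
  filterlim f F (locally l) <-> forall eps, 0 < eps -> F (fun x => Rabs (f x - l) < eps).
Proof.
  split.
  - intros H eps He. exact (proj1 (filterlim_locally f l) H (mkposreal eps He)).
  - intros H. apply filterlim_locally. intros [eps He]. now apply H.
Qed.

Lemma locally_pos (s : R) : 0 < s -> locally s (fun y => 0 < y).
Proof.
  intros Hs. exists (mkposreal s Hs). intros y Hy. apply Rabs_lt_between in Hy.
  unfold minus, plus, opp in Hy; simpl in Hy. lra.
Qed.

Lemma filterlim_lincomb {T : Type} {F : (T -> Prop) -> Prop} {FF : Filter F}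
  (f g : T -> R) (a b c d : R) :
  filterlim f F (locally a) -> filterlim g F (locally b) ->
  filterlim (fun x => c * f x + d * g x) F (locally (c * a + d * b)).
Proof.
  intros Hf Hg.
  apply (filterlim_comp_2 (H := locally (d * b)) (G := locally (c * a))
           (F := F) (fun x => c * f x) (fun x => d * g x) Rplus).
  - apply (filterlim_comp _ _ _ f (fun y => c * y) F (locally a)); auto.
    apply (filterlim_scal_r (V := R_NormedModule) c a).
  - apply (filterlim_comp _ _ _ g (fun y => d * y) F (locally b)); auto.
    apply (filterlim_scal_r (V := R_NormedModule) d b).
  - apply (filterlim_plus (V := R_NormedModule)).
Qed.

Lemma filterlim_lincomb_ext {T : Type} {F : (T -> Prop) -> Prop} {FF : Filter F}
  (h f g : T -> R) (l a b c d : R) :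
  (forall x, h x = c * f x + d * g x) -> l = c * a + d * b ->
  filterlim f F (locally a) -> filterlim g F (locally b) -> filterlim h F (locally l).
Proof.
  intros Hh -> Hf Hg. apply (filterlim_ext (fun x => c * f x + d * g x)); auto.
  now apply filterlim_lincomb.
Qed.

Lemma filterlim_scal_ext {T : Type} {F : (T -> Prop) -> Prop} {FF : Filter F}
  (h f : T -> R) (l a c : R) :
  (forall x, h x = c * f x) -> l = c * a -> filterlim f F (locally a) -> filterlim h F (locally l).
Proof.
  intros Hh Hl Hf. apply (filterlim_lincomb_ext h f (fun _ => 0) l a 0 c 0);
    [intros; rewrite Hh; ring|rewrite Hl; ring|assumption|apply filterlim_const].
Qed.

Lemma filterlim_0_dominated {F : (R -> Prop) -> Prop} {FF : Filter F} (f g : R -> R) (C : R) :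
  F (fun x => Rabs (f x) <= C * g x) -> filterlim g F (locally 0) -> filterlim f F (locally 0).
Proof.
  intros Hfg Hg. apply filterlim_eps. intros eps Heps. pose proof (Rabs_pos C) as HC.
  pose proof (proj1 (filterlim_eps g 0) Hg (eps / (Rabs C + 1))
    ltac:(nonneg)) as Hg'.
  eapply filter_imp; [|apply (filter_and _ _ Hfg Hg')].
  intros x [H1 H2]. rewrite Rminus_0_r in *. apply Rlt_div_r in H2; [|lra].
  assert (C * g x <= Rabs C * Rabs (g x)) by (rewrite <- Rabs_mult; apply Rle_abs).
  pose proof (Rabs_pos (g x)). lra.
Qed.

(** Cauchy's criterion: increments of B are controlled by those of a convergent function. *)
Lemma filterlim_dominated {T : Type} {F : (T -> Prop) -> Prop} {FF : ProperFilter F}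
  (B E : T -> R) (e : R) (P : T -> Prop) :
  F P -> (forall x y, P x -> P y -> Rabs (B y - B x) <= Rabs (E y - E x)) ->
  filterlim E F (locally e) -> exists l : R, filterlim B F (locally l).
Proof.
  intros HP Hdom HE.
  apply (filterlim_locally_cauchy (U := R_CompleteSpace)).
  intros eps.
  assert (He : exists y : R_CompleteSpace, filterlim E F (locally y)) by (exists e; exact HE).
  destruct (proj2 (filterlim_locally_cauchy (U := R_CompleteSpace) E) He eps) as [Q [HQ HQE]].
  exists (fun x => P x /\ Q x). split. { now apply filter_and. }
  intros u v [Pu Qu] [Pv Qv]. specialize (HQE u v Qu Qv).
  unfold ball in *. simpl in *. unfold AbsRing_ball, minus, plus, opp, abs in *; simpl in *.
  eapply Rle_lt_trans; [|exact HQE].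
  apply Hdom; auto.
Qed.

(** B s is the integral over (0, s). Carrying the primitive along reduces comparison, rescaling
    and deformation of contours to statements about derivatives and limits. *)
Definition has_integral (f : R -> R) (l : R) : Prop :=
  (forall s, 0 < s -> continuous f s) /\
  exists B : R -> R,
    (forall s, 0 < s -> is_derive B s (f s)) /\
    filterlim B (at_right 0) (locally 0) /\
    filterlim B (Rbar_locally p_infty) (locally l).

Lemma at_right_pos (c : R) : 0 < c -> at_right 0 (fun x => 0 < x < c).
Proof.
  intros Hc. exists (mkposreal c Hc). intros y Hy Hy0.
  unfold ball in Hy; simpl in Hy. unfold AbsRing_ball, abs, minus, plus, opp in Hy; simpl in Hy.
  apply Rabs_lt_between in Hy. lra.
Qed.

Lemma has_integral_primitive (f B : R -> R) (l0 l1 : R) :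
  (forall s, 0 < s -> continuous f s) ->
  (forall s, 0 < s -> is_derive B s (f s)) ->
  filterlim B (at_right 0) (locally l0) ->
  filterlim B (Rbar_locally p_infty) (locally l1) ->
  has_integral f (l1 - l0).
Proof.
  intros Hc HB H0 H1. split; auto.
  exists (fun s => B s - l0). split; [|split].
  - intros s Hs. auto_derive.
    + now exists (f s); apply HB.
    + rewrite Rmult_1_l. now apply is_derive_unique, HB.
  - apply (filterlim_lincomb_ext _ B (fun _ => 1) _ l0 1 1 (- l0));
      [intros; ring|ring|assumption|apply filterlim_const].
  - apply (filterlim_lincomb_ext _ B (fun _ => 1) _ l1 1 1 (- l0));
      [intros; ring|ring|assumption|apply filterlim_const].
Qed.

Lemma has_integral_correct (f : R -> R) (l : R) :
  has_integral f l -> converges_pos f /\ int_pos f = l.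
Proof.
  intros [Hc [B [HB [H0 H1]]]].
  assert (HI : is_RInt_gen f (at_right 0) (Rbar_locally p_infty) l).
  { assert (HF : filter_prod (at_right 0) (Rbar_locally p_infty)
              (fun ab => 0 < fst ab /\ 1 < snd ab)).
    { apply (Filter_prod _ _ _ (fun x => 0 < x < 1) (fun x => 1 < x)).
      - apply at_right_pos; lra.
      - exists 1; auto.
      - simpl; intros; lra. }
    assert (HD : is_RInt_gen (Derive B) (at_right 0) (Rbar_locally p_infty) (l - 0)).
    { apply is_RInt_gen_Derive; auto.
      - eapply filter_imp; [|exact HF]. intros [a b] [Ha Hb] x Hx; simpl in *.
        assert (0 < x) by (unfold Rmin in Hx; destruct (Rle_dec a b); lra).
        now exists (f x); apply HB.
      - eapply filter_imp; [|exact HF]. intros [a b] [Ha Hb] x Hx; simpl in *.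
        assert (Hx0 : 0 < x) by (unfold Rmin in Hx; destruct (Rle_dec a b); lra).
        apply (continuous_ext_loc (Derive B) f).
        + eapply filter_imp; [|exact (locally_pos x Hx0)]. intros y Hy.
          symmetry. now apply is_derive_unique, HB.
        + now apply Hc. }
    rewrite Rminus_0_r in HD.
    apply (is_RInt_gen_ext (Derive B)); auto.
    eapply filter_imp; [|exact HF]. intros [a b] [Ha Hb] x Hx; simpl in *.
    apply is_derive_unique, HB. unfold Rmin in Hx; destruct (Rle_dec a b); lra. }
  split.
  - now exists l.
  - unfold int_pos. now apply is_RInt_gen_unique.
Qed.

Lemma primitive_le_0 (B E b e : R -> R) (y : R) :
  0 < y ->
  (forall s, 0 < s <= y -> is_derive B s (b s)) ->
  (forall s, 0 < s <= y -> is_derive E s (e s)) ->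
  (forall s, 0 < s <= y -> Rabs (b s) <= e s) ->
  filterlim B (at_right 0) (locally 0) -> filterlim E (at_right 0) (locally 0) ->
  Rabs (B y) <= E y.
Proof.
  intros Hy HB HE Hbe HB0 HE0.
  assert (H : Rbar_le (Rabs (B y)) (E y)); [|exact H].
  apply (filterlim_le (F := at_right 0) (fun x => Rabs (B y - B x)) (fun x => E y - E x)).
  - eapply filter_imp; [|apply (at_right_pos y Hy)]. intros x Hx; simpl.
    apply (increment_le B E b e); [lra| | |]; intros t Ht; [apply HB|apply HE|apply Hbe]; lra.
  - apply (filterlim_comp _ _ _ (fun x => B y - B x) Rabs _ (locally (B y))).
    + apply (filterlim_lincomb_ext _ (fun _ => B y) B _ (B y) 0 1 (-1));
        [intros; ring|ring|apply filterlim_const|assumption].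
    + apply (continuous_Rabs (B y)).
  - apply (filterlim_lincomb_ext _ (fun _ => E y) E _ (E y) 0 1 (-1));
      [intros; ring|ring|apply filterlim_const|assumption].
Qed.

Lemma primitive_le_infty (B E b e : R -> R) (x l m : R) :
  (forall s, x <= s -> is_derive B s (b s)) ->
  (forall s, x <= s -> is_derive E s (e s)) ->
  (forall s, x <= s -> Rabs (b s) <= e s) ->
  filterlim B (Rbar_locally p_infty) (locally l) ->
  filterlim E (Rbar_locally p_infty) (locally m) ->
  Rabs (l - B x) <= m - E x.
Proof.
  intros HB HE Hbe HB1 HE1.
  assert (H : Rbar_le (Rabs (l - B x)) (m - E x)); [|exact H].
  apply (filterlim_le (F := Rbar_locally p_infty)
    (fun y => Rabs (B y - B x)) (fun y => E y - E x)).
  - exists x. intros y Hy.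
    apply (increment_le B E b e); [lra| | |]; intros t Ht; [apply HB|apply HE|apply Hbe]; lra.
  - apply (filterlim_comp _ _ _ (fun y => B y - B x) Rabs _ (locally (l - B x))).
    + apply (filterlim_lincomb_ext _ B (fun _ => B x) _ l (B x) 1 (-1));
        [intros; ring|ring|assumption|apply filterlim_const].
    + apply (continuous_Rabs (l - B x)).
  - apply (filterlim_lincomb_ext _ E (fun _ => E x) _ m (E x) 1 (-1));
      [intros; ring|ring|assumption|apply filterlim_const].
Qed.

Lemma has_integral_compare (f g : R -> R) (l m : R) :
  has_integral f l -> has_integral g m ->
  (forall s, 0 < s -> Rabs (f s) <= g s) -> Rabs l <= m.
Proof.
  intros [_ [B [HB [HB0 HB1]]]] [_ [E [HE [HE0 HE1]]]] Hfg.
  assert (H0 : Rabs (B 1) <= E 1).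
  { apply (primitive_le_0 B E f g); auto; [lra| | |]; intros; [apply HB|apply HE|apply Hfg]; lra. }
  assert (H1 : Rabs (l - B 1) <= m - E 1).
  { apply (primitive_le_infty B E f g); auto; intros; [apply HB|apply HE|apply Hfg]; lra. }
  replace l with (l - B 1 + B 1) by ring.
  pose proof (Rabs_triang (l - B 1) (B 1)). lra.
Qed.

Lemma has_integral_lincomb (f g : R -> R) (l m c d : R) :
  has_integral f l -> has_integral g m ->
  has_integral (fun s => c * f s + d * g s) (c * l + d * m).
Proof.
  intros [Hf [B [HB [HB0 HB1]]]] [Hg [E [HE [HE0 HE1]]]]. split.
  - intros s Hs. apply (continuous_plus (fun s => c * f s) (fun s => d * g s)).
    + apply (continuous_scal_r c f s). auto.
    + apply (continuous_scal_r d g s). auto.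
  - exists (fun s => c * B s + d * E s). split; [|split].
    + intros s Hs. apply (is_derive_plus (fun s => c * B s) (fun s => d * E s)).
      * apply (is_derive_scal B). auto.
      * apply (is_derive_scal E). auto.
    + apply (filterlim_lincomb_ext _ B E _ 0 0 c d); [intros; ring|ring|assumption|assumption].
    + now apply filterlim_lincomb.
Qed.

Lemma has_integral_ext (f g : R -> R) (l : R) :
  (forall s, 0 < s -> f s = g s) -> has_integral f l -> has_integral g l.
Proof.
  intros Hfg [Hf [B [HB HB']]]. split.
  - intros s Hs. apply (continuous_ext_loc g f); auto.
    eapply filter_imp; [|exact (locally_pos s Hs)]. exact Hfg.
  - exists B. split; auto. intros s Hs. rewrite <- Hfg; auto.
Qed.

Lemma has_integral_unique (f : R -> R) (l m : R) :
  has_integral f l -> has_integral f m -> l = m.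
Proof.
  intros Hl Hm. apply has_integral_correct in Hl. apply has_integral_correct in Hm.
  destruct Hl, Hm; congruence.
Qed.

Lemma has_integral_rescale (f : R -> R) (l c : R) :
  0 < c -> has_integral f l -> has_integral (fun s => f (c * s)) (l / c).
Proof.
  intros Hc [Hf [B [HB [H0 H1]]]]. split.
  - intros s Hs. apply (continuous_comp (fun s => c * s) f).
    + apply (continuous_scal_r (V := R_NormedModule) c (fun s => s)). apply continuous_id.
    + apply Hf. now apply Rmult_lt_0_compat.
  - exists (fun s => B (c * s) / c). split; [|split].
    + intros s Hs. assert (0 < c * s) by nonneg.
      auto_derive.
      * exists (f (c * s)). now apply HB.
      * replace (Derive (fun x => B x) (c * s)) with (f (c * s)).
        -- field; lra.
        -- symmetry. now apply is_derive_unique, HB.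
    + apply (filterlim_scal_ext _ (fun s => B (c * s)) _ 0 (/ c));
        [intros; field; lra|ring| ].
      apply (filterlim_comp _ _ _ (fun s => c * s) B _ (at_right 0)); auto.
        intros P [eps HP].
        assert (He : 0 < eps / c) by nonneg.
        unfold filtermap; apply (filter_imp (fun x => 0 < x < eps / c)); [|apply (at_right_pos _ He)].
        intros x Hx. apply HP.
        -- unfold ball; simpl; unfold AbsRing_ball, abs, minus, plus, opp; simpl.
           assert (c * x < eps).
           { replace (pos eps) with (c * (eps / c)) by (field; lra).
             apply Rmult_lt_compat_l; lra. }
           assert (0 < c * x) by nonneg.
           rewrite Rabs_pos_eq; lra.
        -- apply Rmult_lt_0_compat; lra.
    + apply (filterlim_scal_ext _ (fun s => B (c * s)) _ l (/ c));
        [intros; field; lra|field; lra| ].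
      apply (filterlim_comp _ _ _ (fun s => c * s) B _ (Rbar_locally p_infty)); auto.
        intros P [M HP]. exists (M / c). intros x Hx. apply HP.
        replace M with (c * (M / c)) by (field; lra).
        apply Rmult_lt_compat_l; lra.
Qed.

Lemma has_integral_pos (f : R -> R) (l : R) :
  has_integral f l -> (forall s, 0 < s -> 0 < f s) -> 0 < l.
Proof.
  intros [_ [B [HB [HB0 HB1]]]] Hf.
  assert (Hinc : forall x y, 0 < x -> x < y -> B x < B y).
  { intros x y Hx Hxy.
    apply (incr_function B 0 p_infty f); simpl; auto. intros; now apply Hf. }
  assert (H1 : 0 <= B 1).
  { assert (H : Rbar_le 0 (B 1)); [|exact H].
    apply (filterlim_le (F := at_right 0) B (fun _ => B 1)); auto.
    - eapply filter_imp; [|apply (at_right_pos 1); lra]. intros x Hx. simpl.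
      left; apply Hinc; lra.
    - apply filterlim_const. }
  assert (H2 : B 2 <= l).
  { assert (H : Rbar_le (B 2) l); [|exact H].
    apply (filterlim_le (F := Rbar_locally p_infty) (fun _ => B 2) B); auto.
    - exists 2. intros; left; apply Hinc; lra.
    - apply filterlim_const. }
  assert (B 1 < B 2) by (apply Hinc; lra). lra.
Qed.

(** The majorant makes the primitive of f that vanishes at 1 converge at both ends of the
    half-line. *)
Lemma has_integral_dominated (f g : R -> R) (m : R) :
  (forall s, 0 < s -> continuous f s) -> has_integral g m ->
  (forall s, 0 < s -> Rabs (f s) <= g s) -> exists l, has_integral f l.
Proof.
  intros Hf [_ [E [HE [HE0 HE1]]]] Hfg.
  set (B := fun x => RInt f 1 x).
  assert (HB : forall s, 0 < s -> is_derive B s (f s)).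
  { intros s Hs. apply (is_derive_RInt f B 1).
    - eapply filter_imp; [|exact (locally_pos s Hs)]. intros y Hy.
      apply (RInt_correct (V := R_CompleteNormedModule)).
      apply ex_RInt_continuous. intros z Hz. apply Hf.
      unfold Rmin in Hz; destruct (Rle_dec 1 y); lra.
    - auto. }
  assert (Hinc : forall x y, 0 < x -> 0 < y -> Rabs (B y - B x) <= Rabs (E y - E x)).
  { assert (H : forall x y, 0 < x <= y -> Rabs (B y - B x) <= E y - E x).
    { intros x y Hxy. apply (increment_le B E f g); try lra; intros t Ht;
        [apply HB|apply HE|apply Hfg]; lra. }
    intros x y Hx Hy. destruct (Rle_dec x y).
    - eapply Rle_trans; [apply H; lra|apply Rle_abs].
    - rewrite Rabs_minus_sym, (Rabs_minus_sym (E y)).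
      eapply Rle_trans; [apply H; lra|apply Rle_abs]. }
  destruct (filterlim_dominated (F := at_right 0) B E 0 (fun x => 0 < x)) as [l0 Hl0]; auto.
  { eapply filter_imp; [|apply (at_right_pos 1); lra]. simpl; intros; lra. }
  destruct (filterlim_dominated (F := Rbar_locally p_infty) B E m (fun x => 0 < x))
    as [l1 Hl1]; auto.
  { now exists 0. }
  exists (l1 - l0). now apply (has_integral_primitive f B).
Qed.

(** * Integrands of moderate growth on the half-line *)

Lemma mean_value (u u1 : R -> R) (x y : R) :
  (forall t, Rmin x y <= t <= Rmax x y -> is_derive u t (u1 t)) ->
  exists c, Rmin x y <= c <= Rmax x y /\ u y - u x = u1 c * (y - x).
Proof.
  intros Hu. apply MVT_gen.
  - intros t Ht. apply Hu. lra.
  - intros t Ht. apply derivable_continuous_pt. exists (u1 t).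
    now apply is_derive_Reals, Hu.
Qed.

Lemma primitives_differ (A B f : R -> R) (s : R) :
  (forall s, 0 < s -> is_derive A s (f s)) -> (forall s, 0 < s -> is_derive B s (f s)) ->
  0 < s -> A s - B s = A 1 - B 1.
Proof.
  intros HA HB Hs.
  destruct (mean_value (fun s => A s - B s) (fun _ => 0) 1 s) as [c [_ E]]; [|lra].
  intros t Ht. assert (0 < t) by (unfold Rmin in Ht; destruct (Rle_dec 1 s); lra).
  evar_last; [apply (is_derive_minus (V := R_NormedModule)); [now apply HA|now apply HB]|].
  apply Rminus_diag.
Qed.

Lemma primitive_unique (A B f : R -> R) (s : R) :
  (forall s, 0 < s -> is_derive A s (f s)) -> (forall s, 0 < s -> is_derive B s (f s)) ->
  filterlim A (at_right 0) (locally 0) -> filterlim B (at_right 0) (locally 0) ->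
  0 < s -> A s = B s.
Proof.
  intros HA HB Ha Hb Hs.
  assert (H : Rabs (A s - B s) <= 0); [|apply Rabs_le_between in H; lra].
  apply (primitive_le_0 (fun s => A s - B s) (fun _ => 0) (fun s => f s - f s) (fun _ => 0)); auto.
  - intros t Ht. apply (is_derive_minus (V := R_NormedModule)); [apply HA|apply HB]; lra.
  - intros t _. apply (is_derive_const (K := R_AbsRing) (V := R_NormedModule)).
  - intros t _. rewrite Rminus_diag, Rabs_R0. lra.
  - apply (filterlim_lincomb_ext _ A B _ 0 0 1 (-1)); [intros; ring|ring|assumption|assumption].
  - apply filterlim_const.
Qed.

Lemma Rabs_between (x y c : R) : Rmin x y <= c <= Rmax x y -> Rabs (c - x) <= Rabs (y - x).
Proof.
  unfold Rmin, Rmax, Rabs. destruct (Rle_dec x y); intros;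
    repeat destruct (Rcase_abs _); lra.
Qed.

Lemma taylor_quadratic (u u1 u2 : R -> R) (M x y : R) :
  (forall t, Rmin x y <= t <= Rmax x y ->
     is_derive u t (u1 t) /\ is_derive u1 t (u2 t) /\ Rabs (u2 t) <= M) ->
  Rabs (u y - u x - (y - x) * u1 x) <= M * (y - x) ^ 2.
Proof.
  intros H.
  destruct (mean_value u u1 x y) as [c [Hc Ec]]. { intros; now apply H. }
  assert (Hsub : forall t, Rmin x c <= t <= Rmax x c -> Rmin x y <= t <= Rmax x y).
  { intros t. revert Hc. unfold Rmin, Rmax.
    destruct (Rle_dec x y), (Rle_dec x c); lra. }
  destruct (mean_value u1 u2 x c) as [d [Hd Ed]]. { intros; now apply H, Hsub. }
  rewrite Ec. replace (u1 c * (y - x) - (y - x) * u1 x) with ((u1 c - u1 x) * (y - x)) by ring.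
  rewrite Ed, !Rabs_mult.
  destruct (H d (Hsub d Hd)) as [_ [_ HM]].
  pose proof (Rabs_between _ _ _ Hc).
  rewrite <- (pow2_abs (y - x)).
  pose proof (Rabs_pos (u2 d)). pose proof (Rabs_pos (y - x)). pose proof (Rabs_pos (c - x)).
  replace (M * Rabs (y - x) ^ 2) with (M * Rabs (y - x) * Rabs (y - x)) by ring.
  apply Rmult_le_compat_r; auto. apply Rmult_le_compat; auto.
Qed.

Lemma exp_le_compat (x y : R) : x <= y -> exp x <= exp y.
Proof. intros [H| ->]; [left; now apply exp_increasing|lra]. Qed.

Lemma pow_le_fact_exp (n : nat) (s : R) : 0 <= s -> s ^ n <= INR (fact n) * exp s.
Proof.
  revert s. induction n as [|n IH]; intros s Hs.
  - simpl. pose proof (exp_ineq1_le s). lra.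
  - pose proof (INR_fact_lt_0 n) as Hf.
    pose proof (increment_le (fun t => t ^ S n) (fun t => INR (fact (S n)) * exp t)
      (fun t => INR (S n) * t ^ n) (fun t => INR (fact (S n)) * exp t) 0 s Hs) as H.
    cbv beta in H.
    assert (H' : Rabs (s ^ S n - 0 ^ S n) <= INR (fact (S n)) * exp s - INR (fact (S n)) * exp 0).
    { apply H; clear H; intros t Ht.
      - auto_derive; auto. change (1 * (INR (S n) * t ^ n) = INR (S n) * t ^ n). ring.
      - apply (is_derive_scal exp), is_derive_exp.
      - pose proof (pos_INR (S n)). pose proof (pow_le t n (proj1 Ht)).
        rewrite Rabs_pos_eq by now apply Rmult_le_pos.
        rewrite fact_simpl, mult_INR, Rmult_assoc. apply Rmult_le_compat_l; auto.
        apply IH; lra. }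
    rewrite exp_0 in H'. rewrite (pow_i (S n)) in H' by lia. rewrite Rminus_0_r in H'.
    pose proof (Rle_abs (s ^ S n)). pose proof (INR_fact_lt_0 (S n)). lra.
Qed.

Lemma Rpower_lim_0 (p : R) : 0 < p -> filterlim (fun s => Rpower s p) (at_right 0) (locally 0).
Proof.
  intros Hp. apply filterlim_eps. intros eps Heps.
  eapply filter_imp; [|apply (at_right_pos (Rpower eps (/ p)))].
  - intros x Hx. rewrite Rminus_0_r.
    assert (0 < Rpower x p) by nonneg. rewrite Rabs_pos_eq by lra.
    replace eps with (Rpower (Rpower eps (/ p)) p).
    + apply Rlt_Rpower_l; lra.
    + rewrite Rpower_mult, Rinv_l, Rpower_1 by lra. reflexivity.
  - apply exp_pos.
Qed.

Lemma is_derive_Rpower (p s : R) : 0 < s -> is_derive (fun t => Rpower t p) s (p * Rpower s (p - 1)).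
Proof.
  intros Hs. apply is_derive_Reals. now apply derivable_pt_lim_power.
Qed.

Lemma Rpower_S (s p : R) : 0 < s -> Rpower s (1 + p) = s * Rpower s p.
Proof. intros Hs. now rewrite Rpower_plus, Rpower_1. Qed.

Lemma Rpower_le_1 (s p : R) : 1 <= s -> p <= 0 -> Rpower s p <= 1.
Proof.
  intros Hs Hp. unfold Rpower. rewrite <- exp_0.
  destruct (Req_dec s 1) as [->|]; [rewrite ln_1, Rmult_0_r; lra|].
  assert (0 < ln s) by (rewrite <- ln_1; apply ln_increasing; lra).
  destruct (Req_dec p 0) as [->|]; [rewrite Rmult_0_l; lra|].
  left. apply exp_increasing. nra.
Qed.

(** Common majorant of all the absolutely convergent integrals. The rate 1/2 leaves room below
    the decay exp(- s) of the kernel of E_2 at x = 0 for the powers of s that its derivatives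
    produce. *)
Definition weight (xi s : R) : R := Rpower s (- xi) * exp (- s / 2).

Lemma weight_pos (xi s : R) : 0 < weight xi s.
Proof. apply Rmult_lt_0_compat; apply exp_pos. Qed.

Lemma continuous_weight (xi s : R) : 0 < s -> continuous (weight xi) s.
Proof.
  intros Hs. apply continuous_of_derivable.
  unfold weight, Rpower. auto_derive. auto.
Qed.

Lemma exp_ge_quadratic (s : R) : 0 <= s -> 1 + s + s ^ 2 / 2 <= exp s.
Proof.
  intros Hs.
  pose proof (increment_le (fun t => t + t ^ 2 / 2) exp (fun t => 1 + t) exp 0 s Hs) as H.
  cbv beta in H.
  assert (H' : Rabs (s + s ^ 2 / 2 - (0 + 0 ^ 2 / 2)) <= exp s - exp 0).
  { apply H; intros t Ht.
    - auto_derive; auto. field.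
    - apply is_derive_exp.
    - rewrite Rabs_pos_eq by lra. apply exp_ineq1_le. }
  rewrite exp_0 in H'. pose proof (Rle_abs (s + s ^ 2 / 2 - (0 + 0 ^ 2 / 2))). lra.
Qed.

(** One explicit majorant serves near 0 and near +oo: the derivative of a multiple of (s / (1 +
    s))^(1 - xi), which behaves like s^(-xi) at 0 and like s^(-2) at infinity. *)
Lemma has_integral_weight (xi : R) : 0 < xi < 1 -> exists w, has_integral (weight xi) w.
Proof.
  intros Hxi.
  (* The factor 8 comes from (1 + s)^2 <= 8 exp(s/2). *)
  set (e := fun s => 8 * (Rpower (s / (1 + s)) (- xi) / (1 + s) ^ 2)).
  set (E := fun s => 8 / (1 - xi) * Rpower (s / (1 + s)) (1 - xi)).
  assert (He : has_integral e (8 / (1 - xi) - 0)).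
  { apply (has_integral_primitive e E).
    - intros s Hs. apply continuous_of_derivable.
      unfold e, Rpower. auto_derive. repeat split; try lra.
      + nonneg.
      + apply Rgt_not_eq. assert (0 < (1 + s) ^ 2) by nonneg. simpl in *; lra.
    - intros s Hs. unfold E, e.
      assert (Hq : 0 < s / (1 + s)) by nonneg.
      evar_last.
      + apply (is_derive_scal (fun t => Rpower (t / (1 + t)) (1 - xi))).
        apply (is_derive_comp (fun u => Rpower u (1 - xi)) (fun t => t / (1 + t))).
        * now apply is_derive_Rpower.
        * auto_derive; [lra|]. reflexivity.
      + unfold scal; simpl; unfold mult; simpl.
        replace (1 - xi - 1) with (- xi) by ring. field. lra.
    - assert (Hxi1 : 0 < 1 - xi) by lra.
      apply (filterlim_0_dominated E (fun s => Rpower s (1 - xi)) (8 / (1 - xi)));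
        [|now apply Rpower_lim_0].
      apply (filter_imp (fun s => 0 < s < 1)); [|apply at_right_pos; lra].
      intros x Hx. unfold E.
      assert (0 < 8 / (1 - xi)) by nonneg.
      rewrite Rabs_pos_eq by nonneg.
      mono_l. apply Rle_Rpower_l; [lra|].
      split; [nonneg|]. apply Rle_div_l; nra.
    - unfold E.
      assert (Hlim : is_lim (fun s => s / (1 + s)) p_infty 1).
      { apply (is_lim_ext_loc (fun s => 1 - / (1 + s))).
        - exists 0. intros s Hs. field. lra.
        - replace (Finite 1) with (Finite (1 - 0)) by (f_equal; ring).
          apply is_lim_minus'. apply is_lim_const.
          replace (Finite 0) with (Rbar_inv p_infty) by reflexivity.
          apply is_lim_inv; [|discriminate].
          apply (is_lim_plus _ _ _ 1 p_infty); [apply is_lim_const|apply is_lim_id|reflexivity]. }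
      assert (H1 : Rpower 1 (1 - xi) = 1).
      { unfold Rpower. rewrite ln_1, Rmult_0_r. apply exp_0. }
      apply (filterlim_comp _ _ _ (fun s => s / (1 + s))
        (fun u => 8 / (1 - xi) * Rpower u (1 - xi)) _ (locally 1)); [exact Hlim|].
      replace (locally (8 / (1 - xi))) with (locally (8 / (1 - xi) * Rpower 1 (1 - xi)))
        by (rewrite H1, Rmult_1_r; reflexivity).
      apply (ex_derive_continuous (K := R_AbsRing) (V := R_NormedModule)
        (fun u => 8 / (1 - xi) * Rpower u (1 - xi)) 1).
      unfold Rpower. auto_derive. lra. }
  apply (has_integral_dominated (weight xi) e _ (continuous_weight xi) He).
  intros s Hs. rewrite Rabs_pos_eq by (left; apply weight_pos).
  unfold weight, e.
  assert (Hq : 0 < s / (1 + s)) by nonneg.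
  assert (Hp : Rpower s (- xi) <= Rpower (s / (1 + s)) (- xi)).
  { rewrite !Rpower_Ropp. apply Rinv_le_contravar; [apply exp_pos|].
    apply Rle_Rpower_l; [lra|]. split; auto.
    apply Rle_div_l; nra. }
  assert (Hexp : exp (- s / 2) <= 8 / (1 + s) ^ 2).
  { pose proof (exp_ge_quadratic (s / 2)). replace (- s / 2) with (- (s / 2)) by field.
    rewrite exp_Ropp. pose proof (exp_pos (s / 2)).
    assert (0 < (1 + s) ^ 2) by nonneg.
    replace (8 / (1 + s) ^ 2) with (/ ((1 + s) ^ 2 / 8)) by (field; lra).
    apply Rinv_le_contravar; nra. }
  replace (8 * (Rpower (s / (1 + s)) (- xi) / (1 + s) ^ 2))
    with (Rpower (s / (1 + s)) (- xi) * (8 / (1 + s) ^ 2)) by (field; lra).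
  apply Rmult_le_compat; auto; nonneg.
Qed.

Definition tame (xi : R) (f : R -> R) : Prop :=
  (forall s, 0 < s -> continuous f s) /\
  exists C, forall s, 0 < s -> Rabs (f s) <= C * weight xi s.

Lemma tame_has_integral (xi : R) (f : R -> R) :
  0 < xi < 1 -> tame xi f -> has_integral f (int_pos f).
Proof.
  intros Hxi [Hf [C HC]]. destruct (has_integral_weight xi Hxi) as [w Hw].
  destruct (has_integral_dominated f (fun s => C * weight xi s + 0 * weight xi s) (C * w + 0 * w))
    as [l Hl]; auto.
  - now apply has_integral_lincomb.
  - intros s Hs. rewrite Rmult_0_l, Rplus_0_r. auto.
  - now rewrite (proj2 (has_integral_correct f l Hl)).
Qed.

Lemma tame_weight (xi : R) : tame xi (weight xi).
Proof.
  split; [apply continuous_weight|]. exists 1. intros s _.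
  rewrite Rabs_pos_eq by (left; apply weight_pos). lra.
Qed.

Lemma tame_bound (xi C : R) (f : R -> R) :
  0 < xi < 1 -> tame xi f -> (forall s, 0 < s -> Rabs (f s) <= C * weight xi s) ->
  Rabs (int_pos f) <= C * int_pos (weight xi).
Proof.
  intros Hxi Hf HC.
  apply (has_integral_compare f (fun s => C * weight xi s + 0 * weight xi s)).
  - now apply (tame_has_integral xi).
  - replace (C * int_pos (weight xi))
      with (C * int_pos (weight xi) + 0 * int_pos (weight xi)) by ring.
    apply has_integral_lincomb; apply (tame_has_integral xi); auto using tame_weight.
  - intros s Hs. rewrite Rmult_0_l, Rplus_0_r. auto.
Qed.

Lemma int_pos_weight_pos (xi : R) : 0 < xi < 1 -> 0 < int_pos (weight xi).
Proof.
  intros Hxi. apply (has_integral_pos (weight xi)).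
  - apply (tame_has_integral xi); auto using tame_weight.
  - intros; apply weight_pos.
Qed.

(** Differentiation under the integral sign, in quantitative form: a bound on the second
    derivative of the kernel in the parameter bounds the remainder by a multiple of (y - x)^2.
    The points x and y may be ends of the parameter interval, which is needed for E_2 at 0. *)
Lemma integral_taylor_quadratic (xi : R) (K K1 K2 : R -> R -> R) (C x y : R) :
  0 < xi < 1 -> tame xi (K x) -> tame xi (K y) -> tame xi (K1 x) ->
  (forall t s, Rmin x y <= t <= Rmax x y -> 0 < s ->
     is_derive (fun t => K t s) t (K1 t s) /\ is_derive (fun t => K1 t s) t (K2 t s) /\
     Rabs (K2 t s) <= C * weight xi s) ->
  Rabs (int_pos (K y) - int_pos (K x) - (y - x) * int_pos (K1 x))
    <= C * int_pos (weight xi) * (y - x) ^ 2.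
Proof.
  intros Hxi Hx Hy H1 H.
  set (D := fun s => 1 * (1 * K y s + -1 * K x s) + (- (y - x)) * K1 x s).
  assert (HD : has_integral D (1 * (1 * int_pos (K y) + -1 * int_pos (K x))
                 + (- (y - x)) * int_pos (K1 x))).
  { apply (has_integral_lincomb (fun s => 1 * K y s + -1 * K x s)).
    - apply has_integral_lincomb; now apply (tame_has_integral xi).
    - now apply (tame_has_integral xi). }
  replace (int_pos (K y) - int_pos (K x) - (y - x) * int_pos (K1 x))
    with (1 * (1 * int_pos (K y) + -1 * int_pos (K x)) + (- (y - x)) * int_pos (K1 x)) by ring.
  apply (has_integral_compare D
    (fun s => C * (y - x) ^ 2 * weight xi s + 0 * weight xi s)); auto.
  - replace (C * int_pos (weight xi) * (y - x) ^ 2)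
      with (C * (y - x) ^ 2 * int_pos (weight xi) + 0 * int_pos (weight xi)) by ring.
    apply has_integral_lincomb; apply (tame_has_integral xi); auto using tame_weight.
  - intros s Hs. unfold D.
    replace (1 * (1 * K y s + -1 * K x s) + - (y - x) * K1 x s)
      with (K y s - K x s - (y - x) * K1 x s) by ring.
    replace (C * (y - x) ^ 2 * weight xi s + 0 * weight xi s)
      with (C * weight xi s * (y - x) ^ 2) by ring.
    apply (taylor_quadratic (fun t => K t s) (fun t => K1 t s) (fun t => K2 t s)).
    intros t Ht. now apply H.
Qed.

Lemma difference_quotient_quadratic (F : R -> R) (x y l C eps : R) :
  y <> x -> Rabs (F y - F x - (y - x) * l) <= C * (y - x) ^ 2 ->
  Rabs (y - x) < eps / (Rabs C + 1) -> Rabs ((F y - F x) / (y - x) - l) < eps.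
Proof.
  intros Hyx H Hh.
  pose proof (Rabs_pos C) as HC.
  replace ((F y - F x) / (y - x) - l) with ((F y - F x - (y - x) * l) / (y - x)) by (field; lra).
  rewrite Rabs_div by lra.
  assert (Hpos : 0 < Rabs (y - x)) by (apply Rabs_pos_lt; lra).
  apply Rmult_lt_reg_r with (Rabs (y - x)); auto.
  unfold Rdiv. rewrite Rmult_assoc, Rinv_l, Rmult_1_r by lra.
  eapply Rle_lt_trans; [exact H|].
  rewrite <- (pow2_abs (y - x)).
  assert (Rabs (y - x) * (Rabs C + 1) < eps).
  { apply Rmult_lt_reg_r with (/ (Rabs C + 1)); [apply Rinv_0_lt_compat; lra|].
    rewrite Rmult_assoc, Rinv_r, Rmult_1_r by lra. exact Hh. }
  pose proof (Rle_abs C). nra.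
Qed.

Lemma is_derive_quadratic (F : R -> R) (x l C r : R) :
  0 < r ->
  (forall y, Rabs (y - x) < r -> Rabs (F y - F x - (y - x) * l) <= C * (y - x) ^ 2) ->
  is_derive F x l.
Proof.
  intros Hr H. apply is_derive_Reals. intros eps Heps.
  pose proof (Rabs_pos C) as HC.
  assert (Hd : 0 < Rmin r (eps / (Rabs C + 1))).
  { apply Rmin_pos; [lra|]. nonneg. }
  exists (mkposreal _ Hd). simpl. intros h Hh0 Hh.
  pose proof (Rmin_l r (eps / (Rabs C + 1))). pose proof (Rmin_r r (eps / (Rabs C + 1))).
  pose proof (difference_quotient_quadratic F x (x + h) l C eps) as Hq.
  replace (x + h - x) with h in Hq by ring. apply Hq; try lra.
  specialize (H (x + h)). replace (x + h - x) with h in H by ring. apply H; lra.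
Qed.

(** * Integrals along rays and the differential equation *)

(** Real part of exp(i de) s^n exp(- s^3/3 + z s) s^(-xi) at z = th exp(i om). *)
Definition ray_kernel (xi : R) (n : nat) (om de th s : R) : R :=
  s ^ n * (exp (- s ^ 3 / 3 + th * s * cos om) * cos (th * s * sin om + de)) * Rpower s (- xi).

Definition ray_integral (xi : R) (n : nat) (om de th : R) : R :=
  int_pos (ray_kernel xi n om de th).

(** For s <= 1 + 3 N the linear part of the exponent is bounded; beyond, the cube dominates it. *)
Lemma pow_exp_cubic_le (n : nat) (M : R) :
  exists C, forall s, 0 <= s -> s ^ n * exp (- s ^ 3 / 3 + M * s) <= C * exp (- s / 2).
Proof.
  (* Of the extra 3/2, one unit pays for s^n <= n! exp s and a half for the decay exp(- s/2). *)
  set (N := Rabs M + 3 / 2).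
  assert (HN : 1 <= N) by (unfold N; pose proof (Rabs_pos M); lra).
  exists (INR (fact n) * exp (N * (1 + 3 * N))). intros s Hs.
  assert (Hq : - s ^ 3 / 3 + M * s <= N * (1 + 3 * N) - s - s / 2).
  { assert (Hc : N * s - s ^ 3 / 3 <= N * (1 + 3 * N)).
    { destruct (Rle_dec s (1 + 3 * N)).
      - assert (0 <= s ^ 3) by (apply pow_le; auto). nra.
      - assert (3 * N < s * s) by nra. nra. }
    assert (M * s <= Rabs M * s) by (apply Rmult_le_compat_r; auto; apply Rle_abs).
    unfold N in *. nra. }
  apply Rle_trans with (INR (fact n) * exp s * exp (N * (1 + 3 * N) - s - s / 2)).
  - apply Rmult_le_compat.
    + now apply pow_le.
    + nonneg.
    + now apply pow_le_fact_exp.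
    + now apply exp_le_compat.
  - right. rewrite !Rmult_assoc, <- !exp_plus. do 2 f_equal. field.
Qed.

Lemma Rabs_cos_le (x : R) : Rabs (cos x) <= 1.
Proof. apply Rabs_le, COS_bound. Qed.

Lemma ray_kernel_abs_le (xi : R) (n : nat) (om de th M s : R) :
  0 < s -> Rabs th <= M ->
  Rabs (ray_kernel xi n om de th s) <= s ^ n * exp (- s ^ 3 / 3 + M * s) * Rpower s (- xi).
Proof.
  intros Hs HM. unfold ray_kernel.
  rewrite !Rabs_mult.
  rewrite (Rabs_pos_eq (s ^ n)) by (apply pow_le; lra).
  rewrite (Rabs_pos_eq (exp _)) by nonneg.
  rewrite (Rabs_pos_eq (Rpower _ _)) by nonneg.
  mono_r.
  apply Rmult_le_compat_l; [apply pow_le; lra|].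
  rewrite <- (Rmult_1_r (exp (_ + M * s))).
  apply Rmult_le_compat; [nonneg|apply Rabs_pos| |apply Rabs_cos_le].
  apply exp_le_compat. apply Rplus_le_compat_l.
  replace (th * s * cos om) with ((th * cos om) * s) by ring.
  mono_r.
  eapply Rle_trans; [apply Rle_abs|]. rewrite Rabs_mult.
  pose proof (Rabs_cos_le om). pose proof (Rabs_pos th). pose proof (Rabs_pos (cos om)). nra.
Qed.

Lemma ray_kernel_dominated (xi : R) (n : nat) (M : R) :
  exists C, forall om de th s, 0 < s -> Rabs th <= M ->
    Rabs (ray_kernel xi n om de th s) <= C * weight xi s.
Proof.
  destruct (pow_exp_cubic_le n M) as [C HC]. exists C. intros om de th s Hs Hth.
  eapply Rle_trans; [now apply ray_kernel_abs_le with (M := M)|].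
  unfold weight. replace (C * (Rpower s (- xi) * exp (- s / 2)))
    with ((C * exp (- s / 2)) * Rpower s (- xi)) by ring.
  mono_r. apply HC; lra.
Qed.

Lemma tame_ray_kernel (xi : R) (n : nat) (om de th : R) : tame xi (ray_kernel xi n om de th).
Proof.
  split.
  - intros s Hs. apply continuous_of_derivable.
    unfold ray_kernel, Rpower. auto_derive. auto.
  - destruct (ray_kernel_dominated xi n (Rabs th)) as [C HC]. exists C.
    intros s Hs. apply HC; auto. lra.
Qed.

(** A derivative in th multiplies the complex kernel by s exp(i om), hence raises n and adds om
    to the phase. *)
Lemma is_derive_ray_kernel (xi : R) (n : nat) (om de th s : R) :
  is_derive (fun t => ray_kernel xi n om de t s) th (ray_kernel xi (S n) om (de + om) th s).
Proof.
  unfold ray_kernel. generalize (Rpower s (- xi)) as w. intros w.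
  rewrite <- (Rplus_assoc (th * s * sin om)), cos_plus.
  simpl (s ^ S n). generalize (s ^ n) as p. intros p. generalize (- s ^ 3 / 3) as c. intros c.
  auto_derive; auto. ring.
Qed.

Lemma is_derive_ray_integral (xi : R) (n : nat) (om de th : R) :
  0 < xi < 1 ->
  is_derive (ray_integral xi n om de) th (ray_integral xi (S n) om (de + om) th).
Proof.
  intros Hxi.
  destruct (ray_kernel_dominated xi (S (S n)) (Rabs th + 1)) as [C HC].
  apply is_derive_quadratic with (C * int_pos (weight xi)) 1; [lra|]. intros y Hy.
  apply (integral_taylor_quadratic xi (ray_kernel xi n om de) (ray_kernel xi (S n) om (de + om))
    (ray_kernel xi (S (S n)) om (de + om + om))); auto using tame_ray_kernel.
  intros t s Ht Hs. split; [|split]; auto using is_derive_ray_kernel.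
  apply HC; auto. pose proof (Rabs_between _ _ _ Ht).
  pose proof (Rabs_triang th (t - th)). replace (th + (t - th)) with t in * by ring. lra.
Qed.

Lemma weight_lim_infty (xi : R) : 0 < xi -> filterlim (weight xi) (Rbar_locally p_infty) (locally 0).
Proof.
  intros Hxi. apply filterlim_eps. intros eps Heps.
  exists (Rmax 1 (2 / eps)). intros s Hs.
  pose proof (Rmax_l 1 (2 / eps)). pose proof (Rmax_r 1 (2 / eps)).
  rewrite Rminus_0_r, Rabs_pos_eq by (left; apply weight_pos).
  assert (H1 : Rpower s (- xi) <= 1) by (apply Rpower_le_1; lra).
  assert (H2 : exp (- s / 2) < eps).
  { replace (- s / 2) with (- (s / 2)) by field. rewrite exp_Ropp.
    pose proof (exp_ineq1_le (s / 2)).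
    rewrite <- (Rinv_inv eps). apply Rinv_lt_contravar.
    - apply Rmult_lt_0_compat; [now apply Rinv_0_lt_compat|apply exp_pos].
    - assert (/ eps = 2 / eps / 2) by (field; lra). lra. }
  unfold weight. pose proof (exp_pos (- s / 2)). assert (0 < Rpower s (- xi)) by nonneg. nra.
Qed.

(** The derivative in s of s^(1 - xi) exp(- s^3/3 + z s) integrates to 0. The hypothesis on 3
    om says that exp(i om) is a cube root of unity, which makes the third derivative in th
    return to the phase de. *)
Lemma ray_integral_ode (xi om de th : R) :
  0 < xi < 1 -> cos (3 * om) = 1 -> sin (3 * om) = 0 ->
  ray_integral xi 3 om (de + om + om + om) th
    = th * ray_integral xi 1 om (de + om) th + (1 - xi) * ray_integral xi 0 om de th.
Proof.
  intros Hxi Hc Hs.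
  set (f := fun s => 1 * (th * ray_kernel xi 1 om (de + om) th s
                          + (1 - xi) * ray_kernel xi 0 om de th s)
                     + -1 * ray_kernel xi 3 om (de + om + om + om) th s).
  assert (Hf : has_integral f (1 * (th * ray_integral xi 1 om (de + om) th
                          + (1 - xi) * ray_integral xi 0 om de th)
                     + -1 * ray_integral xi 3 om (de + om + om + om) th)).
  { apply (has_integral_lincomb (fun s => th * ray_kernel xi 1 om (de + om) th s
      + (1 - xi) * ray_kernel xi 0 om de th s)); [apply has_integral_lincomb|];
      apply (tame_has_integral xi); auto using tame_ray_kernel. }
  set (B := fun s => s * ray_kernel xi 0 om de th s).
  assert (HB : forall s, B s = ray_kernel xi 1 om de th s).
  { intros s. unfold B, ray_kernel. ring. }
  assert (H0 : has_integral f (0 - 0)).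
  { apply (has_integral_primitive f B).
    - apply Hf.
    - intros s Hs'. unfold B, f, ray_kernel.
      replace (th * s * sin om + (de + om + om + om)) with (th * s * sin om + de + 3 * om) by ring.
      rewrite (cos_plus _ (3 * om)), Hc, Hs.
      rewrite <- (Rplus_assoc (th * s * sin om)), cos_plus.
      evar_last.
      + apply (is_derive_mult (fun s => s) _ s 1); [apply (is_derive_id (K := R_AbsRing))| |apply Rmult_comm].
        apply (is_derive_mult _ (fun s => Rpower s (- xi))); [|now apply is_derive_Rpower|apply Rmult_comm].
        auto_derive; [auto|reflexivity].
      + unfold plus, mult; simpl.
        assert (E : Rpower s (- xi) = s * Rpower s (- xi - 1)).
        { rewrite <- Rpower_S by auto. f_equal; ring. }
        rewrite E. simpl. unfold Rdiv. field.
    - apply (filterlim_0_dominated B (fun s => Rpower s (1 - xi)) (exp (Rabs th))).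
      + apply (filter_imp (fun s => 0 < s < 1)); [|apply at_right_pos; lra].
        intros s Hs'. rewrite HB.
        eapply Rle_trans; [apply ray_kernel_abs_le with (M := Rabs th); lra|].
        rewrite <- (Rpower_1 s) at 1 by lra.
        replace (1 - xi) with (1 + - xi) by ring. rewrite Rpower_S by lra.
        rewrite Rpower_1 by lra.
        replace (exp (Rabs th) * (s * Rpower s (- xi)))
          with (s * exp (Rabs th) * Rpower s (- xi)) by ring.
        mono_r.
        rewrite pow_1. mono_l. apply exp_le_compat.
        assert (0 <= s ^ 3) by (apply pow_le; lra).
        pose proof (Rabs_pos th). nra.
      + apply Rpower_lim_0; lra.
    - destruct (ray_kernel_dominated xi 1 (Rabs th)) as [C HC].
      apply (filterlim_0_dominated B (weight xi) C); [|apply weight_lim_infty; lra].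
      exists 0. intros s Hs'. rewrite HB. apply HC; auto; lra. }
  pose proof (has_integral_unique f _ _ Hf H0). lra.
Qed.

Lemma Derive_ray_integral (xi : R) (n : nat) (om de : R) :
  0 < xi < 1 ->
  Derive (ray_integral xi n om de) = ray_integral xi (S n) om (de + om).
Proof.
  intros Hxi. apply functional_extensionality. intros th.
  now apply is_derive_unique, is_derive_ray_integral.
Qed.

Lemma ray_integral_langer (xi om de : R) :
  0 < xi < 1 -> cos (3 * om) = 1 -> sin (3 * om) = 0 ->
  langer_solution xi (ray_integral xi 0 om de).
Proof.
  intros Hxi Hc Hs th. split.
  - intros k Hk. destruct k as [|[|[|[|k]]]]; [exact I| | | |lia]; simpl;
      rewrite ?Derive_ray_integral by auto; eexists; now apply is_derive_ray_integral.
  - simpl. rewrite !Derive_ray_integral by auto. now apply ray_integral_ode.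
Qed.

Lemma La_integrand_ray (xi th : R) : La_integrand xi th = ray_kernel xi 0 0 0 th.
Proof.
  apply functional_extensionality. intros s. unfold La_integrand, ray_kernel.
  rewrite cos_0, sin_0, Rmult_0_r, Rplus_0_r, cos_0, !Rmult_1_r. simpl. ring.
Qed.

Lemma La_ray (xi th : R) : La xi th = ray_integral xi 0 0 0 th.
Proof. unfold La, ray_integral. now rewrite La_integrand_ray. Qed.

Lemma tame_La (xi th : R) : tame xi (La_integrand xi th).
Proof. rewrite La_integrand_ray. apply tame_ray_kernel. Qed.

(** * The function E_2 *)

(** The n-th derivative in x of exp(- s - x s^3/3) s^(-xi). *)
Definition E2_kernel (xi : R) (n : nat) (x s : R) : R :=
  (- s ^ 3 / 3) ^ n * exp (- s - x * s ^ 3 / 3) * Rpower s (- xi).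

Definition E2_deriv (xi : R) (n : nat) (x : R) : R := int_pos (E2_kernel xi n x).

Lemma E2_kernel_dominated (xi : R) (n : nat) :
  exists C, forall x s, 0 <= x -> 0 < s -> Rabs (E2_kernel xi n x s) <= C * weight xi s.
Proof.
  exists (INR (fact (3 * n)) * 2 ^ (3 * n)). intros x s Hx Hs.
  unfold E2_kernel, weight. rewrite !Rabs_mult.
  rewrite (Rabs_pos_eq (exp _)) by nonneg.
  rewrite (Rabs_pos_eq (Rpower _ _)) by nonneg.
  rewrite <- (Rmult_comm (exp (- s / 2))), <- Rmult_assoc.
  mono_r.
  assert (H1 : Rabs ((- s ^ 3 / 3) ^ n) <= 2 ^ (3 * n) * (INR (fact (3 * n)) * exp (s / 2))).
  { rewrite <- RPow_abs.
    apply Rle_trans with ((s ^ 3) ^ n).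
    - apply pow_incr. split; [apply Rabs_pos|].
      assert (0 <= s ^ 3) by (apply pow_le; lra).
      apply Rabs_le; lra.
    - rewrite <- pow_mult.
      replace (s ^ (3 * n)) with (2 ^ (3 * n) * (s / 2) ^ (3 * n))
        by (rewrite <- Rpow_mult_distr; f_equal; field).
      apply Rmult_le_compat_l; [apply pow_le; lra|]. apply pow_le_fact_exp; lra. }
  assert (H2 : exp (- s - x * s ^ 3 / 3) <= exp (- s)).
  { apply exp_le_compat. assert (0 <= s ^ 3) by (apply pow_le; lra). nra. }
  apply Rle_trans with (2 ^ (3 * n) * (INR (fact (3 * n)) * exp (s / 2)) * exp (- s)).
  - apply Rmult_le_compat; auto; [apply Rabs_pos|nonneg].
  - right. replace (exp (- s / 2)) with (exp (s / 2) * exp (- s)); [ring|].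
    rewrite <- exp_plus. f_equal. field.
Qed.

Lemma tame_E2_kernel (xi : R) (n : nat) (x : R) : 0 <= x -> tame xi (E2_kernel xi n x).
Proof.
  intros Hx. split.
  - intros s Hs. apply continuous_of_derivable.
    unfold E2_kernel, Rpower. auto_derive. auto.
  - destruct (E2_kernel_dominated xi n) as [C HC]. exists C. intros; now apply HC.
Qed.

Lemma is_derive_E2_kernel (xi : R) (n : nat) (x s : R) :
  is_derive (fun x => E2_kernel xi n x s) x (E2_kernel xi (S n) x s).
Proof.
  unfold E2_kernel. rewrite <- (tech_pow_Rmult _ n).
  generalize (Rpower s (- xi)) as w. generalize ((- s ^ 3 / 3) ^ n) as p. intros p w.
  auto_derive; auto. simpl. unfold Rdiv, Rminus. field.
Qed.

Lemma E2_deriv_taylor (xi : R) (n : nat) :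
  0 < xi < 1 -> exists C, forall x y, 0 <= x -> 0 <= y ->
  Rabs (E2_deriv xi n y - E2_deriv xi n x - (y - x) * E2_deriv xi (S n) x) <= C * (y - x) ^ 2.
Proof.
  intros Hxi. destruct (E2_kernel_dominated xi (S (S n))) as [C HC].
  exists (C * int_pos (weight xi)). intros x y Hx Hy.
  apply (integral_taylor_quadratic xi (E2_kernel xi n) (E2_kernel xi (S n))
    (E2_kernel xi (S (S n)))); auto using tame_E2_kernel.
  intros t s Ht Hs. split; [|split]; auto using is_derive_E2_kernel.
  apply HC; auto. unfold Rmin in Ht. destruct (Rle_dec x y); lra.
Qed.

Lemma is_derive_E2_deriv (xi : R) (n : nat) (x : R) :
  0 < xi < 1 -> 0 < x -> is_derive (E2_deriv xi n) x (E2_deriv xi (S n) x).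
Proof.
  intros Hxi Hx. destruct (E2_deriv_taylor xi n Hxi) as [C HC].
  apply is_derive_quadratic with C x; auto. intros y Hy. apply Rabs_lt_between in Hy.
  apply HC; lra.
Qed.

Lemma Rpower_mult_base (x y p : R) : 0 < x -> 0 < y -> Rpower (x * y) p = Rpower x p * Rpower y p.
Proof. intros. symmetry. now apply Rpower_mult_distr. Qed.

(** Substitution s = - th tau. *)
Lemma La_eq_E2 (xi th : R) : 0 < xi < 1 -> th < 0 ->
  La xi th = Rpower (- th) (- (1 - xi)) * E2_deriv xi 0 (/ (- th) ^ 3).
Proof.
  intros Hxi Hth.
  assert (Hx : 0 < / (- th) ^ 3) by nonneg.
  pose proof (tame_has_integral xi _ Hxi (tame_E2_kernel xi 0 (/ (- th) ^ 3) ltac:(lra))) as H.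
  apply (has_integral_rescale _ _ (- th) ltac:(lra)) in H.
  apply (fun H => has_integral_lincomb _ _ _ _ (Rpower (- th) xi) 0 H H) in H.
  apply (has_integral_ext _ (La_integrand xi th)) in H.
  - apply has_integral_correct in H. unfold La. rewrite (proj2 H).
    fold (E2_deriv xi 0 (/ (- th) ^ 3)).
    replace (Rpower (- th) xi) with (- th * Rpower (- th) (- (1 - xi))).
    + field. lra.
    + rewrite <- Rpower_S by lra. f_equal. ring.
  - intros s Hs. unfold E2_kernel, La_integrand.
    rewrite Rpower_mult_base by lra.
    replace (- (- th * s) - / (- th) ^ 3 * (- th * s) ^ 3 / 3) with (- s ^ 3 / 3 + th * s)
      by (field; lra).
    rewrite (Rpower_Ropp (- th)). simpl pow. field.
    apply Rgt_not_eq, exp_pos.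
Qed.

Lemma E2_deriv_0 (xi : R) : E2_deriv xi 0 0 = Gamma (1 - xi).
Proof.
  unfold E2_deriv, Gamma. f_equal. apply functional_extensionality. intros s.
  unfold E2_kernel. replace (1 - xi - 1) with (- xi) by ring.
  replace (- s - 0 * s ^ 3 / 3) with (- s) by field. simpl. ring.
Qed.

Lemma Gamma_pos (xi : R) : 0 < xi < 1 -> 0 < Gamma (1 - xi).
Proof.
  intros Hxi. rewrite <- E2_deriv_0.
  apply (has_integral_pos (E2_kernel xi 0 0)).
  - apply (tame_has_integral xi); auto. apply tame_E2_kernel; lra.
  - intros s Hs. unfold E2_kernel. simpl. rewrite Rmult_1_l.
    apply Rmult_lt_0_compat; apply exp_pos.
Qed.

Lemma E2_smooth (xi : R) : 0 < xi < 1 -> smooth_nonneg (E2_deriv xi 0).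
Proof.
  intros Hxi. exists (E2_deriv xi). split; auto.
  intros n x Hx. destruct (E2_deriv_taylor xi n Hxi) as [C HC].
  pose proof (Rabs_pos C) as HC0.
  apply filterlim_locally. intros eps.
  assert (Hd : 0 < eps / (Rabs C + 1)) by (apply Rdiv_lt_0_compat; [apply cond_pos|lra]).
  exists (mkposreal _ Hd). intros y Hy Hyx Hy0.
  unfold ball in *; simpl in *; unfold AbsRing_ball, abs, minus, plus, opp in *; simpl in *.
  apply (difference_quotient_quadratic (E2_deriv xi n) x y _ C); auto.
Qed.

(** With u = s^3/3 this is u^n exp(- x u) <= n! x^(-n). *)
Lemma E2_deriv_bound (xi : R) (n : nat) (x : R) : 0 < xi < 1 -> 0 < x ->
  Rabs (E2_deriv xi n x) <= INR (fact n) / x ^ n * int_pos (weight xi).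
Proof.
  intros Hxi Hx. apply tame_bound; auto.
  { apply tame_E2_kernel; lra. }
  intros s Hs. unfold E2_kernel, weight.
  assert (Hs3 : 0 <= s ^ 3) by (apply pow_le; lra).
  rewrite !Rabs_mult.
  rewrite (Rabs_pos_eq (exp _)) by nonneg.
  rewrite (Rabs_pos_eq (Rpower _ _)) by nonneg.
  rewrite <- (Rmult_comm (exp (- s / 2))), <- Rmult_assoc.
  mono_r.
  replace (- s - x * s ^ 3 / 3) with (- (x * (s ^ 3 / 3)) + - s) by field.
  rewrite exp_plus, <- Rmult_assoc.
  apply Rmult_le_compat.
  - nonneg.
  - nonneg.
  - rewrite <- RPow_abs. replace (Rabs (- s ^ 3 / 3)) with (s ^ 3 / 3).
    2: { replace (- s ^ 3 / 3) with (- (s ^ 3 / 3)) by field.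
         rewrite Rabs_Ropp, Rabs_pos_eq; lra. }
    pose proof (pow_lt x n Hx).
    apply Rmult_le_reg_l with (x ^ n); auto.
    replace (x ^ n * (INR (fact n) / x ^ n)) with (INR (fact n)) by (field; lra).
    rewrite <- Rmult_assoc, <- Rpow_mult_distr.
    set (u := x * (s ^ 3 / 3)). rewrite exp_Ropp.
    assert (0 <= u) by (unfold u; apply Rmult_le_pos; lra).
    apply Rle_div_l; [apply exp_pos|]. now apply pow_le_fact_exp.
  - apply exp_le_compat. lra.
Qed.

(** The derivative in t of the Taylor polynomial at t, evaluated at y, telescopes to a single
    term. The Cauchy form of the remainder allows y on either side of x. *)
Lemma taylor_remainder (D : nat -> R -> R) (x y : R) (n : nat) :
  (forall k t, Rmin x y <= t <= Rmax x y -> is_derive (D k) t (D (S k) t)) ->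
  exists c, Rmin x y <= c <= Rmax x y /\
    D 0%nat y - sum_n (fun k => D k x / INR (fact k) * (y - x) ^ k) n
      = D (S n) c / INR (fact n) * (y - c) ^ n * (y - x).
Proof.
  intros HD.
  set (Phi := fun t => sum_n (fun k => D k t / INR (fact k) * (y - t) ^ k) n).
  assert (HPhi : forall m t, Rmin x y <= t <= Rmax x y ->
    is_derive (fun t => sum_n (fun k => D k t / INR (fact k) * (y - t) ^ k) m) t
      (D (S m) t / INR (fact m) * (y - t) ^ m)).
  { intros m t Ht. induction m as [|m IH].
    - apply (is_derive_ext (D 0%nat)).
      + intros u. rewrite sum_O. simpl. change (D 0%nat u = D 0%nat u / 1 * 1). field.
      + simpl. replace (D 1%nat t / 1 * 1) with (D 1%nat t) by field. now apply HD.
    - apply (is_derive_ext (fun t => sum_n (fun k => D k t / INR (fact k) * (y - t) ^ k) m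
         + D (S m) t / INR (fact (S m)) * (y - t) ^ S m)).
      { intros u. now rewrite sum_Sn. }
      pose proof (INR_fact_lt_0 m). pose proof (INR_fact_lt_0 (S m)) as HSm.
      assert (Hsub : is_derive (fun t => y - t) t (-1)) by (auto_derive; auto; ring).
      evar_last.
      + apply (is_derive_plus (V := R_NormedModule)); [exact IH|].
        apply (is_derive_mult (fun t => D (S m) t / INR (fact (S m))) (fun t => (y - t) ^ S m));
          [| |apply Rmult_comm].
        * apply (is_derive_ext (fun t => / INR (fact (S m)) * D (S m) t)).
          { intros u. apply Rmult_comm. }
          apply (is_derive_scal (D (S m))). now apply HD.
        * apply (is_derive_pow (fun t => y - t) (S m) t (-1) Hsub).
      + change (D (S m) t / INR (fact m) * (y - t) ^ m
          + (/ INR (fact (S m)) * D (S (S m)) t * (y - t) ^ S m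
             + D (S m) t / INR (fact (S m)) * (INR (S m) * -1 * (y - t) ^ m))
          = D (S (S m)) t / INR (fact (S m)) * (y - t) ^ S m).
        rewrite fact_simpl, mult_INR.
        assert (Hm : INR (S m) <> 0) by (apply not_0_INR; lia).
        field. split; [lra|auto]. }
  destruct (mean_value Phi (fun t => D (S n) t / INR (fact n) * (y - t) ^ n) x y) as [c [Hc E]].
  { intros t Ht. now apply HPhi. }
  exists c. split; auto. rewrite <- E. unfold Phi. f_equal.
  clear. induction n as [|n IH].
  - rewrite sum_O. simpl. field.
  - rewrite sum_Sn, <- IH. unfold plus; simpl. rewrite Rminus_diag. ring.
Qed.

(** For |y - x| < x/3 every intermediate point c exceeds 2x/3, so the remainder is at most a
    constant times (n + 1) 2^(-n-1). *)
Lemma E2_analytic (xi x : R) : 0 < xi < 1 -> 0 < x -> real_analytic_at (E2_deriv xi 0) x.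
Proof.
  intros Hxi Hx. exists (fun k => E2_deriv xi k x / INR (fact k)), (x / 3). split; [lra|].
  intros y Hy. apply is_pseries_R.
  set (W := int_pos (weight xi)).
  assert (HW : 0 < W) by now apply int_pos_weight_pos.
  assert (Hrem : forall n, Rabs (sum_n (fun k => E2_deriv xi k x / INR (fact k) * (y - x) ^ k) n
      - E2_deriv xi 0 y) <= W * (INR (S n) * (/ 2) ^ S n)).
  { intros n. apply Rabs_lt_between in Hy.
    assert (Hmin : 2 * x / 3 < Rmin x y) by (apply Rmin_glb_lt; lra).
    destruct (taylor_remainder (E2_deriv xi) x y n) as [c [Hc E]].
    { intros k t Ht. apply is_derive_E2_deriv; auto; lra. }
    rewrite Rabs_minus_sym, E.
    assert (Hc0 : 2 * x / 3 < c) by lra.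
    assert (Hyc : Rabs (y - c) <= x / 3).
    { unfold Rmin, Rmax in Hc. apply Rabs_le. destruct (Rle_dec x y); lra. }
    assert (Hyx : Rabs (y - x) <= x / 3) by (apply Rabs_le; lra).
    pose proof (E2_deriv_bound xi (S n) c Hxi ltac:(lra)) as HB. fold W in HB.
    pose proof (INR_fact_lt_0 n).
    assert (Hcn : 0 < c ^ S n) by nonneg.
    rewrite !Rabs_mult, <- RPow_abs, Rabs_div, (Rabs_pos_eq (INR (fact n))) by lra.
    apply Rle_trans with (INR (fact (S n)) / c ^ S n * W / INR (fact n) * (x / 3) ^ n * (x / 3)).
    - apply Rmult_le_compat; auto using Rabs_pos.
      + nonneg.
      + apply Rmult_le_compat.
        * nonneg.
        * apply pow_le, Rabs_pos.
        * apply Rmult_le_compat_r; auto. nonneg.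
        * apply pow_incr; split; auto using Rabs_pos.
    - rewrite fact_simpl, mult_INR.
      replace (INR (S n) * INR (fact n) / c ^ S n * W / INR (fact n) * (x / 3) ^ n * (x / 3))
        with (W * (INR (S n) * (x / 3 / c) ^ S n)).
      + mono_l. apply Rmult_le_compat_l; [apply pos_INR|].
        apply pow_incr. split; [nonneg|].
        apply Rle_div_l; lra.
      + unfold Rdiv at 1. rewrite Rpow_mult_distr. rewrite pow_inv.
        change ((x / 3) ^ S n) with (x / 3 * (x / 3) ^ n). field. split; lra. }
  apply (is_lim_seq_spec _ (Finite (E2_deriv xi 0 y))).
  intros eps. cbn beta.
  assert (Hlim : is_lim_seq (fun n => W * (INR (S n) * (/ 2) ^ S n)) 0).
  { replace (Finite 0) with (Rbar_mult (Finite W) (Finite 0)) by (simpl; f_equal; ring).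
    apply is_lim_seq_scal_l.
    apply (is_lim_seq_incr_1 (fun n => INR n * (/ 2) ^ n)).
    apply (is_lim_seq_le_le (fun _ => 0) _ (fun n => 3 * (2 / 3) ^ n)).
    - intros n. assert (H2 : 0 < (/ 2) ^ n) by nonneg.
      split; [nonneg|].
      pose proof (poly n (/ 3) ltac:(lra)) as Hb.
      replace (2 / 3) with ((1 + / 3) * / 2) by field.
      rewrite Rpow_mult_distr, <- Rmult_assoc. apply Rmult_le_compat_r; lra.
    - apply is_lim_seq_const.
    - replace (Finite 0) with (Rbar_mult (Finite 3) (Finite 0)) by (simpl; f_equal; ring).
      apply is_lim_seq_scal_l. apply is_lim_seq_geom. rewrite Rabs_pos_eq; lra. }
  apply is_lim_seq_spec in Hlim. destruct (Hlim eps) as [N HN].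
  exists N. intros n Hn. specialize (HN n Hn). specialize (Hrem n).
  eapply Rle_lt_trans; [exact Hrem|]. rewrite Rminus_0_r in HN.
  eapply Rle_lt_trans; [apply Rle_abs|exact HN].
Qed.

Lemma La_asymptotics_minf (xi : R) : 0 < xi < 1 ->
  exists (r : R -> R) (K : R), forall th, th < -1 -> Rabs (r th) <= K * Rabs (/ th ^ 3) /\
    La xi th = Rpower (- th) (- (1 - xi)) * Gamma (1 - xi) * (1 + r th).
Proof.
  intros Hxi. destruct (E2_deriv_taylor xi 0 Hxi) as [C HC].
  pose proof (Gamma_pos xi Hxi) as HG.
  exists (fun th => E2_deriv xi 0 (/ (- th) ^ 3) / Gamma (1 - xi) - 1),
    ((Rabs C + Rabs (E2_deriv xi 1 0)) / Gamma (1 - xi)).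
  intros th Hth. set (x := / (- th) ^ 3).
  assert (Hth3 : 1 <= (- th) ^ 3) by (apply pow_R1_Rle; lra).
  assert (Hx : 0 < x <= 1).
  { unfold x. split; [apply Rinv_0_lt_compat; lra|]. rewrite <- Rinv_1.
    apply Rinv_le_contravar; lra. }
  split.
  - replace (/ th ^ 3) with (- x).
    2: { unfold x. field. lra. }
    rewrite Rabs_Ropp, (Rabs_pos_eq x) by lra.
    specialize (HC 0 x ltac:(lra) ltac:(lra)). rewrite E2_deriv_0, Rminus_0_r in HC.
    replace (E2_deriv xi 0 x / Gamma (1 - xi) - 1)
      with ((E2_deriv xi 0 x - Gamma (1 - xi)) / Gamma (1 - xi)) by (field; lra).
    rewrite Rabs_div, (Rabs_pos_eq (Gamma _)) by lra.
    unfold Rdiv at 2. rewrite Rmult_assoc, (Rmult_comm (/ _)), <- Rmult_assoc.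
    mono_r.
    pose proof (Rabs_triang (E2_deriv xi 0 x - Gamma (1 - xi) - x * E2_deriv xi 1 0)
      (x * E2_deriv xi 1 0)) as HT.
    replace (E2_deriv xi 0 x - Gamma (1 - xi) - x * E2_deriv xi 1 0 + x * E2_deriv xi 1 0)
      with (E2_deriv xi 0 x - Gamma (1 - xi)) in HT by ring.
    rewrite Rabs_mult, (Rabs_pos_eq x) in HT by lra.
    pose proof (Rle_abs C). pose proof (Rabs_pos C).
    assert (C * x ^ 2 <= Rabs C * x).
    { apply Rle_trans with (Rabs C * x ^ 2); [apply Rmult_le_compat_r; nra|].
      apply Rmult_le_compat_l; nra. }
    simpl pow in *. lra.
  - rewrite (La_eq_E2 xi th Hxi) by lra. fold x. field. lra.
Qed.

(** Half of exp(- b s) absorbs the factor s at the price of 2/b; the other half is dominated by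
    the weight because b >= 1. *)
Lemma La_derivative_bound (xi b : R) : 0 < xi < 1 -> 1 <= b ->
  Rabs (ray_integral xi 1 0 0 (- b)) <= 2 / b * int_pos (weight xi).
Proof.
  intros Hxi Hb. apply tame_bound; auto using tame_ray_kernel.
  intros s Hs. unfold ray_kernel, weight. rewrite cos_0, sin_0, Rmult_0_r, Rplus_0_r, cos_0.
  rewrite !Rmult_1_r, pow_1.
  assert (H3 : 0 <= s ^ 3) by (apply pow_le; lra).
  assert (Hexp : exp (- s ^ 3 / 3 + - b * s) <= exp (- (b * s / 2)) * exp (- s / 2)).
  { rewrite <- exp_plus. apply exp_le_compat. nra. }
  rewrite Rabs_pos_eq.
  2: nonneg.
  replace (2 / b * (Rpower s (- xi) * exp (- s / 2)))
    with (2 / b * exp (- s / 2) * Rpower s (- xi)) by ring.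
  mono_r.
  apply Rle_trans with (s * (exp (- (b * s / 2)) * exp (- s / 2))).
  - apply Rmult_le_compat_l; lra.
  - rewrite <- Rmult_assoc. mono_r.
    rewrite exp_Ropp. apply Rle_div_l; [apply exp_pos|].
    pose proof (exp_ineq1_le (b * s / 2)).
    apply Rmult_le_reg_l with (b / 2); [lra|].
    replace (b / 2 * (2 / b * exp (b * s / 2))) with (exp (b * s / 2)) by (field; lra). lra.
Qed.

(** * A potential in logarithmic coordinates *)

(** Continuous partial derivatives give a total derivative: first move u at height v, then v
    above x. *)
Lemma differentiable_of_partials (A p q : R -> R -> R) (x y : R) :
  (forall u v, is_derive (fun u => A u v) u (p u v)) ->
  (forall u v, is_derive (fun v => A u v) v (q u v)) ->
  continuity_2d_pt p x y -> continuity_2d_pt q x y ->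
  differentiable_pt_lim A x y (p x y) (q x y).
Proof.
  intros Hp Hq Cp Cq eps.
  assert (He : 0 < eps / 2) by (pose proof (cond_pos eps); lra).
  destruct (Cp (mkposreal _ He)) as [d1 H1]. destruct (Cq (mkposreal _ He)) as [d2 H2].
  simpl in H1, H2.
  assert (Hd : 0 < Rmin d1 d2) by (apply Rmin_pos; apply cond_pos).
  exists (mkposreal _ Hd). simpl. intros u v Hu Hv.
  pose proof (Rmin_l d1 d2). pose proof (Rmin_r d1 d2).
  destruct (mean_value (fun u => A u v) (fun u => p u v) x u) as [c [Hc Ec]]; [auto|].
  destruct (mean_value (fun v => A x v) (fun v => q x v) y v) as [d [Hd' Ed]]; [auto|].
  replace (A u v - A x y - (p x y * (u - x) + q x y * (v - y)))
    with ((A u v - A x v - p x y * (u - x)) + (A x v - A x y - q x y * (v - y))) by ring.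
  rewrite Ec, Ed.
  replace (p c v * (u - x) - p x y * (u - x)) with ((p c v - p x y) * (u - x)) by ring.
  replace (q x d * (v - y) - q x y * (v - y)) with ((q x d - q x y) * (v - y)) by ring.
  pose proof (Rabs_between _ _ _ Hc). pose proof (Rabs_between _ _ _ Hd').
  assert (Kp : Rabs (p c v - p x y) < eps / 2) by (apply H1; lra).
  assert (Kq : Rabs (q x d - q x y) < eps / 2).
  { apply H2; [|lra]. rewrite Rminus_diag, Rabs_R0. apply cond_pos. }
  eapply Rle_trans; [apply Rabs_triang|]. rewrite !Rabs_mult.
  pose proof (Rmax_l (Rabs (u - x)) (Rabs (v - y))).
  pose proof (Rmax_r (Rabs (u - x)) (Rabs (v - y))).
  pose proof (Rabs_pos (u - x)). pose proof (Rabs_pos (v - y)).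
  set (m := Rmax (Rabs (u - x)) (Rabs (v - y))) in *.
  assert (Rabs (p c v - p x y) * Rabs (u - x) <= eps / 2 * m)
    by (apply Rmult_le_compat; auto using Rabs_pos; lra).
  assert (Rabs (q x d - q x y) * Rabs (v - y) <= eps / 2 * m)
    by (apply Rmult_le_compat; auto using Rabs_pos; lra).
  lra.
Qed.

(** Real part of exp(i de) exp(i (tau^3/3 + th tau)) tau^(-xi) (d tau / d z) for tau = exp z, z
    = r + i f. In the variable z the integrand is entire, so neither the singularity at tau = 0
    nor a branch of tau^(-xi) has to be avoided. Adding PI/2 to de multiplies by i. *)
Definition log_integrand (xi th de r f : R) : R :=
  exp (- (exp r ^ 3 * (cos f ^ 2 * sin f - sin f ^ 3 / 3) + th * exp r * sin f) + (1 - xi) * r)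
  * cos (exp r ^ 3 * (cos f ^ 3 / 3 - cos f * sin f ^ 2) + th * exp r * cos f + (1 - xi) * f + de).

Definition log_integrand_dr (xi th de r f : R) : R :=
  exp (- (exp r ^ 3 * (cos f ^ 2 * sin f - sin f ^ 3 / 3) + th * exp r * sin f) + (1 - xi) * r)
  * ((- (exp r ^ 3 * (3 * cos f ^ 2 * sin f - sin f ^ 3) + th * exp r * sin f) + (1 - xi))
     * cos (exp r ^ 3 * (cos f ^ 3 / 3 - cos f * sin f ^ 2) + th * exp r * cos f + (1 - xi) * f + de)
     - (exp r ^ 3 * (cos f ^ 3 - 3 * cos f * sin f ^ 2) + th * exp r * cos f)
     * sin (exp r ^ 3 * (cos f ^ 3 / 3 - cos f * sin f ^ 2) + th * exp r * cos f + (1 - xi) * f + de)).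

Lemma is_derive_log_integrand_r (xi th de r f : R) :
  is_derive (fun r => log_integrand xi th de r f) r (log_integrand_dr xi th de r f).
Proof.
  unfold log_integrand, log_integrand_dr. auto_derive; auto. simpl. unfold Rdiv, Rminus. field.
Qed.

Lemma cos_quarter_shift (x : R) : cos (x + PI / 2) = - sin x.
Proof. rewrite cos_plus, cos_PI2, sin_PI2. ring. Qed.

Lemma sin_quarter_shift (x : R) : sin (x + PI / 2) = cos x.
Proof. rewrite sin_plus, cos_PI2, sin_PI2. ring. Qed.

(** Cauchy-Riemann: the derivative along i is i times the derivative along 1. *)
Lemma is_derive_log_integrand_f (xi th de r f : R) :
  is_derive (fun f => log_integrand xi th de r f) f (log_integrand_dr xi th (de + PI / 2) r f).
Proof.
  unfold log_integrand, log_integrand_dr.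
  rewrite <- (Rplus_assoc (_ + (1 - xi) * f)), cos_quarter_shift, sin_quarter_shift.
  auto_derive; auto. simpl. unfold Rdiv, Rminus. field.
Qed.

Ltac continuity_2d :=
  repeat first
    [ apply continuity_2d_pt_const
    | apply continuity_2d_pt_id1
    | apply continuity_2d_pt_id2
    | apply continuity_2d_pt_plus
    | apply continuity_2d_pt_minus
    | apply continuity_2d_pt_mult
    | apply continuity_2d_pt_opp
    | apply (continuity_1d_2d_pt_comp exp); [apply derivable_continuous_pt, derivable_pt_exp|]
    | apply (continuity_1d_2d_pt_comp cos); [apply continuity_cos|]
    | apply (continuity_1d_2d_pt_comp sin); [apply continuity_sin|] ].

Lemma continuity_2d_log_integrand (xi th de r f : R) :
  continuity_2d_pt (log_integrand xi th de) r f.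
Proof. unfold log_integrand, Rdiv, pow. continuity_2d. Qed.

Lemma continuity_2d_log_integrand_dr (xi th de r f : R) :
  continuity_2d_pt (log_integrand_dr xi th de) r f.
Proof. unfold log_integrand_dr, Rdiv, pow. continuity_2d. Qed.

(** Real part of a primitive of the entire integrand, obtained by integrating along the real
    axis up to r and then vertically up to height f. Cauchy's theorem is the statement that its
    partial derivatives are the right ones everywhere. *)
Definition potential (xi th de r f : R) : R :=
  RInt (fun t => log_integrand xi th de t 0) 0 r
  + RInt (fun t => log_integrand xi th (de + PI / 2) r t) 0 f.

Lemma continuous_log_integrand_r (xi th de r f : R) :
  continuous (fun r => log_integrand xi th de r f) r.
Proof.
  apply continuous_of_derivable.
  eexists; apply is_derive_log_integrand_r.
Qed.

Lemma continuous_log_integrand_f (xi th de r f : R) :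
  continuous (fun f => log_integrand xi th de r f) f.
Proof.
  apply continuous_of_derivable.
  eexists; apply is_derive_log_integrand_f.
Qed.

Lemma is_derive_RInt_continuous (g : R -> R) (x : R) :
  (forall t, continuous g t) -> is_derive (fun x => RInt g 0 x) x (g x).
Proof.
  intros Hg. apply (is_derive_RInt g (fun x => RInt g 0 x) 0); auto.
  apply filter_forall. intros y. apply (RInt_correct (V := R_CompleteNormedModule)).
  apply ex_RInt_continuous; auto.
Qed.

Lemma is_derive_potential_f (xi th de r f : R) :
  is_derive (fun f => potential xi th de r f) f (log_integrand xi th (de + PI / 2) r f).
Proof.
  unfold potential. evar_last.
  - apply (is_derive_plus (V := R_NormedModule)); [apply is_derive_const|].
    apply (is_derive_RInt_continuous (fun t => log_integrand xi th (de + PI / 2) r t)).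
    intros; apply continuous_log_integrand_f.
  - apply Rplus_0_l.
Qed.

(** Differentiation under the integral over the vertical segment, where the Cauchy-Riemann
    equations turn the r-derivative of the integrand into an f-derivative. *)
Lemma is_derive_potential_r (xi th de r f : R) :
  is_derive (fun r => potential xi th de r f) r (log_integrand xi th de r f).
Proof.
  unfold potential.
  assert (HD : forall de u v, Derive (fun z => log_integrand xi th de z v) u
                       = log_integrand_dr xi th de u v).
  { intros. apply is_derive_unique, is_derive_log_integrand_r. }
  evar_last.
  - apply (is_derive_plus (V := R_NormedModule)).
    + apply (is_derive_RInt_continuous (fun t => log_integrand xi th de t 0)).
      intros; apply continuous_log_integrand_r.
    + apply (is_derive_RInt_param (fun r t => log_integrand xi th (de + PI / 2) r t)).
      * apply filter_forall. intros u t _. eexists; apply is_derive_log_integrand_r.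
      * intros t _. apply (continuity_2d_pt_ext (log_integrand_dr xi th (de + PI / 2))).
        { intros; now rewrite HD. }
        apply continuity_2d_log_integrand_dr.
      * apply filter_forall. intros u. apply (ex_RInt_continuous (V := R_CompleteNormedModule)).
        intros; apply continuous_log_integrand_f.
  - assert (E : RInt (fun t => Derive (fun u => log_integrand xi th (de + PI / 2) u t) r) 0 f
                = log_integrand xi th de r f - log_integrand xi th de r 0).
    { rewrite (RInt_ext _ (fun t => log_integrand_dr xi th (de + PI / 2) r t)).
      2: { intros; apply HD. }
      apply is_RInt_unique.
      apply (is_RInt_derive (V := R_CompleteNormedModule) (fun f => log_integrand xi th de r f)).
      - intros; apply is_derive_log_integrand_f.
      - intros x _. apply continuous_of_derivable.
        unfold log_integrand_dr. auto_derive. auto. }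
    unfold plus; simpl. rewrite E. ring.
Qed.

Lemma is_derive_potential_path (xi th de : R) (r f : R -> R) (t dr df : R) :
  is_derive r t dr -> is_derive f t df ->
  is_derive (fun t => potential xi th de (r t) (f t)) t
    (log_integrand xi th de (r t) (f t) * dr + log_integrand xi th (de + PI / 2) (r t) (f t) * df).
Proof.
  intros Hr Hf. apply is_derive_Reals.
  apply derivable_pt_lim_comp_2d; try (now apply is_derive_Reals).
  apply (differentiable_of_partials _ (log_integrand xi th de) (log_integrand xi th (de + PI / 2)));
    auto using is_derive_potential_r, is_derive_potential_f, continuity_2d_log_integrand.
Qed.

(** * Independence of the ray of integration *)

(** The integrand with respect to s on the ray of argument f, tau = s exp(i f). *)
Definition polar_integrand (xi th de f s : R) : R :=
  exp (- (s ^ 3 * (cos f ^ 2 * sin f - sin f ^ 3 / 3) + th * s * sin f))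
  * cos (s ^ 3 * (cos f ^ 3 / 3 - cos f * sin f ^ 2) + th * s * cos f + (1 - xi) * f + de)
  * Rpower s (- xi).

Lemma log_integrand_ln (xi th de f s : R) : 0 < s ->
  log_integrand xi th de (ln s) f = s * polar_integrand xi th de f s.
Proof.
  intros Hs. unfold log_integrand, polar_integrand. rewrite exp_ln by auto.
  rewrite exp_plus. replace (exp ((1 - xi) * ln s)) with (s * Rpower s (- xi)).
  - ring.
  - rewrite <- Rpower_S by auto. reflexivity.
Qed.

Lemma continuous_polar_integrand (xi th de f s : R) : 0 < s ->
  continuous (polar_integrand xi th de f) s.
Proof.
  intros Hs. apply continuous_of_derivable.
  unfold polar_integrand, Rpower. auto_derive. auto.
Qed.

Lemma is_derive_potential_ray (xi th de f s : R) : 0 < s ->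
  is_derive (fun s => potential xi th de (ln s) f) s (polar_integrand xi th de f s).
Proof.
  intros Hs. evar_last.
  - apply (is_derive_potential_path xi th de ln (fun _ => f) s (/ s) 0).
    + apply is_derive_Reals. now apply derivable_pt_lim_ln.
    + apply (is_derive_const (K := R_AbsRing) (V := R_NormedModule)).
  - rewrite !log_integrand_ln by auto. field. lra.
Qed.

Lemma sin_cos_abs (f : R) : Rabs (sin f) <= 1 /\ Rabs (cos f) <= 1.
Proof. split; apply Rabs_le; [apply SIN_bound|apply COS_bound]. Qed.

Lemma polar_integrand_near_0 (xi th de f s : R) : 0 < s < 1 ->
  Rabs (polar_integrand xi th de f s) <= exp (1 + Rabs th) * Rpower s (- xi).
Proof.
  intros Hs. unfold polar_integrand. rewrite !Rabs_mult.
  rewrite (Rabs_pos_eq (Rpower _ _)) by nonneg.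
  rewrite (Rabs_pos_eq (exp _)) by nonneg.
  mono_r.
  rewrite <- (Rmult_1_r (exp (1 + _))).
  apply Rmult_le_compat; [nonneg|apply Rabs_pos| |apply Rabs_cos_le].
  apply exp_le_compat.
  pose proof (sin2_cos2 f) as H. unfold Rsqr in H. pose proof (SIN_bound f).
  assert (H1 : - 1 <= cos f ^ 2 * sin f - sin f ^ 3 / 3 <= 1).
  { replace (cos f ^ 2) with (1 - sin f * sin f) by (simpl; lra). set (x := sin f) in *.
    split; nra. }
  assert (Hs3 : 0 <= s ^ 3 <= 1).
  { split; [apply pow_le; lra|]. rewrite <- (pow1 3). apply pow_incr; lra. }
  assert (H2 : - Rabs th <= th * s * sin f).
  { assert (Ha : Rabs (th * s * sin f) <= Rabs th).
    { rewrite !Rabs_mult, (Rabs_pos_eq s) by lra.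
      pose proof (Rabs_pos th). destruct (sin_cos_abs f) as [Hsf _].
      pose proof (Rabs_pos (sin f)).
      assert (s * Rabs (sin f) <= 1) by nra. nra. }
    apply Rabs_le_between in Ha. lra. }
  assert (-1 <= s ^ 3 * (cos f ^ 2 * sin f - sin f ^ 3 / 3)) by nra.
  lra.
Qed.

(** These bounds make the real part of i tau^3/3 at most - |tau|^3 sin f / 3 in the sector 0 <=
    f <= pi/4. *)
Lemma sin_cos_sector (f : R) : 0 <= f <= PI / 4 -> 0 <= sin f /\ 1 / 2 <= cos f ^ 2 /\ 1 / 2 <= cos f.
Proof.
  intros Hf. pose proof PI_RGT_0.
  assert (Hs : 0 <= sin f) by (apply sin_ge_0; lra).
  assert (Hc : cos (PI / 4) <= cos f) by (apply cos_decr_1; lra).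
  rewrite cos_PI4 in Hc.
  assert (H2 : 0 < sqrt 2) by nonneg.
  assert (Hq : sqrt 2 * sqrt 2 = 2) by (apply sqrt_sqrt; lra).
  assert (Hp : 0 < 1 / sqrt 2) by nonneg.
  assert (Hpp : 1 / sqrt 2 * (1 / sqrt 2) = 1 / 2).
  { replace (1 / sqrt 2 * (1 / sqrt 2)) with (1 / (sqrt 2 * sqrt 2)) by (field; lra).
    now rewrite Hq. }
  split; [auto|]. split; nra.
Qed.

(** The factor cos f, at least 1/2 in the sector, is inserted to make the bound the derivative
    of an elementary function of f. *)
Lemma log_integrand_sector (xi th de r f : R) : 0 < xi < 1 -> 0 <= r -> 0 <= f <= PI / 4 ->
  Rabs (log_integrand xi th de r f)
    <= 2 * exp r * (cos f * exp (- (exp r * (exp r ^ 2 / 3 - Rabs th)) * sin f)).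
Proof.
  intros Hxi Hr Hf. destruct (sin_cos_sector f Hf) as [Hs [Hc2 Hc]].
  pose proof (sin2_cos2 f) as Hsc. unfold Rsqr in Hsc.
  unfold log_integrand. rewrite Rabs_mult, (Rabs_pos_eq (exp _)) by nonneg.
  set (R0 := exp r) in *. assert (HR0 : 0 < R0) by nonneg.
  apply Rle_trans with (exp (r + - (R0 * (R0 ^ 2 / 3 - Rabs th)) * sin f)).
  - rewrite <- (Rmult_1_r (exp (r + _))).
    apply Rmult_le_compat; [nonneg|apply Rabs_pos| |apply Rabs_cos_le].
    apply exp_le_compat.
    assert (H1 : sin f / 3 <= cos f ^ 2 * sin f - sin f ^ 3 / 3).
    { assert (sin f * sin f <= 1 / 2) by (simpl in Hc2; lra). simpl in *. nra. }
    assert (HR3 : 0 <= R0 ^ 3) by (apply pow_le; lra).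
    assert (H2 : R0 ^ 3 * (sin f / 3) <= R0 ^ 3 * (cos f ^ 2 * sin f - sin f ^ 3 / 3))
      by (apply Rmult_le_compat_l; auto).
    assert (H3 : - Rabs th * (R0 * sin f) <= th * (R0 * sin f)).
    { apply Rmult_le_compat_r; [apply Rmult_le_pos; lra|].
      pose proof (Rle_abs (- th)). rewrite Rabs_Ropp in H. lra. }
    replace (- (R0 * (R0 ^ 2 / 3 - Rabs th)) * sin f)
      with (- (R0 ^ 3 * (sin f / 3)) + Rabs th * (R0 * sin f)) by field.
    nra.
  - rewrite exp_plus. fold R0.
    replace (2 * R0 * (cos f * exp (- (R0 * (R0 ^ 2 / 3 - Rabs th)) * sin f)))
      with (R0 * exp (- (R0 * (R0 ^ 2 / 3 - Rabs th)) * sin f) * (2 * cos f)) by ring.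
    rewrite <- (Rmult_1_r (R0 * exp _)) at 1.
    apply Rmult_le_compat_l; [|lra].
    apply Rmult_le_pos; left; auto; apply exp_pos.
Qed.

(** Jordan's lemma: the contribution of an arc of radius exp r in the sector tends to 0 as r
    grows. *)
Lemma potential_sector (xi th de r f : R) : 0 < xi < 1 -> 0 <= r -> 0 <= f <= PI / 4 ->
  0 < exp r ^ 2 / 3 - Rabs th ->
  Rabs (potential xi th de r f - potential xi th de r 0) <= 2 / (exp r ^ 2 / 3 - Rabs th).
Proof.
  intros Hxi Hr Hf HK. set (k := exp r ^ 2 / 3 - Rabs th) in *.
  assert (HR0 : 0 < exp r) by nonneg.
  pose proof (increment_le (fun f => potential xi th de r f)
    (fun f => - 2 / k * exp (- (exp r * k) * sin f))
    (fun f => log_integrand xi th (de + PI / 2) r f)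
    (fun f => 2 * exp r * (cos f * exp (- (exp r * k) * sin f))) 0 f) as H.
  eapply Rle_trans; [apply H; clear H|].
  - lra.
  - intros; apply is_derive_potential_f.
  - intros t _. auto_derive; auto. field. lra.
  - intros t Ht. apply log_integrand_sector; auto; lra.
  - cbv beta. rewrite sin_0, Rmult_0_r, exp_0.
    assert (0 < 2 / k) by nonneg.
    pose proof (exp_pos (- (exp r * k) * sin f)).
    replace (- 2 / k) with (- (2 / k)) by (field; lra). nra.
Qed.

Definition fresnel_integrand (xi th de s : R) : R :=
  cos (s ^ 3 / 3 + th * s + de) * Rpower s (- xi).

Lemma polar_integrand_0 (xi th de s : R) :
  polar_integrand xi th de 0 s = fresnel_integrand xi th de s.
Proof.
  unfold polar_integrand, fresnel_integrand. rewrite cos_0, sin_0.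
  replace (- (s ^ 3 * (1 ^ 2 * 0 - 0 ^ 3 / 3) + th * s * 0)) with 0 by field.
  replace (s ^ 3 * (1 ^ 3 / 3 - 1 * 0 ^ 2) + th * s * 1 + (1 - xi) * 0 + de)
    with (s ^ 3 / 3 + th * s + de) by field.
  rewrite exp_0. ring.
Qed.

Lemma cos_third_turn : cos (2 * PI / 3) = - / 2.
Proof.
  replace (2 * PI / 3) with (2 * (PI / 3)) by field.
  rewrite cos_2a_cos, cos_PI3. field.
Qed.

Lemma sin_third_turn : sin (2 * PI / 3) = sqrt 3 / 2.
Proof.
  replace (2 * PI / 3) with (2 * (PI / 3)) by field.
  rewrite sin_2a, cos_PI3, sin_PI3. field.
Qed.

Lemma polar_integrand_PI6 (xi th de s : R) :
  polar_integrand xi th de (PI / 6) s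
    = ray_kernel xi 0 (2 * PI / 3) (de + (1 - xi) * (PI / 6)) th s.
Proof.
  unfold polar_integrand, ray_kernel. rewrite cos_PI6, sin_PI6, cos_third_turn, sin_third_turn.
  assert (H3 : sqrt 3 * sqrt 3 = 3) by (apply sqrt_sqrt; lra).
  replace (s ^ 3 * ((sqrt 3 / 2) ^ 2 * (1 / 2) - (1 / 2) ^ 3 / 3))
    with (s ^ 3 * (sqrt 3 * sqrt 3 / 8 - 1 / 24)) by field. rewrite H3.
  replace (s ^ 3 * ((sqrt 3 / 2) ^ 3 / 3 - sqrt 3 / 2 * (1 / 2) ^ 2))
    with (s ^ 3 * (sqrt 3 / 8 * (sqrt 3 * sqrt 3 / 3 - 1))) by field. rewrite H3.
  replace (- (s ^ 3 * (3 / 8 - 1 / 24) + th * s * (1 / 2))) with (- s ^ 3 / 3 + th * s * - / 2)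
    by field.
  replace (s ^ 3 * (sqrt 3 / 8 * (3 / 3 - 1)) + th * s * (sqrt 3 / 2) + (1 - xi) * (PI / 6) + de)
    with (th * s * (sqrt 3 / 2) + (de + (1 - xi) * (PI / 6))) by field.
  simpl. ring.
Qed.

(** The potential has one limit A0 at tau = 0 along all rays and one limit L at infinity along
    all paths that end in the sector 0 <= f <= pi/4. The integral L - A0 along such paths is
    computed on the ray of argument pi/6, where it converges absolutely. *)
Lemma potential_limits (xi th de : R) : 0 < xi < 1 ->
  exists A0 L : R,
    L - A0 = ray_integral xi 0 (2 * PI / 3) (de + (1 - xi) * (PI / 6)) th /\
    (forall f, filterlim (fun s => potential xi th de (ln s) f) (at_right 0) (locally A0)) /\
    (forall r f : R -> R, filterlim r (Rbar_locally p_infty) (Rbar_locally p_infty) ->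
       Rbar_locally p_infty (fun t => 0 <= f t <= PI / 4) ->
       filterlim (fun t => potential xi th de (r t) (f t)) (Rbar_locally p_infty) (locally L)).
Proof.
  intros Hxi. pose proof PI_RGT_0 as HPI.
  (* The primitive along the ray of angle PI/6 converges at both ends: its integrand is tame. *)
  pose proof (tame_has_integral xi _ Hxi
    (tame_ray_kernel xi 0 (2 * PI / 3) (de + (1 - xi) * (PI / 6)) th)) as [_ [B [HB [HB0 HB1]]]].
  fold (ray_integral xi 0 (2 * PI / 3) (de + (1 - xi) * (PI / 6)) th) in HB1.
  set (T := ray_integral xi 0 (2 * PI / 3) (de + (1 - xi) * (PI / 6)) th) in *.
  set (A0 := potential xi th de (ln 1) (PI / 6) - B 1).
  assert (HBA : forall s, 0 < s -> potential xi th de (ln s) (PI / 6) = A0 + B s).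
  { intros s Hs.
    pose proof (primitives_differ (fun s => potential xi th de (ln s) (PI / 6)) B
      (polar_integrand xi th de (PI / 6)) s) as H. cbv beta in H. fold A0 in H.
    rewrite <- H; auto; [ring| |].
    - intros; now apply is_derive_potential_ray.
    - intros t Ht. rewrite polar_integrand_PI6. now apply HB. }
  assert (HA0 : forall f, filterlim (fun s => potential xi th de (ln s) f) (at_right 0) (locally A0)).
  { intros f.
    assert (Hd : filterlim (fun s => potential xi th de (ln s) f - (A0 + B s)) (at_right 0) (locally 0)).
    { apply (filterlim_0_dominated _ (fun s => Rpower s (1 - xi)) (exp (1 + Rabs th) * Rabs (f - PI / 6)));
        [|apply Rpower_lim_0; lra].
      apply (filter_imp (fun s => 0 < s < 1)); [|apply at_right_pos; lra].
      intros s Hs. rewrite <- HBA by lra.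
      destruct (mean_value (fun f => potential xi th de (ln s) f)
        (fun f => log_integrand xi th (de + PI / 2) (ln s) f) (PI / 6) f) as [c [Hc ->]].
      { intros; apply is_derive_potential_f. }
      rewrite log_integrand_ln, !Rabs_mult, (Rabs_pos_eq s) by lra.
      replace (1 - xi) with (1 + - xi) by ring. rewrite Rpower_S by lra.
      replace (exp (1 + Rabs th) * Rabs (f - PI / 6) * (s * Rpower s (- xi)))
        with (s * (exp (1 + Rabs th) * Rpower s (- xi)) * Rabs (f - PI / 6)) by ring.
      mono_r.
      mono_l. now apply polar_integrand_near_0. }
    apply (filterlim_lincomb_ext _ (fun s => potential xi th de (ln s) f - (A0 + B s))
      (fun s => A0 + B s) _ 0 A0 1 1); [intros; ring|ring|exact Hd|].
    apply (filterlim_lincomb_ext _ (fun _ => 1) B _ 1 0 A0 1);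
      [intros; ring|ring|apply filterlim_const|exact HB0]. }
  exists A0, (A0 + T). split; [ring|]. split; [exact HA0|].
  intros r f Hr Hf. apply filterlim_eps. intros eps Heps0.
  assert (He : 0 < eps / 3) by lra.
  pose proof (proj1 (filterlim_eps B T) HB1 (eps / 3) He) as [M0 HM0].
  set (M := Rmax M0 1).
  assert (HrM : Rbar_locally p_infty (fun t => Rmax (ln M) (ln (1 + 3 * (Rabs th + 6 / eps)) + 1) < r t)).
  { apply Hr. now exists (Rmax (ln M) (ln (1 + 3 * (Rabs th + 6 / eps)) + 1)). }
  eapply filter_imp; [|exact (filter_and _ _ HrM Hf)].
  intros t [Ht Hft]. cbv beta in Ht.
  pose proof (Rmax_l (ln M) (ln (1 + 3 * (Rabs th + 6 / eps)) + 1)).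
  pose proof (Rmax_r (ln M) (ln (1 + 3 * (Rabs th + 6 / eps)) + 1)).
  assert (Heps : 0 < 6 / eps) by nonneg.
  assert (HM1 : M0 <= M /\ 1 <= M) by (unfold M; split; [apply Rmax_l|apply Rmax_r]).
  set (R0 := exp (r t)).
  assert (HR0M : M < R0).
  { unfold R0. rewrite <- (exp_ln M) by lra. apply exp_increasing. lra. }
  assert (HR0 : 1 + 3 * (Rabs th + 6 / eps) < R0).
  { pose proof (Rabs_pos th). unfold R0.
    rewrite <- (exp_ln (1 + 3 * (Rabs th + 6 / eps))) by lra. apply exp_increasing. lra. }
  assert (Hr0 : 0 <= r t).
  { left. apply exp_lt_inv. rewrite exp_0. fold R0. lra. }
  assert (HK : 6 / eps < exp (r t) ^ 2 / 3 - Rabs th).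
  { fold R0. pose proof (Rabs_pos th). nra. }
  assert (Hsec : forall f, 0 <= f <= PI / 4 ->
    Rabs (potential xi th de (r t) f - potential xi th de (r t) 0) < eps / 3).
  { intros g Hg. eapply Rle_lt_trans; [apply potential_sector; auto; lra|].
    replace (eps / 3) with (2 / (6 / eps)) by (field; lra).
    unfold Rdiv at 1 3. apply Rmult_lt_compat_l; [lra|].
    apply Rinv_lt_contravar; auto. apply Rmult_lt_0_compat; lra. }
  pose proof (Hsec (f t) Hft) as H1. pose proof (Hsec (PI / 6) ltac:(lra)) as H2.
  assert (H3 : Rabs (B R0 - T) < eps / 3).
  { apply (HM0 R0). lra. }
  assert (H4 : potential xi th de (r t) (PI / 6) = A0 + B R0).
  { rewrite <- HBA by nonneg. unfold R0. now rewrite ln_exp. }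
  apply Rabs_lt_between in H1. apply Rabs_lt_between in H2. apply Rabs_lt_between in H3.
  apply Rabs_lt_between. lra.
Qed.

Lemma filterlim_ln_p : filterlim ln (Rbar_locally p_infty) (Rbar_locally p_infty).
Proof. apply is_lim_ln_p. Qed.

Lemma has_integral_fresnel (xi th de : R) : 0 < xi < 1 ->
  has_integral (fresnel_integrand xi th de)
    (ray_integral xi 0 (2 * PI / 3) (de + (1 - xi) * (PI / 6)) th).
Proof.
  intros Hxi. pose proof PI_RGT_0.
  destruct (potential_limits xi th de Hxi) as [A0 [L [<- [H0 H1]]]].
  apply (has_integral_ext (polar_integrand xi th de 0)).
  { intros; apply polar_integrand_0. }
  apply (has_integral_primitive _ (fun s => potential xi th de (ln s) 0)).
  - intros; now apply continuous_polar_integrand.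
  - intros; now apply is_derive_potential_ray.
  - apply H0.
  - apply (H1 ln (fun _ => 0)); [apply filterlim_ln_p|].
    apply filter_forall. intros; lra.
Qed.

(** * Paths through the saddle points *)

(** The chain rule along a straight line tau = X + i Y with direction m exp(i mu), after the
    polar factors have been recombined. *)
Lemma is_derive_potential_cartesian (xi th de : R) (r f : R -> R) (t X Y m mu : R) :
  X = exp (r t) * cos (f t) -> Y = exp (r t) * sin (f t) ->
  is_derive r t ((X * (m * cos mu) + Y * (m * sin mu)) / (X ^ 2 + Y ^ 2)) ->
  is_derive f t ((X * (m * sin mu) - Y * (m * cos mu)) / (X ^ 2 + Y ^ 2)) ->
  is_derive (fun t => potential xi th de (r t) (f t)) t
    (m * (exp (- (X ^ 2 * Y - Y ^ 3 / 3 + th * Y)) * Rpower (X ^ 2 + Y ^ 2) (- xi / 2)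
     * cos (X ^ 3 / 3 - X * Y ^ 2 + th * X - xi * f t + mu + de))).
Proof.
  intros HX HY Hr Hf. evar_last; [apply (is_derive_potential_path xi th de r f t _ _ Hr Hf)|].
  assert (HQ : X ^ 2 + Y ^ 2 = exp (r t) * exp (r t)).
  { pose proof (sin2_cos2 (f t)) as H. unfold Rsqr in H. rewrite HX, HY.
    replace ((exp (r t) * cos (f t)) ^ 2 + (exp (r t) * sin (f t)) ^ 2)
      with (exp (r t) * exp (r t) * (sin (f t) * sin (f t) + cos (f t) * cos (f t))) by ring.
    rewrite H. ring. }
  rewrite HQ.
  replace (Rpower (exp (r t) * exp (r t)) (- xi / 2)) with (exp (- xi * r t)).
  2: { unfold Rpower. rewrite <- exp_plus, ln_exp. f_equal. field. }
  unfold log_integrand.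
  set (E := - (X ^ 2 * Y - Y ^ 3 / 3 + th * Y)).
  set (Th := X ^ 3 / 3 - X * Y ^ 2 + th * X).
  replace (- (exp (r t) ^ 3 * (cos (f t) ^ 2 * sin (f t) - sin (f t) ^ 3 / 3)
     + th * exp (r t) * sin (f t)) + (1 - xi) * r t) with (E + - xi * r t + r t)
    by (unfold E; rewrite HX, HY; field).
  replace (exp (r t) ^ 3 * (cos (f t) ^ 3 / 3 - cos (f t) * sin (f t) ^ 2)
     + th * exp (r t) * cos (f t) + (1 - xi) * f t + (de + PI / 2))
    with (Th + (1 - xi) * f t + de + PI / 2) by (unfold Th; rewrite HX, HY; field).
  replace (exp (r t) ^ 3 * (cos (f t) ^ 3 / 3 - cos (f t) * sin (f t) ^ 2)
     + th * exp (r t) * cos (f t) + (1 - xi) * f t + de)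
    with (Th + (1 - xi) * f t + de) by (unfold Th; rewrite HX, HY; field).
  rewrite cos_quarter_shift.
  replace (Th - xi * f t + mu + de) with (Th + (1 - xi) * f t + de + (mu - f t)) by ring.
  rewrite (cos_plus _ (mu - f t)), cos_minus, sin_minus.
  rewrite !exp_plus, HX, HY. pose proof (exp_pos (r t)). field. lra.
Qed.

Lemma exp_half_ln (z : R) : 0 < z -> exp (ln z / 2) = sqrt z.
Proof.
  intros Hz. rewrite <- Rpower_sqrt by auto. unfold Rpower. f_equal. field.
Qed.

Lemma polar_atan (d t : R) : 0 < d ->
  sqrt (d ^ 2 + t ^ 2) * cos (atan (t / d)) = d /\ sqrt (d ^ 2 + t ^ 2) * sin (atan (t / d)) = t.
Proof.
  intros Hd. rewrite cos_atan, sin_atan.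
  assert (H : sqrt (d ^ 2 + t ^ 2) = d * sqrt (1 + (t / d)²)).
  { rewrite <- (sqrt_pow2 d) at 2 by lra. rewrite <- sqrt_mult.
    - f_equal. unfold Rsqr. field. lra.
    - apply pow2_ge_0.
    - pose proof (Rle_0_sqr (t / d)). lra. }
  assert (0 < sqrt (1 + (t / d)²)) by (apply sqrt_lt_R0; pose proof (Rle_0_sqr (t / d)); lra).
  rewrite H. split; field; lra.
Qed.

(** The integrand on the line tau = x + i a for th = a^2, with the saddle at x = 0. *)
Definition up_integrand (xi a de x : R) : R :=
  exp (- (a * x ^ 2 + 2 * a ^ 3 / 3)) * Rpower (x ^ 2 + a ^ 2) (- xi / 2)
  * cos (x ^ 3 / 3 + xi * atan (x / a) - xi * PI / 2 + de).

Lemma filterlim_half_ln (Q : R -> R) :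
  Rbar_locally p_infty (fun x => x ^ 2 <= Q x) ->
  filterlim (fun x => ln (Q x) / 2) (Rbar_locally p_infty) (Rbar_locally p_infty).
Proof.
  intros HQ. apply (filterlim_ge_p_infty ln); [|apply filterlim_ln_p].
  assert (H1 : Rbar_locally p_infty (fun x => 1 < x)) by (now exists 1).
  eapply filter_imp; [|exact (filter_and _ _ HQ H1)].
  intros x [Hx Hx1].
  assert (H : ln (x ^ 2) <= ln (Q x)) by (apply ln_le; [apply pow_lt; lra|auto]).
  replace (x ^ 2) with (x * x) in H by ring. rewrite ln_mult in H by lra. lra.
Qed.

Lemma filterlim_shift {F : (R -> Prop) -> Prop} {FF : Filter F} (A : R -> R) (l m c : R) :
  m = l - c -> filterlim A F (locally l) -> filterlim (fun x => A x - c) F (locally m).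
Proof.
  intros -> H. apply (filterlim_lincomb_ext _ A (fun _ => 1) _ l 1 1 (- c));
    [intros; ring|ring|assumption|apply filterlim_const].
Qed.

Lemma is_derive_shift (A : R -> R) (c t d : R) :
  is_derive A t d -> is_derive (fun x => A x - c) t d.
Proof.
  intros H. evar_last.
  - apply (is_derive_minus (V := R_NormedModule)); [exact H|apply is_derive_const].
  - apply Rminus_0_r.
Qed.

(** B1 and B2 are the potential, normalised to vanish at tau = 0, along the imaginary axis up
    to i a and then along the horizontal line. The argument of x + i a is PI/2 - atan (x / a),
    which enters the sector where the limit at infinity is known. *)
Lemma contour_up (xi a de : R) : 0 < xi < 1 -> 0 < a ->
  exists B1 B2 : R -> R,
    (forall s, 0 < s -> is_derive B1 s
       (cos (de + (1 - xi) * (PI / 2)) * (exp (s ^ 3 / 3 - a ^ 2 * s) * Rpower s (- xi)))) /\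
    filterlim B1 (at_right 0) (locally 0) /\
    (forall x : R, is_derive B2 x (up_integrand xi a de x)) /\
    filterlim B2 (Rbar_locally p_infty)
      (locally (ray_integral xi 0 (2 * PI / 3) (de + (1 - xi) * (PI / 6)) (a ^ 2))) /\
    B2 0 = B1 a.
Proof.
  intros Hxi Ha. pose proof PI_RGT_0.
  destruct (potential_limits xi (a ^ 2) de Hxi) as [A0 [L [HL [H0 H1]]]].
  rewrite <- HL.
  set (r := fun x => ln (x ^ 2 + a ^ 2) / 2). set (f := fun x => PI / 2 - atan (x / a)).
  exists (fun s => potential xi (a ^ 2) de (ln s) (PI / 2) - A0),
    (fun x => potential xi (a ^ 2) de (r x) (f x) - A0).
  assert (HQ : forall x, 0 < x ^ 2 + a ^ 2).
  { intros x. pose proof (pow2_ge_0 x). pose proof (pow_lt a 2 Ha). lra. }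
  split; [|split; [|split; [|split]]].
  - intros s Hs. apply is_derive_shift. evar_last; [now apply is_derive_potential_ray|].
    unfold polar_integrand. rewrite cos_PI2, sin_PI2.
    replace (- (s ^ 3 * (0 ^ 2 * 1 - 1 ^ 3 / 3) + a ^ 2 * s * 1)) with (s ^ 3 / 3 - a ^ 2 * s) by field.
    replace (s ^ 3 * (0 ^ 3 / 3 - 0 * 1 ^ 2) + a ^ 2 * s * 0 + (1 - xi) * (PI / 2) + de)
      with (de + (1 - xi) * (PI / 2)) by field.
    ring.
  - apply (filterlim_shift _ A0); [ring|apply H0].
  - intros x. apply is_derive_shift.
    destruct (polar_atan a x Ha) as [Hc Hs].
    evar_last.
    + apply (is_derive_potential_cartesian xi (a ^ 2) de r f x x a 1 0).
      * unfold r, f. rewrite exp_half_ln, <- sin_shift by auto.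
        replace (PI / 2 - (PI / 2 - atan (x / a))) with (atan (x / a)) by ring.
        rewrite (Rplus_comm (x ^ 2)). now rewrite Hs.
      * unfold r, f. rewrite exp_half_ln, <- cos_shift by auto.
        replace (PI / 2 - (PI / 2 - atan (x / a))) with (atan (x / a)) by ring.
        rewrite (Rplus_comm (x ^ 2)). now rewrite Hc.
      * unfold r. rewrite cos_0, sin_0. pose proof (HQ x). auto_derive; [simpl in *; lra|].
        simpl in *; field; lra.
      * unfold f. rewrite cos_0, sin_0. pose proof (HQ x).
        auto_derive; auto. simpl in *; field. split; lra.
    + unfold up_integrand, f. rewrite Rmult_1_l. f_equal; [f_equal|].
      * f_equal. field.
      * f_equal. field.
  - apply (filterlim_shift _ L); [reflexivity|]. apply (H1 r f).
    + apply filterlim_half_ln. apply filter_forall. intros x. pose proof (pow2_ge_0 a). lra.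
    + exists a. intros x Hx. unfold f. pose proof (atan_bound (x / a)).
      assert (atan 1 < atan (x / a)).
      { apply atan_increasing. apply Rlt_div_r; lra. }
      rewrite atan_1 in *. lra.
  - f_equal. unfold r, f. f_equal.
    + replace (0 ^ 2 + a ^ 2) with (a * a) by ring. rewrite ln_mult by auto. field.
    + replace (0 / a) with 0 by (field; lra). rewrite atan_0. ring.
Qed.

(** The integrand on the line tau = a + v + i v for th = - a^2, with the saddle at v = 0; the
    line meets the imaginary axis at v = - a. *)
Definition down_integrand (xi a de v : R) : R :=
  sqrt 2 * (exp (- (2 * a * v ^ 2) - 2 / 3 * v ^ 3) * Rpower ((a + v) ^ 2 + v ^ 2) (- xi / 2)
  * cos (de + PI / 4 - 2 / 3 * a ^ 3 - (2 / 3 * v ^ 3 + xi * (atan (1 + 2 * v / a) - PI / 4)))).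

(** The same with the imaginary axis down to - i a and then the line of slope 1, whose argument
    increases from - PI/2 to PI/4. *)
Lemma contour_down (xi a de : R) : 0 < xi < 1 -> 0 < a ->
  exists B1 B2 : R -> R,
    (forall s, 0 < s -> is_derive B1 s
       (cos (de - (1 - xi) * (PI / 2)) * La_integrand xi (- a ^ 2) s)) /\
    filterlim B1 (at_right 0) (locally 0) /\
    (forall v : R, is_derive B2 v (down_integrand xi a de v)) /\
    filterlim B2 (Rbar_locally p_infty)
      (locally (ray_integral xi 0 (2 * PI / 3) (de + (1 - xi) * (PI / 6)) (- a ^ 2))) /\
    B2 (- a) = B1 a.
Proof.
  intros Hxi Ha. pose proof PI_RGT_0.
  destruct (potential_limits xi (- a ^ 2) de Hxi) as [A0 [L [HL [H0 H1]]]].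
  rewrite <- HL.
  set (r := fun v => ln ((a + v) ^ 2 + v ^ 2) / 2).
  set (f := fun v => atan (1 + 2 * v / a) - PI / 4).
  exists (fun s => potential xi (- a ^ 2) de (ln s) (- (PI / 2)) - A0),
    (fun v => potential xi (- a ^ 2) de (r v) (f v) - A0).
  assert (HQ : forall v, 0 < (a + v) ^ 2 + v ^ 2).
  { intros v. destruct (Req_dec v 0) as [->|Hv].
    - rewrite Rplus_0_r. pose proof (pow_lt a 2 Ha). simpl in *; lra.
    - pose proof (pow2_ge_0 (a + v)). pose proof (pow2_gt_0 v Hv). lra. }
  split; [|split; [|split; [|split]]].
  - intros s Hs. apply is_derive_shift. evar_last; [now apply is_derive_potential_ray|].
    unfold polar_integrand, La_integrand. rewrite cos_neg, sin_neg, cos_PI2, sin_PI2.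
    replace (- (s ^ 3 * (0 ^ 2 * -(1) - (-(1)) ^ 3 / 3) + - a ^ 2 * s * -(1)))
      with (- s ^ 3 / 3 + - a ^ 2 * s) by field.
    replace (s ^ 3 * (0 ^ 3 / 3 - 0 * (-(1)) ^ 2) + - a ^ 2 * s * 0 + (1 - xi) * - (PI / 2) + de)
      with (de - (1 - xi) * (PI / 2)) by field.
    ring.
  - apply (filterlim_shift _ A0); [ring|apply H0].
  - intros v. apply is_derive_shift.
    destruct (polar_atan a (a + 2 * v) Ha) as [Hc Hs].
    replace ((a + 2 * v) / a) with (1 + 2 * v / a) in Hc, Hs by (field; lra).
    replace (a ^ 2 + (a + 2 * v) ^ 2) with (2 * ((a + v) ^ 2 + v ^ 2)) in Hc, Hs by ring.
    rewrite sqrt_mult in Hc, Hs by (try lra; left; apply HQ).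
    assert (Hq2 : sqrt 2 * sqrt 2 = 2) by (apply sqrt_sqrt; lra).
    assert (H2 : 0 < sqrt 2) by nonneg.
    assert (Hm : sqrt 2 * (1 / sqrt 2) = 1) by (field; lra).
    assert (Hd : 1 / sqrt 2 = sqrt 2 / 2).
    { apply Rmult_eq_reg_l with (sqrt 2); [|lra]. rewrite Hm. lra. }
    evar_last.
    + apply (is_derive_potential_cartesian xi (- a ^ 2) de r f v (a + v) v (sqrt 2) (PI / 4)).
      * unfold r, f. rewrite exp_half_ln by auto. rewrite cos_minus, cos_PI4, sin_PI4, Hd.
        match goal with |- _ = ?s * _ => set (q := s) in * end.
        replace (q * (cos (atan (1 + 2 * v / a)) * (sqrt 2 / 2)
            + sin (atan (1 + 2 * v / a)) * (sqrt 2 / 2)))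
         with ((sqrt 2 * q * cos (atan (1 + 2 * v / a))
            + sqrt 2 * q * sin (atan (1 + 2 * v / a))) / 2) by field.
        rewrite Hc, Hs. field.
      * unfold r, f. rewrite exp_half_ln by auto. rewrite sin_minus, cos_PI4, sin_PI4, Hd.
        match goal with |- _ = ?s * _ => set (q := s) in * end.
        replace (q * (sin (atan (1 + 2 * v / a)) * (sqrt 2 / 2)
            - cos (atan (1 + 2 * v / a)) * (sqrt 2 / 2)))
         with ((sqrt 2 * q * sin (atan (1 + 2 * v / a))
            - sqrt 2 * q * cos (atan (1 + 2 * v / a))) / 2) by field.
        rewrite Hc, Hs. field.
      * unfold r. rewrite cos_PI4, sin_PI4, Hm. pose proof (HQ v).
        auto_derive; [simpl in *; lra|]. simpl in *; field; lra.
      * unfold f. rewrite cos_PI4, sin_PI4, Hm. pose proof (HQ v).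
        auto_derive; auto. simpl in *; field. split; [lra|]. split; [lra|].
        apply Rgt_not_eq. nra.
    + unfold down_integrand, f. f_equal. f_equal; [f_equal|].
      * f_equal. field.
      * f_equal. field.
  - apply (filterlim_shift _ L); [reflexivity|]. apply (H1 r f).
    + apply filterlim_half_ln. apply filter_forall. intros v. pose proof (pow2_ge_0 (a + v)). lra.
    + exists 0. intros v Hv. unfold f. pose proof (atan_bound (1 + 2 * v / a)).
      assert (atan 1 < atan (1 + 2 * v / a)).
      { apply atan_increasing. assert (0 < 2 * v / a) by nonneg. lra. }
      rewrite atan_1 in *. lra.
  - f_equal. unfold r, f. f_equal.
    + replace ((a + - a) ^ 2 + (- a) ^ 2) with (a * a) by ring. rewrite ln_mult by auto. field.
    + replace (1 + 2 * - a / a) with (- (1)) by (field; lra).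
      rewrite atan_opp, atan_1. field.
Qed.

(** * The Gaussian integral *)

Definition gauss_primitive (x : R) : R := RInt (fun t => exp (- t ^ 2)) 0 x.

Lemma is_derive_gauss_primitive (x : R) : is_derive gauss_primitive x (exp (- x ^ 2)).
Proof.
  apply (is_derive_RInt_continuous (fun t => exp (- t ^ 2))). intros t.
  apply continuous_of_derivable. auto_derive. auto.
Qed.

Lemma gauss_primitive_0 : gauss_primitive 0 = 0.
Proof. apply (RInt_point (V := R_CompleteNormedModule)). Qed.

Lemma constant_of_derive_0 (g : R -> R) (x y : R) : (forall t : R, is_derive g t 0) -> g x = g y.
Proof.
  intros H. destruct (mean_value g (fun _ => 0) y x) as [c [_ E]]; auto. lra.
Qed.

Lemma gauss_primitive_odd (x : R) : gauss_primitive (- x) = - gauss_primitive x.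
Proof.
  assert (H : gauss_primitive (- x) + gauss_primitive x = gauss_primitive (- 0) + gauss_primitive 0).
  { apply (constant_of_derive_0 (fun x => gauss_primitive (- x) + gauss_primitive x)).
    intros t. evar_last.
    - apply (is_derive_plus (V := R_NormedModule)); [|apply is_derive_gauss_primitive].
      apply (is_derive_comp gauss_primitive Ropp t (exp (- (- t) ^ 2)) (-1));
        [apply is_derive_gauss_primitive|].
      auto_derive; auto.
    - unfold plus, scal; simpl; unfold mult; simpl.
      replace (- t * (- t * 1)) with (t * (t * 1)) by ring. ring. }
  rewrite Ropp_0, gauss_primitive_0 in H. lra.
Qed.

Lemma gauss_primitive_incr (x y : R) : x <= y -> gauss_primitive x <= gauss_primitive y.
Proof.
  intros Hxy. destruct (mean_value gauss_primitive (fun t => exp (- t ^ 2)) x y) as [c [_ E]].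
  { intros; apply is_derive_gauss_primitive. }
  pose proof (exp_pos (- c ^ 2)). nra.
Qed.

(** Its derivative is opposite to that of the square of the Gaussian primitive, so the sum of
    the two is constant and equal to its value PI/4 at 0. *)
Definition gauss_companion (x : R) : R :=
  RInt (fun t => exp (- x ^ 2 * (1 + t ^ 2)) / (1 + t ^ 2)) 0 1.

Lemma pow2_plus_1_pos (t : R) : 0 < 1 + t ^ 2.
Proof. pose proof (pow2_ge_0 t). lra. Qed.

Lemma is_derive_gauss_companion (x : R) :
  is_derive gauss_companion x (- 2 * exp (- x ^ 2) * gauss_primitive x).
Proof.
  assert (HD : forall u t, is_derive (fun z => exp (- z ^ 2 * (1 + t ^ 2)) / (1 + t ^ 2)) u
     (- 2 * u * exp (- u ^ 2 * (1 + t ^ 2)))).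
  { intros u t. pose proof (pow2_plus_1_pos t) as Ht.
    auto_derive; simpl in *; [lra|]. field. lra. }
  evar_last.
  - apply (is_derive_RInt_param (fun x t => exp (- x ^ 2 * (1 + t ^ 2)) / (1 + t ^ 2)) 0 1 x).
    + apply filter_forall. intros u t _. eexists; apply HD.
    + intros t _. apply (continuity_2d_pt_ext (fun u t => - 2 * u * exp (- u ^ 2 * (1 + t ^ 2)))).
      { intros. symmetry. now apply is_derive_unique. }
      unfold pow. continuity_2d.
    + apply filter_forall. intros u. apply (ex_RInt_continuous (V := R_CompleteNormedModule)).
      intros t _. apply continuous_of_derivable.
      pose proof (pow2_plus_1_pos t) as Ht. auto_derive. simpl in *; lra.
  - apply is_RInt_unique.
    apply (is_RInt_ext (fun t => - 2 * exp (- x ^ 2) * (x * exp (- (x * t) ^ 2)))).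
    { intros t _. match goal with |- ?u = ?w => change (@eq R u w) end.
      transitivity (- 2 * x * exp (- x ^ 2 * (1 + t ^ 2)));
        [|symmetry; apply is_derive_unique, HD].
      replace (- x ^ 2 * (1 + t ^ 2)) with (- x ^ 2 + - (x * t) ^ 2) by ring.
      rewrite exp_plus. ring. }
    replace (- 2 * exp (- x ^ 2) * gauss_primitive x)
      with (- 2 * exp (- x ^ 2) * gauss_primitive (x * 1) - - 2 * exp (- x ^ 2) * gauss_primitive (x * 0)).
    2: { rewrite Rmult_1_r, Rmult_0_r, gauss_primitive_0. ring. }
    apply (is_RInt_derive (V := R_CompleteNormedModule)
      (fun t => - 2 * exp (- x ^ 2) * gauss_primitive (x * t))).
    + intros t _. apply (is_derive_scal (fun t => gauss_primitive (x * t))).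
      apply (is_derive_comp gauss_primitive (fun t => x * t) t (exp (- (x * t) ^ 2)) x);
        [apply is_derive_gauss_primitive|].
      auto_derive; auto. ring.
    + intros t _. apply continuous_of_derivable.
      auto_derive. auto.
Qed.

Lemma gauss_primitive_sqr (x : R) : gauss_primitive x ^ 2 + gauss_companion x = PI / 4.
Proof.
  replace (PI / 4) with (gauss_primitive 0 ^ 2 + gauss_companion 0).
  - apply (constant_of_derive_0 (fun x => gauss_primitive x ^ 2 + gauss_companion x)).
    intros t. evar_last.
    + apply (is_derive_plus (V := R_NormedModule)); [|apply is_derive_gauss_companion].
      apply (is_derive_pow gauss_primitive 2 t). apply is_derive_gauss_primitive.
    + unfold plus; simpl. ring.
  - rewrite gauss_primitive_0. unfold gauss_companion.
    rewrite (RInt_ext _ (fun t => / (1 + t ^ 2))).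
    + replace (RInt (fun t => / (1 + t ^ 2)) 0 1) with (atan 1 - atan 0).
      * rewrite atan_1, atan_0. ring.
      * symmetry. apply is_RInt_unique. apply (is_RInt_derive (V := R_CompleteNormedModule) atan).
        -- intros t _. auto_derive; auto. simpl; field. pose proof (pow2_plus_1_pos t). simpl in *; lra.
        -- intros t _. apply continuous_of_derivable.
           pose proof (pow2_plus_1_pos t). auto_derive. simpl in *; lra.
    + intros t _. replace (- 0 ^ 2 * (1 + t ^ 2)) with 0 by ring. rewrite exp_0.
      unfold Rdiv; apply Rmult_1_l.
Qed.

Lemma gauss_companion_bounds (x : R) : 0 <= gauss_companion x <= exp (- x ^ 2).
Proof.
  assert (Hex : ex_RInt (fun t => exp (- x ^ 2 * (1 + t ^ 2)) / (1 + t ^ 2)) 0 1).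
  { apply (ex_RInt_continuous (V := R_CompleteNormedModule)).
    intros t _. apply continuous_of_derivable.
    pose proof (pow2_plus_1_pos t) as Ht. auto_derive. simpl in *; lra. }
  split.
  - apply RInt_ge_0; [lra|exact Hex|]. intros t _. left.
    apply Rdiv_lt_0_compat; [apply exp_pos|apply pow2_plus_1_pos].
  - replace (exp (- x ^ 2)) with (RInt (fun _ => exp (- x ^ 2)) 0 1).
    2: { rewrite RInt_const. unfold scal; simpl; unfold mult; simpl. ring. }
    apply RInt_le; [lra|exact Hex|apply ex_RInt_const|]. intros t _.
    pose proof (pow2_plus_1_pos t). apply Rle_div_l; auto.
    assert (exp (- x ^ 2 * (1 + t ^ 2)) <= exp (- x ^ 2)).
    { apply exp_le_compat. pose proof (pow2_ge_0 x). pose proof (pow2_ge_0 t). nra. }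
    pose proof (exp_pos (- x ^ 2)). pose proof (pow2_ge_0 t). nra.
Qed.

Lemma sqrt_PI_bounds : 1 <= sqrt PI <= 2.
Proof.
  pose proof PI_4. pose proof PI2_1. pose proof PI_RGT_0. split.
  - rewrite <- sqrt_1. apply sqrt_le_1; lra.
  - replace 2 with (sqrt (2 * 2)) by (apply sqrt_square; lra). apply sqrt_le_1; lra.
Qed.

Lemma gauss_primitive_bounds (x : R) : 0 < x ->
  0 <= sqrt PI / 2 - gauss_primitive x <= / x.
Proof.
  intros Hx. pose proof (gauss_primitive_sqr x) as HS. pose proof (gauss_companion_bounds x) as HC.
  assert (H0 : 0 <= gauss_primitive x).
  { rewrite <- gauss_primitive_0. apply gauss_primitive_incr; lra. }
  pose proof PI_RGT_0. pose proof sqrt_PI_bounds as HP.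
  assert (Hq : sqrt PI * sqrt PI = PI) by (apply sqrt_sqrt; lra).
  set (p := sqrt PI / 2) in *. set (g := gauss_primitive x) in *.
  assert (Hp : p * p = PI / 4) by (unfold p; lra).
  assert (Hpg : (p - g) * (p + g) = gauss_companion x) by (simpl in HS; lra).
  assert (Hp2 : / 2 <= p) by (unfold p; lra).
  assert (Hge : 0 <= p - g).
  { destruct (Rle_dec 0 (p - g)); auto. exfalso.
    pose proof (Rmult_lt_0_compat (g - p) (p + g) ltac:(lra) ltac:(lra)). lra. }
  split; [auto|].
  assert (He : exp (- x ^ 2) <= / (2 * x)).
  { rewrite exp_Ropp. apply Rinv_le_contravar; [lra|].
    pose proof (exp_ineq1_le (x ^ 2)). pose proof (pow2_ge_0 (x - 1)). simpl in *; lra. }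
  replace (/ x) with (2 * / (2 * x)) by (field; lra).
  apply Rle_trans with (2 * gauss_companion x); [|lra].
  rewrite <- Hpg. nra.
Qed.

Lemma gauss_primitive_abs (x : R) : Rabs (gauss_primitive x) <= 1.
Proof.
  assert (H : forall x, 0 < x -> 0 <= gauss_primitive x <= 1).
  { intros y Hy. pose proof (gauss_primitive_bounds y Hy). pose proof sqrt_PI_bounds.
    split; [|lra]. rewrite <- gauss_primitive_0. apply gauss_primitive_incr; lra. }
  apply Rabs_le. destruct (Rtotal_order x 0) as [Hx|[->|Hx]].
  - specialize (H (- x) ltac:(lra)). rewrite gauss_primitive_odd in H. lra.
  - rewrite gauss_primitive_0. lra.
  - specialize (H x Hx). lra.
Qed.

Lemma gauss_primitive_lim : filterlim gauss_primitive (Rbar_locally p_infty) (locally (sqrt PI / 2)).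
Proof.
  apply filterlim_eps. intros eps Heps.
  assert (He : 0 < / eps) by nonneg.
  exists (/ eps). intros x Hx.
  pose proof (gauss_primitive_bounds x ltac:(lra)) as HB.
  assert (/ x < eps).
  { rewrite <- (Rinv_inv eps). apply Rinv_lt_contravar; auto. apply Rmult_lt_0_compat; lra. }
  apply Rabs_lt_between. lra.
Qed.

Lemma is_derive_gauss_scaled (a u : R) : 0 < a ->
  is_derive (fun u => gauss_primitive (sqrt a * u) / sqrt a) u (exp (- (a * u ^ 2))).
Proof.
  intros Ha. assert (Hs : 0 < sqrt a) by nonneg.
  assert (Hq : sqrt a * sqrt a = a) by (apply sqrt_sqrt; lra).
  apply (is_derive_ext (fun u => / sqrt a * gauss_primitive (sqrt a * u))).
  { intros; apply Rmult_comm. }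
  evar_last.
  - apply (is_derive_scal (fun u => gauss_primitive (sqrt a * u))).
    apply (is_derive_comp gauss_primitive (fun u => sqrt a * u) u (exp (- (sqrt a * u) ^ 2)) (sqrt a));
      [apply is_derive_gauss_primitive|]. auto_derive; auto. ring.
  - unfold scal; simpl; unfold mult; simpl.
    replace (sqrt a * u * (sqrt a * u * 1)) with (sqrt a * sqrt a * (u * (u * 1))) by ring.
    rewrite Hq. field. lra.
Qed.

(** * Laplace's method *)

Lemma quartic_le_exp (C v : R) : 0 <= C -> 0 <= v ->
  v ^ 3 * (1 + C * v) + C * v + C * (v ^ 3 + v) <= (18 + 55 * C) * exp (v ^ 2 / 4).
Proof.
  intros HC Hv.
  pose proof (exp_ge_quadratic (v ^ 2 / 4)) as He.
  assert (H2 : 0 <= v ^ 2) by apply pow2_ge_0. specialize (He ltac:(lra)).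
  set (e := exp (v ^ 2 / 4)) in *.
  assert (H4 : v ^ 4 <= 32 * e) by (simpl in *; nra).
  assert (H22 : v ^ 2 <= 4 * e) by (simpl in *; nra).
  assert (H11 : 1 <= e) by (simpl in *; nra).
  assert (H1 : v <= 5 / 2 * e) by (pose proof (pow2_ge_0 (v - 1)); simpl in *; lra).
  assert (H3 : v ^ 3 <= 18 * e).
  { assert (0 <= v ^ 2 * (v - 1) ^ 2) by (apply Rmult_le_pos; apply pow2_ge_0).
    simpl in *. lra. }
  replace (v ^ 3 * (1 + C * v) + C * v + C * (v ^ 3 + v))
    with (v ^ 3 + C * (v ^ 4 + 2 * v + v ^ 3)) by ring.
  assert (C * (v ^ 4 + 2 * v + v ^ 3) <= C * (55 * e)) by (apply Rmult_le_compat_l; lra).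
  lra.
Qed.

Lemma exp_minus_1_le (z w : R) : 0 <= w -> z <= w -> Rabs (exp z - 1) <= Rabs z * exp w.
Proof.
  intros Hw Hz. destruct (mean_value exp exp 0 z) as [c [Hc E]].
  { intros; apply is_derive_exp. }
  rewrite exp_0, Rminus_0_r in E. rewrite E, Rabs_mult, (Rabs_pos_eq (exp c)) by nonneg.
  rewrite Rmult_comm. mono_l.
  apply exp_le_compat. unfold Rmax in Hc. destruct (Rle_dec 0 z); lra.
Qed.

Lemma Rabs_cos_minus (x y : R) : Rabs (cos x - cos y) <= Rabs (x - y).
Proof.
  destruct (mean_value cos (fun t => - sin t) y x) as [c [_ E]].
  { intros; apply is_derive_Reals, derivable_pt_lim_cos. }
  rewrite E, Rabs_mult, Rabs_Ropp. destruct (sin_cos_abs c). pose proof (Rabs_pos (x - y)).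
  pose proof (Rabs_pos (sin c)). nra.
Qed.

(** In v = sqrt A |u| the relative errors of the cubic exponential, the modulus and the phase
    are polynomials in v divided by A^(3/2). The cubic exponential grows for u < 0, but p |u|
    <= A/2 keeps it below exp(A u^2/2), which costs half of the Gaussian. *)
Lemma laplace_pointwise (C A M p c0 u m q : R) :
  0 <= C -> 1 <= A -> 0 <= M -> 0 <= p <= 1 -> p * - u <= A / 2 ->
  Rabs (m - M) <= C * M * (Rabs u / A) -> Rabs q <= C * (Rabs u ^ 3 + Rabs u / A) ->
  Rabs (exp (- (A * u ^ 2) - p * u ^ 3) * m * cos (c0 + q) - M * cos c0 * exp (- (A * u ^ 2)))
    <= M * (18 + 55 * C) / (A * sqrt A) * exp (- (A / 4 * u ^ 2)).
Proof.
  intros HC HA HM Hp Hpu Hm Hq.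
  set (s := sqrt A).
  assert (Hss : s * s = A) by (apply sqrt_sqrt; lra).
  assert (Hs1 : 1 <= s) by (unfold s; rewrite <- sqrt_1; apply sqrt_le_1; lra).
  set (v := s * Rabs u).
  pose proof (Rabs_pos u) as Hu0.
  assert (Hv : 0 <= v) by nonneg.
  assert (Hv2 : v ^ 2 = A * u ^ 2).
  { unfold v. rewrite Rpow_mult_distr, pow2_abs, <- Hss. ring. }
  assert (Hu : Rabs u = v / s) by (unfold v; field; lra).
  (* All errors are polynomials in v divided by A^(3/2). *)
  assert (H3 : Rabs u ^ 3 = v ^ 3 / (A * s)) by (rewrite Hu, <- Hss; field; lra).
  assert (H1 : Rabs u / A = v / (A * s)) by (rewrite Hu, <- Hss; field; lra).
  assert (HAs : 1 <= A * s) by nra.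
  assert (H1v : Rabs u / A <= v).
  { rewrite H1. apply Rle_div_l; nra. }
  assert (Hz : - (p * u ^ 3) <= A * u ^ 2 / 2).
  { replace (- (p * u ^ 3)) with (p * - u * u ^ 2) by ring.
    pose proof (pow2_ge_0 u). nra. }
  assert (Hw : 0 <= A * u ^ 2 / 2) by (pose proof (pow2_ge_0 u); nra).
  set (W := exp (A * u ^ 2 / 2)).
  assert (HW : 1 <= W) by (unfold W; rewrite <- exp_0; now apply exp_le_compat).
  assert (He : Rabs (exp (- (p * u ^ 3)) - 1) <= v ^ 3 / (A * s) * W).
  { eapply Rle_trans; [apply (exp_minus_1_le _ _ Hw Hz)|]. fold W.
    mono_r. rewrite <- H3, Rabs_Ropp, Rabs_mult, RPow_abs.
    rewrite (Rabs_pos_eq p) by lra. pose proof (Rabs_pos (u ^ 3)). nra. }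
  rewrite H1 in Hm. rewrite H3, H1 in Hq.
  assert (Hm' : Rabs m <= M * (1 + C * v)).
  { replace m with (m - M + M) by ring. eapply Rle_trans; [apply Rabs_triang|].
    rewrite (Rabs_pos_eq M) by lra. rewrite H1 in H1v.
    assert (C * M * (v / (A * s)) <= C * M * v) by (apply Rmult_le_compat_l; nra). nra. }
  assert (Hc : Rabs (cos (c0 + q) - cos c0) <= C * (v ^ 3 / (A * s) + v / (A * s))).
  { eapply Rle_trans; [apply Rabs_cos_minus|]. replace (c0 + q - c0) with q by ring. auto. }
  replace (exp (- (A * u ^ 2) - p * u ^ 3) * m * cos (c0 + q) - M * cos c0 * exp (- (A * u ^ 2)))
    with (exp (- (A * u ^ 2)) * ((exp (- (p * u ^ 3)) - 1) * m * cos (c0 + q)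
       + (m - M) * cos (c0 + q) + M * (cos (c0 + q) - cos c0))).
  2: { unfold Rminus at 5. rewrite exp_plus. ring. }
  rewrite Rabs_mult, (Rabs_pos_eq (exp _)) by nonneg.
  assert (Hv3 : 0 <= v ^ 3 / (A * s)) by nonneg.
  assert (Hv1 : 0 <= v / (A * s)) by nonneg.
  assert (Hin : Rabs ((exp (- (p * u ^ 3)) - 1) * m * cos (c0 + q)
       + (m - M) * cos (c0 + q) + M * (cos (c0 + q) - cos c0))
     <= W * (M / (A * s)) * (v ^ 3 * (1 + C * v) + C * v + C * (v ^ 3 + v))).
  { eapply Rle_trans; [apply Rabs_triang|].
    eapply Rle_trans; [apply Rplus_le_compat_r, Rabs_triang|].
    rewrite !Rabs_mult, (Rabs_pos_eq M) by lra.
    destruct (sin_cos_abs (c0 + q)) as [_ Hcq]. pose proof (Rabs_pos (cos (c0 + q))).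
    assert (T1 : Rabs (exp (- (p * u ^ 3)) - 1) * Rabs m * Rabs (cos (c0 + q))
       <= W * (M / (A * s)) * (v ^ 3 * (1 + C * v))).
    { apply Rle_trans with (v ^ 3 / (A * s) * W * (M * (1 + C * v)) * 1).
      - apply Rmult_le_compat; auto; [apply Rmult_le_pos; apply Rabs_pos|].
        apply Rmult_le_compat; auto using Rabs_pos.
      - right. field. lra. }
    assert (T2 : Rabs (m - M) * Rabs (cos (c0 + q)) <= W * (M / (A * s)) * (C * v)).
    { apply Rle_trans with (C * M * (v / (A * s)) * 1).
      - apply Rmult_le_compat; auto using Rabs_pos.
      - replace (W * (M / (A * s)) * (C * v)) with (C * M * (v / (A * s)) * W) by (field; lra).
        apply Rmult_le_compat_l; [nonneg|lra]. }
    assert (T3 : M * Rabs (cos (c0 + q) - cos c0) <= W * (M / (A * s)) * (C * (v ^ 3 + v))).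
    { apply Rle_trans with (M * (C * (v ^ 3 / (A * s) + v / (A * s))) * 1).
      - rewrite Rmult_1_r. apply Rmult_le_compat_l; auto.
      - replace (W * (M / (A * s)) * (C * (v ^ 3 + v)))
          with (M * (C * (v ^ 3 / (A * s) + v / (A * s))) * W) by (field; lra).
        apply Rmult_le_compat_l; [nonneg|lra]. }
    lra. }
  apply Rle_trans with (exp (- (A * u ^ 2)) * (W * (M / (A * s)) * ((18 + 55 * C) * exp (v ^ 2 / 4)))).
  - mono_l.
    eapply Rle_trans; [exact Hin|]. apply Rmult_le_compat_l.
    + nonneg.
    + now apply quartic_le_exp.
  - right. rewrite Hv2. fold s. unfold W.
    replace (exp (- (A / 4 * u ^ 2)))
      with (exp (- (A * u ^ 2)) * exp (A * u ^ 2 / 2) * exp (A * u ^ 2 / 4)).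
    + field. lra.
    + rewrite <- !exp_plus. f_equal. field.
Qed.

Lemma filterlim_gauss_scaled (a : R) : 0 < a ->
  filterlim (fun u => gauss_primitive (sqrt a * u) / sqrt a) (Rbar_locally p_infty)
    (locally (sqrt PI / 2 / sqrt a)).
Proof.
  intros Ha. assert (Hs : 0 < sqrt a) by nonneg.
  apply (filterlim_scal_ext _ (fun u => gauss_primitive (sqrt a * u)) _ (sqrt PI / 2)
    (/ sqrt a)); [intros; field; lra|field; lra| ].
  apply (filterlim_comp _ _ _ (fun u => sqrt a * u) gauss_primitive _ (Rbar_locally p_infty));
    [|apply gauss_primitive_lim].
  intros P [M HP]. exists (M / sqrt a). intros x Hx. apply HP.
  replace M with (sqrt a * (M / sqrt a)) by (field; lra).
  apply Rmult_lt_compat_l; lra.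
Qed.

(** The pointwise error is the derivative of a Gaussian primitive with parameter A/4, whose
    total variation is of order A^(-1/2). *)
Lemma laplace_estimate (C A M p c0 u0 L : R) (m q B : R -> R) :
  0 <= C -> 1 <= A -> 0 <= M -> 0 <= p <= 1 ->
  (forall u, u0 <= u -> is_derive B u (exp (- (A * u ^ 2) - p * u ^ 3) * m u * cos (c0 + q u))) ->
  (forall u, u0 <= u -> p * - u <= A / 2 /\ Rabs (m u - M) <= C * M * (Rabs u / A) /\
     Rabs (q u) <= C * (Rabs u ^ 3 + Rabs u / A)) ->
  filterlim B (Rbar_locally p_infty) (locally L) ->
  Rabs (L - B u0 - M * cos c0 / sqrt A * (sqrt PI / 2 - gauss_primitive (sqrt A * u0)))
    <= 4 * (18 + 55 * C) * M / A ^ 2.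
Proof.
  intros HC HA HM Hp HB Hb HL.
  assert (Hs : 0 < sqrt A) by nonneg.
  assert (Hss : sqrt A * sqrt A = A) by (apply sqrt_sqrt; lra).
  assert (Hs4 : sqrt (A / 4) = sqrt A / 2).
  { rewrite sqrt_div_alt by lra. replace 4 with (2 * 2) by ring. rewrite sqrt_square; lra. }
  set (K := M * (18 + 55 * C) / (A * sqrt A)).
  assert (HK : 0 <= K).
  { unfold K. nonneg. }
  pose proof (primitive_le_infty
    (fun u => B u - M * cos c0 * (gauss_primitive (sqrt A * u) / sqrt A))
    (fun u => K * (gauss_primitive (sqrt (A / 4) * u) / sqrt (A / 4)))
    (fun u => exp (- (A * u ^ 2) - p * u ^ 3) * m u * cos (c0 + q u)
              - M * cos c0 * exp (- (A * u ^ 2)))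
    (fun u => K * exp (- (A / 4 * u ^ 2))) u0
    (L - M * cos c0 * (sqrt PI / 2 / sqrt A)) (K * (sqrt PI / 2 / sqrt (A / 4)))) as H.
  cbv beta in H.
  replace (L - B u0 - M * cos c0 / sqrt A * (sqrt PI / 2 - gauss_primitive (sqrt A * u0)))
    with (L - M * cos c0 * (sqrt PI / 2 / sqrt A)
      - (B u0 - M * cos c0 * (gauss_primitive (sqrt A * u0) / sqrt A))) by (field; lra).
  eapply Rle_trans; [apply H; clear H|].
  - intros u Hu. apply (is_derive_minus (V := R_NormedModule)); [now apply HB|].
    apply (is_derive_scal (fun u => gauss_primitive (sqrt A * u) / sqrt A)).
    apply is_derive_gauss_scaled; lra.
  - intros u Hu. apply (is_derive_scal (fun u => gauss_primitive (sqrt (A / 4) * u) / sqrt (A / 4))).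
    apply is_derive_gauss_scaled; lra.
  - intros u Hu. destruct (Hb u Hu) as [H1 [H2 H3]]. now apply laplace_pointwise.
  - apply (filterlim_lincomb_ext _ B (fun u => gauss_primitive (sqrt A * u) / sqrt A) _ L
      (sqrt PI / 2 / sqrt A) 1 (- (M * cos c0))); [intros; ring|ring|assumption|].
    apply filterlim_gauss_scaled; lra.
  - apply (filterlim_lincomb_ext _ (fun u => gauss_primitive (sqrt (A / 4) * u) / sqrt (A / 4))
      (fun _ => 0) _ (sqrt PI / 2 / sqrt (A / 4)) 0 K 0); [intros; ring|ring| |apply filterlim_const].
    apply filterlim_gauss_scaled; lra.
  - rewrite Hs4.
    pose proof (gauss_primitive_abs (sqrt A / 2 * u0)) as HG. apply Rabs_le_between in HG.
    pose proof sqrt_PI_bounds.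
    replace (K * (sqrt PI / 2 / (sqrt A / 2)) - K * (gauss_primitive (sqrt A / 2 * u0) / (sqrt A / 2)))
      with (K / sqrt A * (sqrt PI - 2 * gauss_primitive (sqrt A / 2 * u0))) by (field; lra).
    apply Rle_trans with (K / sqrt A * 4).
    + apply Rmult_le_compat_l; [|lra].
      nonneg.
    + right. unfold K. replace (A ^ 2) with (A * (sqrt A * sqrt A)) by (rewrite Hss; ring). field. lra.
Qed.

(** * Saddle point contributions *)

Lemma Rpower_sqr_half (x p : R) : 0 < x -> Rpower (x ^ 2) (p / 2) = Rpower x p.
Proof.
  intros Hx. unfold Rpower. replace (x ^ 2) with (x * x) by ring.
  rewrite ln_mult by auto. f_equal. field.
Qed.

Lemma Rpower_antitone (x y p : R) : 0 < x <= y -> p <= 0 -> Rpower y p <= Rpower x p.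
Proof.
  intros Hxy Hp. rewrite <- (Ropp_involutive p), !(Rpower_Ropp _ (- p)).
  apply Rinv_le_contravar; [apply exp_pos|]. apply Rle_Rpower_l; lra.
Qed.

(** Q is the squared modulus of tau along a line or half-line; it stays above (a/2)^2 and Q'^2
    <= 8 Q, so the logarithmic derivative of the modulus is of order 1/a. *)
Lemma modulus_lipschitz (xi a t : R) (Q Q' : R -> R) :
  0 < xi < 1 -> 0 < a -> Q 0 = a ^ 2 ->
  (forall u, Rmin 0 t <= u <= Rmax 0 t ->
     is_derive Q u (Q' u) /\ (a / 2) ^ 2 <= Q u /\ Q' u ^ 2 <= 8 * Q u) ->
  Rabs (Rpower (Q t) (- xi / 2) - Rpower a (- xi)) <= 6 * Rpower a (- xi) * (Rabs t / a).
Proof.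
  intros Hxi Ha HQ0 H.
  assert (Hpow : forall u, Rmin 0 t <= u <= Rmax 0 t -> 0 < Q u).
  { intros u Hu. destruct (H u Hu) as [_ [HQ _]]. pose proof (pow_lt (a / 2) 2 ltac:(lra)). lra. }
  destruct (mean_value (fun u => Rpower (Q u) (- xi / 2))
    (fun u => Q' u * (- xi / 2 * Rpower (Q u) (- xi / 2 - 1))) 0 t) as [c [Hc E]].
  { intros u Hu. apply (is_derive_comp (fun z => Rpower z (- xi / 2)) Q).
    - apply is_derive_Rpower; auto.
    - now apply H. }
  rewrite HQ0, Rpower_sqr_half, Rminus_0_r in E by auto. rewrite E.
  destruct (H c Hc) as [_ [HQ HQ']]. pose proof (Hpow c Hc) as HQc.
  assert (Hratio : Rabs (Q' c) <= 6 * Q c / a).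
  { apply Rsqr_incr_0_var.
    - rewrite <- Rsqr_abs. unfold Rsqr.
      replace (6 * Q c / a * (6 * Q c / a)) with (36 * (Q c / a ^ 2) * Q c) by (field; lra).
      assert (/ 4 <= Q c / a ^ 2).
      { apply Rle_div_r; [apply pow_lt; auto|]. simpl in *; lra. }
      simpl in *; nra.
    - apply Rlt_le, Rdiv_lt_0_compat; lra. }
  assert (Hp : Rpower (Q c) (- xi / 2) <= 2 * Rpower a (- xi)).
  { apply Rle_trans with (Rpower ((a / 2) ^ 2) (- xi / 2)).
    - apply Rpower_antitone; [|lra]. split; auto. apply pow_lt; lra.
    - rewrite Rpower_sqr_half by lra. unfold Rdiv at 1. rewrite Rpower_mult_base by lra.
      rewrite Rmult_comm. mono_r.
      replace (/ 2) with (Rpower 2 (- (1))) by (rewrite Rpower_Ropp, Rpower_1; lra).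
      rewrite Rpower_mult. apply Rle_trans with (Rpower 2 1); [apply Rle_Rpower; lra|].
      rewrite Rpower_1; lra. }
  replace (Rpower (Q c) (- xi / 2 - 1)) with (Rpower (Q c) (- xi / 2) * / Q c).
  2: { unfold Rminus. rewrite Rpower_plus, Rpower_Ropp, Rpower_1 by auto. reflexivity. }
  set (Mc := Rpower (Q c) (- xi / 2)) in *. set (M := Rpower a (- xi)) in *.
  assert (HMc : 0 < Mc) by nonneg. assert (HM : 0 < M) by nonneg.
  rewrite !Rabs_mult, (Rabs_pos_eq Mc), (Rabs_pos_eq (/ Q c)),
    (Rabs_left (- xi / 2)).
  2: lra. 2: nonneg. 2: lra.
  replace (6 * M * (Rabs t / a)) with (6 * M / a * Rabs t) by (field; lra).
  mono_r.
  apply Rle_trans with (6 * Q c / a * (/ 2 * (2 * M * / Q c))).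
  - apply Rmult_le_compat; auto; [apply Rabs_pos| |].
    + nonneg.
    + apply Rmult_le_compat; try lra.
      * nonneg.
      * apply Rmult_le_compat_r; [|auto]. nonneg.
  - right. field. lra.
Qed.

Lemma Rabs_atan_minus (x y : R) : Rabs (atan x - atan y) <= Rabs (x - y).
Proof.
  destruct (mean_value atan (fun t => / (1 + t ^ 2)) y x) as [c [_ E]].
  { intros t _. pose proof (pow2_plus_1_pos t). auto_derive; auto. simpl in *; field; lra. }
  rewrite E, Rabs_mult. pose proof (pow2_ge_0 c).
  rewrite (Rabs_pos_eq (/ _)) by nonneg.
  assert (/ (1 + c ^ 2) <= 1).
  { rewrite <- Rinv_1. apply Rinv_le_contravar; lra. }
  pose proof (Rabs_pos (x - y)). nra.
Qed.

Lemma between_0 (t u : R) : Rmin 0 t <= u <= Rmax 0 t -> (t <= 0 -> t <= u <= 0) /\ (0 <= t -> 0 <= u <= t).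
Proof.
  unfold Rmin, Rmax. destruct (Rle_dec 0 t); intros; split; lra.
Qed.

Lemma gauss_tail_neg (a k : R) : 0 < a -> 0 < k ->
  Rabs (sqrt PI / 2 - gauss_primitive (sqrt a * - k) - sqrt PI) <= / (sqrt a * k).
Proof.
  intros Ha Hk. assert (0 < sqrt a) by nonneg.
  replace (sqrt a * - k) with (- (sqrt a * k)) by ring. rewrite gauss_primitive_odd.
  pose proof (gauss_primitive_bounds (sqrt a * k) ltac:(nra)).
  apply Rabs_le. lra.
Qed.

Lemma exp_neg_le_inv (x : R) : 0 < x -> exp (- x) <= / x.
Proof.
  intros Hx. rewrite exp_Ropp. apply Rinv_le_contravar; auto. pose proof (exp_ineq1_le x). lra.
Qed.

(** The saddle is tau = a. On (a/2, oo) the method of Laplace applies; on (0, a/2), where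
    tau^(-xi) is singular, the exponent is at most a^3/2, less than its saddle value 2a^3/3. *)
Lemma La_laplace (xi : R) : 0 < xi < 1 -> exists K, forall a, 1 <= a ->
  Rabs (La xi (a ^ 2) * exp (- (2 * a ^ 3 / 3)) - Rpower a (- xi) / sqrt a * sqrt PI)
    <= K * Rpower a (- xi) / a ^ 2.
Proof.
  intros Hxi. exists (4 * (18 + 55 * 6) + 2 + 6 / (1 - xi)). intros a Ha.
  set (M := Rpower a (- xi)). assert (HM : 0 < M) by nonneg.
  assert (Hs : 0 < sqrt a) by nonneg.
  assert (Hss : sqrt a * sqrt a = a) by (apply sqrt_sqrt; lra).
  pose proof (tame_has_integral xi _ Hxi (tame_La xi (a ^ 2))) as [_ [B [HB [HB0 HB1]]]].
  fold (La xi (a ^ 2)) in HB1.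
  set (c := exp (- (2 * a ^ 3 / 3))). assert (Hc : 0 < c) by nonneg.
  pose proof (laplace_estimate 6 a M (1 / 3) 0 (- (a / 2)) (c * La xi (a ^ 2))
    (fun u => Rpower ((a + u) ^ 2) (- xi / 2)) (fun _ => 0) (fun u => c * B (a + u))) as HL.
  assert (HL' : Rabs (c * La xi (a ^ 2) - c * B (a + - (a / 2))
      - M * cos 0 / sqrt a * (sqrt PI / 2 - gauss_primitive (sqrt a * - (a / 2))))
      <= 4 * (18 + 55 * 6) * M / a ^ 2).
  { apply HL; clear HL; try lra.
    - intros u Hu. evar_last.
      + apply (is_derive_scal (fun u => B (a + u))).
        apply (is_derive_comp B (fun u => a + u) u (La_integrand xi (a ^ 2) (a + u)) 1);
          [apply HB; lra|auto_derive; auto].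
      + unfold scal; simpl; unfold mult; simpl.
        change (c * (1 * La_integrand xi (a ^ 2) (a + u)) =
          exp (- (a * u ^ 2) - 1 / 3 * u ^ 3) * Rpower ((a + u) ^ 2) (- xi / 2) * cos (0 + 0)).
        rewrite Rpower_sqr_half, Rplus_0_r, cos_0 by lra.
        unfold La_integrand, c.
        rewrite Rmult_1_l, Rmult_1_r, <- Rmult_assoc, <- exp_plus. f_equal. f_equal. field.
    - intros u Hu. split; [lra|]. split.
      + apply (modulus_lipschitz xi a u (fun u => (a + u) ^ 2) (fun u => 2 * (a + u))); try lra.
        intros v Hv. destruct (between_0 _ _ Hv).
          assert (a / 2 <= a + v) by lra.
          split; [auto_derive; auto; ring|]. split; [apply pow_incr; lra|].
          pose proof (pow2_ge_0 (a + v)). simpl in *; lra.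
      + rewrite Rabs_R0. nonneg.
    - apply (filterlim_scal_ext _ (fun u => B (a + u)) _ (La xi (a ^ 2)) c);
        [intros; ring|ring| ].
      apply (filterlim_comp _ _ _ (fun u => a + u) B _ (Rbar_locally p_infty)); auto.
      intros P [N HP]. exists (N - a). intros x Hx. apply HP. lra. }
  clear HL. rewrite cos_0, Rmult_1_r in HL'.
  replace (a + - (a / 2)) with (a / 2) in HL' by field.
  pose proof (gauss_tail_neg a (a / 2) ltac:(lra) ltac:(lra)) as HG.
  (* Near the singularity at 0 the integral is exponentially small after division by exp(2a^3/3). *)
  assert (HBa : Rabs (B (a / 2)) <= exp (a ^ 3 / 2) / (1 - xi) * Rpower (a / 2) (1 - xi)).
  { apply (primitive_le_0 B (fun s => exp (a ^ 3 / 2) / (1 - xi) * Rpower s (1 - xi))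
      (La_integrand xi (a ^ 2)) (fun s => exp (a ^ 3 / 2) * Rpower s (- xi))); auto; try lra.
    - intros; apply HB; lra.
    - intros s Hs'. evar_last.
      + apply (is_derive_scal (fun s => Rpower s (1 - xi))). apply is_derive_Rpower; lra.
      + change (exp (a ^ 3 / 2) / (1 - xi) * ((1 - xi) * Rpower s (1 - xi - 1))
          = exp (a ^ 3 / 2) * Rpower s (- xi)).
        replace (1 - xi - 1) with (- xi) by ring. field. lra.
    - intros s Hs'. unfold La_integrand.
      rewrite Rabs_pos_eq by nonneg.
      mono_r. apply exp_le_compat.
      assert (0 <= s ^ 3) by (apply pow_le; lra).
      assert (a ^ 2 * s <= a ^ 2 * (a / 2)).
      { apply Rmult_le_compat_l; [apply pow_le|]; lra. }
      replace (a ^ 3 / 2) with (a ^ 2 * (a / 2)) by field. lra.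
    - apply (filterlim_scal_ext _ (fun s => Rpower s (1 - xi)) _ 0 (exp (a ^ 3 / 2) / (1 - xi)));
        [intros; ring|ring|apply Rpower_lim_0; lra]. }
  assert (Ha3 : 0 < a ^ 3) by nonneg.
  assert (Hbound : Rabs (c * B (a / 2)) <= 6 / (1 - xi) * M / a ^ 2).
  { rewrite Rabs_mult, (Rabs_pos_eq c) by lra.
    assert (H1 : c * exp (a ^ 3 / 2) <= 6 / a ^ 3).
    { unfold c. rewrite <- exp_plus.
      replace (- (2 * a ^ 3 / 3) + a ^ 3 / 2) with (- (a ^ 3 / 6)) by field.
      replace (6 / a ^ 3) with (/ (a ^ 3 / 6)) by (field; lra). apply exp_neg_le_inv; lra. }
    assert (H2 : Rpower (a / 2) (1 - xi) <= a * M).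
    { unfold M. rewrite <- Rpower_S by lra. apply Rle_Rpower_l; lra. }
    apply Rle_trans with (c * (exp (a ^ 3 / 2) / (1 - xi) * (a * M))).
    - mono_l. eapply Rle_trans; [exact HBa|].
      now mono_l.
    - replace (c * (exp (a ^ 3 / 2) / (1 - xi) * (a * M)))
        with (c * exp (a ^ 3 / 2) * (a * M / (1 - xi))) by (field; lra).
      replace (6 / (1 - xi) * M / a ^ 2) with (6 / a ^ 3 * (a * M / (1 - xi))) by (field; lra).
      now mono_r. }
  assert (HG' : Rabs (M / sqrt a * (sqrt PI / 2 - gauss_primitive (sqrt a * - (a / 2)) - sqrt PI))
     <= 2 * M / a ^ 2).
  { rewrite Rabs_mult, (Rabs_pos_eq (M / sqrt a)) by nonneg.
    apply Rle_trans with (M / sqrt a * / (sqrt a * (a / 2))).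
    - apply Rmult_le_compat_l; auto. nonneg.
    - right. replace (a ^ 2) with (sqrt a * sqrt a * a) by (rewrite Hss; ring). field. lra. }
  replace (La xi (a ^ 2) * c - M / sqrt a * sqrt PI)
    with ((c * La xi (a ^ 2) - c * B (a / 2)
         - M / sqrt a * (sqrt PI / 2 - gauss_primitive (sqrt a * - (a / 2))))
      + (c * B (a / 2) + M / sqrt a * (sqrt PI / 2 - gauss_primitive (sqrt a * - (a / 2)) - sqrt PI)))
    by ring.
  eapply Rle_trans; [apply Rabs_triang|].
  eapply Rle_trans; [apply Rplus_le_compat_l, Rabs_triang|].
  replace ((4 * (18 + 55 * 6) + 2 + 6 / (1 - xi)) * M / a ^ 2)
    with (4 * (18 + 55 * 6) * M / a ^ 2 + (6 / (1 - xi) * M / a ^ 2 + 2 * M / a ^ 2)) by (field; lra).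
  lra.
Qed.

Lemma line_up_laplace (xi a de L : R) (B : R -> R) : 0 < xi < 1 -> 1 <= a ->
  (forall x : R, is_derive B x (up_integrand xi a de x)) ->
  filterlim B (Rbar_locally p_infty) (locally L) ->
  Rabs ((L - B 0) * exp (2 * a ^ 3 / 3)
        - Rpower a (- xi) / sqrt a * (cos (de - xi * PI / 2) * (sqrt PI / 2)))
    <= 4 * (18 + 55 * 6) * Rpower a (- xi) / a ^ 2.
Proof.
  intros Hxi Ha HB HL. set (M := Rpower a (- xi)). assert (HM : 0 < M) by nonneg.
  assert (Hs : 0 < sqrt a) by nonneg.
  set (c := exp (2 * a ^ 3 / 3)). assert (Hc : 0 < c) by nonneg.
  pose proof (laplace_estimate 6 a M 0 (de - xi * PI / 2) 0 (c * L)
    (fun u => Rpower (u ^ 2 + a ^ 2) (- xi / 2)) (fun u => u ^ 3 / 3 + xi * atan (u / a))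
    (fun u => c * B u)) as H.
  replace ((L - B 0) * c - M / sqrt a * (cos (de - xi * PI / 2) * (sqrt PI / 2)))
    with (c * L - c * B 0 - M * cos (de - xi * PI / 2) / sqrt a *
      (sqrt PI / 2 - gauss_primitive (sqrt a * 0))).
  2: { rewrite Rmult_0_r, gauss_primitive_0. field. lra. }
  apply H; clear H; try lra.
  - intros u _. evar_last; [apply (is_derive_scal B), HB|].
    unfold up_integrand, c. rewrite <- !Rmult_assoc, <- exp_plus. f_equal; [f_equal|]; f_equal; field.
  - intros u Hu. split; [nra|]. split.
    + apply (modulus_lipschitz xi a u (fun u => u ^ 2 + a ^ 2) (fun u => 2 * u)); try lra.
      intros v Hv. pose proof (pow2_ge_0 v). pose proof (pow2_ge_0 a).
        split; [auto_derive; auto; ring|]. split; simpl in *; lra.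
    + pose proof (Rabs_pos u). pose proof (Rabs_pos (u / a)).
      eapply Rle_trans; [apply Rabs_triang|]. rewrite Rabs_mult, (Rabs_pos_eq xi) by lra.
      pose proof (Rabs_atan_minus (u / a) 0) as Hat. rewrite atan_0, !Rminus_0_r in Hat.
      replace (Rabs (u / a)) with (Rabs u / a) in *
        by (rewrite Rabs_div, (Rabs_pos_eq a); lra).
      replace (Rabs (u ^ 3 / 3)) with (Rabs u ^ 3 / 3)
        by (rewrite RPow_abs, Rabs_div, (Rabs_pos_eq 3); lra).
      assert (0 <= Rabs u ^ 3) by now apply pow_le.
      pose proof (Rabs_pos (atan (u / a))). nra.
  - apply (filterlim_scal_ext _ B _ L c);
      [intros; ring|ring|assumption].
Qed.

(** The path starts at v = - a, which is so far from the saddle that replacing - a by -oo in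
    the Gaussian costs only a relative error of order a^(-3/2). *)
Lemma line_down_laplace (xi a de L : R) (B : R -> R) : 0 < xi < 1 -> 1 <= a ->
  (forall v : R, is_derive B v (down_integrand xi a de v)) ->
  filterlim B (Rbar_locally p_infty) (locally L) ->
  Rabs (L - B (- a)
        - Rpower a (- xi) / sqrt a * (sqrt PI * cos (de + PI / 4 - 2 / 3 * a ^ 3)))
    <= (2 * (18 + 55 * 12) + 1) * Rpower a (- xi) / a ^ 2.
Proof.
  intros Hxi Ha HB HL. set (M := Rpower a (- xi)). assert (HM : 0 < M) by nonneg.
  assert (Hs : 0 < sqrt a) by nonneg.
  assert (Hss : sqrt a * sqrt a = a) by (apply sqrt_sqrt; lra).
  assert (H2 : 0 < sqrt 2) by nonneg.
  assert (H22 : sqrt 2 * sqrt 2 = 2) by (apply sqrt_sqrt; lra).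
  assert (H2le : sqrt 2 <= 2) by nra.
  set (c0 := de + PI / 4 - 2 / 3 * a ^ 3).
  pose proof (laplace_estimate 12 (2 * a) M (2 / 3) c0 (- a) (/ sqrt 2 * L)
    (fun v => Rpower ((a + v) ^ 2 + v ^ 2) (- xi / 2))
    (fun v => - (2 / 3 * v ^ 3 + xi * (atan (1 + 2 * v / a) - PI / 4)))
    (fun v => / sqrt 2 * B v)) as H.
  assert (H' : Rabs (/ sqrt 2 * L - / sqrt 2 * B (- a)
     - M * cos c0 / sqrt (2 * a) * (sqrt PI / 2 - gauss_primitive (sqrt (2 * a) * - a)))
     <= 4 * (18 + 55 * 12) * M / (2 * a) ^ 2).
  { apply H; clear H; try lra.
    - intros v _. evar_last; [apply (is_derive_scal B), HB|].
      unfold down_integrand.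
      change (/ sqrt 2 * (sqrt 2 * (exp (- (2 * a * v ^ 2) - 2 / 3 * v ^ 3) *
        Rpower ((a + v) ^ 2 + v ^ 2) (- xi / 2) * cos (c0 - (2 / 3 * v ^ 3
          + xi * (atan (1 + 2 * v / a) - PI / 4))))) =
        exp (- (2 * a * v ^ 2) - 2 / 3 * v ^ 3) *
        Rpower ((a + v) ^ 2 + v ^ 2) (- xi / 2) * cos (c0 + - (2 / 3 * v ^ 3
          + xi * (atan (1 + 2 * v / a) - PI / 4)))).
      unfold Rminus at 2. field. lra.
    - intros v Hv. pose proof (Rabs_pos v) as Hv0.
      assert (Hva : Rabs v / (2 * a) * 2 = Rabs v / a) by (field; lra).
      split; [lra|]. split.
      + replace (12 * M * (Rabs v / (2 * a))) with (6 * M * (Rabs v / a)) by (field; lra).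
        apply (modulus_lipschitz xi a v (fun v => (a + v) ^ 2 + v ^ 2)
          (fun v => 2 * (a + v) + 2 * v)); try lra.
        intros w _. split; [auto_derive; auto; ring|].
          pose proof (pow2_ge_0 (a + 2 * w)). pose proof (pow2_ge_0 a). split; simpl in *; lra.
      + rewrite Rabs_Ropp. eapply Rle_trans; [apply Rabs_triang|].
        rewrite !Rabs_mult, (Rabs_pos_eq xi), (Rabs_pos_eq (2 / 3)), <- RPow_abs by lra.
        pose proof (Rabs_atan_minus (1 + 2 * v / a) 1) as Hat. rewrite atan_1 in Hat.
        replace (1 + 2 * v / a - 1) with (2 * (v / a)) in Hat by (field; lra).
        rewrite Rabs_mult, (Rabs_pos_eq 2), Rabs_div, (Rabs_pos_eq a) in Hat by lra.
        assert (0 <= Rabs v ^ 3) by now apply pow_le.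
        pose proof (Rabs_pos (atan (1 + 2 * v / a) - PI / 4)). nra.
    - apply (filterlim_scal_ext _ B _ L (/ sqrt 2));
        [intros; ring|ring|assumption]. }
  clear H.
  rewrite sqrt_mult in H' by lra.
  set (G := sqrt PI / 2 - gauss_primitive (sqrt 2 * sqrt a * - a)) in *.
  assert (HG : Rabs (G - sqrt PI) <= / (sqrt 2 * sqrt a * a)).
  { unfold G. rewrite <- sqrt_mult by lra. apply gauss_tail_neg; lra. }
  replace (L - B (- a) - M / sqrt a * (sqrt PI * cos c0))
    with (sqrt 2 * (/ sqrt 2 * L - / sqrt 2 * B (- a) - M * cos c0 / (sqrt 2 * sqrt a) * G)
      + M / sqrt a * cos c0 * (G - sqrt PI)) by (field; lra).
  eapply Rle_trans; [apply Rabs_triang|].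
  rewrite Rabs_mult, (Rabs_pos_eq (sqrt 2)) by lra.
  assert (T1 : sqrt 2 * Rabs (/ sqrt 2 * L - / sqrt 2 * B (- a) - M * cos c0 / (sqrt 2 * sqrt a) * G)
    <= 2 * (4 * (18 + 55 * 12) * M / (2 * a) ^ 2)).
  { apply Rmult_le_compat; auto; [lra|apply Rabs_pos]. }
  assert (T2 : Rabs (M / sqrt a * cos c0 * (G - sqrt PI)) <= M / a ^ 2).
  { rewrite !Rabs_mult, (Rabs_pos_eq (M / sqrt a)) by nonneg.
    apply Rle_trans with (M / sqrt a * 1 * / (sqrt 2 * sqrt a * a)).
    - apply Rmult_le_compat; auto using Rabs_pos.
      + nonneg.
      + apply Rmult_le_compat_l; [nonneg|apply Rabs_cos_le].
    - replace (M / sqrt a * 1 * / (sqrt 2 * sqrt a * a)) with (M / a ^ 2 * / sqrt 2).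
      + assert (/ sqrt 2 <= 1) by (rewrite <- Rinv_1; apply Rinv_le_contravar; nra).
        assert (0 <= M / a ^ 2) by nonneg. nra.
      + replace (a ^ 2) with (sqrt a * sqrt a * a) by (rewrite Hss; ring). field. lra. }
  replace ((2 * (18 + 55 * 12) + 1) * M / a ^ 2)
    with (2 * (4 * (18 + 55 * 12) * M / (2 * a) ^ 2) + M / a ^ 2) by (field; lra).
  lra.
Qed.

(** * Asymptotics of the three solutions *)

(** Value of int_0^oo cos (s^3/3 + th s + de) s^(-xi) ds, by [has_integral_fresnel]. *)
Definition fresnel (xi de th : R) : R :=
  ray_integral xi 0 (2 * PI / 3) (de + (1 - xi) * (PI / 6)) th.

Lemma Lb_fresnel (xi th : R) : 0 < xi < 1 ->
  converges_pos (Lb_integrand xi th) /\ Lb xi th = fresnel xi (xi * PI / 2) th.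
Proof.
  intros Hxi. apply (has_integral_correct (Lb_integrand xi th)).
  now apply (has_integral_fresnel xi th (xi * PI / 2)).
Qed.

Lemma Lc_fresnel (xi th : R) : 0 < xi < 1 ->
  converges_pos (Lc_integrand xi th) /\ Lc xi th = fresnel xi (- (xi * PI / 2)) th.
Proof.
  intros Hxi. apply (has_integral_correct (Lc_integrand xi th)).
  now apply (has_integral_fresnel xi th (- (xi * PI / 2))).
Qed.

(** The vertical part of the path carries the integrand of La over (0, a); the missing part
    over (a, oo) is smaller than the error term. *)
Lemma fresnel_minf (xi : R) : 0 < xi < 1 -> exists K, 0 <= K /\ forall a de, 1 <= a ->
  Rabs (fresnel xi de (- a ^ 2) - cos (de - (1 - xi) * (PI / 2)) * La xi (- a ^ 2)
        - Rpower a (- xi) / sqrt a * (sqrt PI * cos (de + PI / 4 - 2 / 3 * a ^ 3)))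
    <= K * Rpower a (- xi) / a ^ 2.
Proof.
  intros Hxi. exists (2 * (18 + 55 * 12) + 2). split; [lra|]. intros a de Ha.
  destruct (contour_down xi a de Hxi ltac:(lra)) as [B1 [B2 [HB1 [HB10 [HB2 [HL HE]]]]]].
  fold (fresnel xi de (- a ^ 2)) in HL.
  pose proof (line_down_laplace xi a de _ B2 Hxi Ha HB2 HL) as H.
  set (M := Rpower a (- xi)) in *. assert (HM : 0 < M) by nonneg.
  pose proof (tame_has_integral xi _ Hxi (tame_La xi (- a ^ 2))) as [_ [B [HB [HB0 HBl]]]].
  fold (La xi (- a ^ 2)) in HBl. set (k := cos (de - (1 - xi) * (PI / 2))) in *.
  assert (Hk : B1 a = k * B a).
  { apply (primitive_unique B1 (fun s => k * B s) (fun s => k * La_integrand xi (- a ^ 2) s));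
      auto; [| |lra].
    - intros s Hs. apply (is_derive_scal B). auto.
    - apply (filterlim_scal_ext _ B _ 0 k);
        [intros; ring|ring|assumption]. }
  assert (Htail : Rabs (La xi (- a ^ 2) - B a) <= M / a ^ 2).
  { assert (Ha2 : 0 < a ^ 2) by nonneg.
    pose proof (primitive_le_infty B (fun s => - (M / a ^ 2) * exp (- a ^ 2 * s))
      (La_integrand xi (- a ^ 2)) (fun s => M * exp (- a ^ 2 * s)) a (La xi (- a ^ 2)) 0) as HT.
    eapply Rle_trans; [apply HT; clear HT|].
    - intros s Hs. apply HB; lra.
    - intros s _. auto_derive; auto. simpl in *; field; lra.
    - intros s Hs. unfold La_integrand.
      rewrite Rabs_pos_eq by nonneg.
      rewrite Rmult_comm. apply Rmult_le_compat; try nonneg.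
      + unfold M. apply Rpower_antitone; lra.
      + apply exp_le_compat. assert (0 <= s ^ 3) by (apply pow_le; lra). lra.
    - auto.
    - apply filterlim_eps. intros eps Heps.
      exists (Rmax 1 (M / eps)). intros s Hs.
      pose proof (Rmax_l 1 (M / eps)). pose proof (Rmax_r 1 (M / eps)).
      rewrite Rminus_0_r, Rabs_mult, Rabs_Ropp.
      assert (HMa : 0 < M / a ^ 2) by nonneg.
      rewrite !Rabs_pos_eq by (try nonneg; lra).
      assert (H1a : 1 <= a ^ 2) by (apply pow_R1_Rle; auto).
      assert (HMa1 : M / a ^ 2 <= M) by (apply Rle_div_l; nra).
      assert (He : exp (- a ^ 2 * s) <= / s).
      { apply Rle_trans with (exp (- s)); [apply exp_le_compat; nra|]. apply exp_neg_le_inv; lra. }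
      pose proof (exp_pos (- a ^ 2 * s)).
      apply Rle_lt_trans with (M * / s); [apply Rmult_le_compat; lra|].
      apply Rlt_div_l; [lra|].
      assert (M / eps * eps < s * eps) by (apply Rmult_lt_compat_r; lra).
      replace (M / eps * eps) with M in * by (field; lra). lra.
    - assert (exp (- a ^ 2 * a) <= 1).
      { rewrite <- exp_0. apply exp_le_compat. nra. }
      assert (0 < M / a ^ 2) by nonneg.
      pose proof (exp_pos (- a ^ 2 * a)). nra. }
  rewrite HE, Hk in H.
  replace (fresnel xi de (- a ^ 2) - k * La xi (- a ^ 2)
        - M / sqrt a * (sqrt PI * cos (de + PI / 4 - 2 / 3 * a ^ 3)))
    with (fresnel xi de (- a ^ 2) - k * B a
        - M / sqrt a * (sqrt PI * cos (de + PI / 4 - 2 / 3 * a ^ 3))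
        - k * (La xi (- a ^ 2) - B a)) by ring.
  unfold Rminus at 1. eapply Rle_trans; [apply Rabs_triang|].
  rewrite Rabs_Ropp, Rabs_mult.
  pose proof (Rabs_cos_le (de - (1 - xi) * (PI / 2))) as Hc. fold k in Hc.
  replace ((2 * (18 + 55 * 12) + 2) * M / a ^ 2)
    with ((2 * (18 + 55 * 12) + 1) * M / a ^ 2 + M / a ^ 2) by (field; lra).
  pose proof (Rabs_pos (La xi (- a ^ 2) - B a)). pose proof (Rabs_pos k). nra.
Qed.

(** The coefficient of the vertical part is cos (PI/2) = 0. *)
Lemma Lb_pinf (xi : R) : 0 < xi < 1 -> exists K, forall a, 1 <= a ->
  Rabs (Lb xi (a ^ 2) * exp (2 * a ^ 3 / 3) - Rpower a (- xi) / sqrt a * (sqrt PI / 2))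
    <= K * Rpower a (- xi) / a ^ 2.
Proof.
  intros Hxi. exists (4 * (18 + 55 * 6)). intros a Ha.
  rewrite (proj2 (Lb_fresnel xi (a ^ 2) Hxi)).
  destruct (contour_up xi a (xi * PI / 2) Hxi ltac:(lra)) as [B1 [B2 [HB1 [HB10 [HB2 [HL HE]]]]]].
  pose proof (line_up_laplace xi a _ _ B2 Hxi Ha HB2 HL) as H.
  fold (fresnel xi (xi * PI / 2) (a ^ 2)) in H.
  assert (Hk : B1 a = 0).
  { apply (primitive_unique B1 (fun _ => 0) (fun _ => 0)); [| | | |lra].
    - intros s Hs. evar_last; [now apply HB1|].
      replace (xi * PI / 2 + (1 - xi) * (PI / 2)) with (PI / 2) by field.
      rewrite cos_PI2. apply Rmult_0_l.
    - intros s _. apply (is_derive_const (K := R_AbsRing) (V := R_NormedModule)).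
    - auto.
    - apply filterlim_const. }
  rewrite HE, Hk, Rminus_0_r, Rminus_diag, cos_0, Rmult_1_l in H. exact H.
Qed.

(** On (0, a) the cubic satisfies s^3 <= a^2 s, so that exp(s^3/3) - 1 is at most s^3/3 exp(a^2
    s/3), and a^6 s^3 is absorbed by another exp(a^2 s/6). What remains is a Gamma integral,
    rescaled by a^2 and truncated at s = a. *)
Lemma exp_cubic_vertical (xi : R) : 0 < xi < 1 -> exists K, 0 <= K /\ forall a (V : R -> R), 1 <= a ->
  (forall s, 0 < s -> is_derive V s (exp (s ^ 3 / 3 - a ^ 2 * s) * Rpower s (- xi))) ->
  filterlim V (at_right 0) (locally 0) ->
  Rabs (V a - Rpower (a ^ 2) (- (1 - xi)) * Gamma (1 - xi))
    <= K / a ^ 3 * Rpower (a ^ 2) (- (1 - xi)).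
Proof.
  intros Hxi. set (W := int_pos (weight xi)).
  assert (HW : 0 < W) by now apply int_pos_weight_pos.
  exists (434 * W). split; [lra|]. intros a V Ha HV HV0.
  set (th := a ^ 2). set (R0 := Rpower th (- (1 - xi))).
  assert (Hth : 1 <= th) by (apply pow_R1_Rle; auto).
  assert (HR0 : R0 = Rpower th xi / th).
  { unfold R0. replace (- (1 - xi)) with (xi + - (1)) by ring.
    rewrite Rpower_plus, Rpower_Ropp, Rpower_1 by lra. reflexivity. }
  assert (HR0p : 0 < R0) by nonneg.
  assert (Hscale : forall f (g : R -> R) l, has_integral f l ->
    (forall s, 0 < s -> f (th * s) = g (th * s) * Rpower (th * s) (- xi)) ->
    has_integral (fun s => g (th * s) * Rpower s (- xi)) (R0 * l)).
  { intros f g l Hf Hfg. apply (has_integral_rescale _ _ th ltac:(lra)) in Hf.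
    apply (fun H => has_integral_lincomb _ _ _ _ (Rpower th xi) 0 H H) in Hf.
    replace (R0 * l) with (Rpower th xi * (l / th) + 0 * (l / th)) by (rewrite HR0; field; lra).
    refine (has_integral_ext _ _ _ _ Hf). intros s Hs. cbv beta.
    rewrite Hfg, Rpower_mult_base, (Rpower_Ropp th) by lra. field. apply Rgt_not_eq, exp_pos. }
  pose proof (tame_has_integral xi _ Hxi (tame_E2_kernel xi 0 0 ltac:(lra))) as HG.
  fold (E2_deriv xi 0 0) in HG. rewrite E2_deriv_0 in HG.
  apply (Hscale _ (fun u => exp (- u))) in HG.
  2: { intros s Hs. unfold E2_kernel. rewrite pow_O, Rmult_1_l. f_equal. f_equal. field. }
  pose proof (tame_has_integral xi _ Hxi (tame_weight xi)) as HWi. fold W in HWi.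
  apply (Hscale _ (fun u => exp (- u / 2))) in HWi.
  2: { intros s Hs. unfold weight. ring. }
  destruct HG as [_ [D [HD [HD0 HD1]]]]. destruct HWi as [_ [E [HE [HE0 HE1]]]].
  cbv beta in HD, HE.
  assert (Ha3 : 1 <= a ^ 3) by (apply pow_R1_Rle; auto).
  assert (Hath : th * a = a ^ 3) by (unfold th; ring).
  assert (HEa : 0 <= E a <= R0 * W).
  { split.
    - assert (H : Rabs (E a) <= E a).
      { apply (primitive_le_0 E E (fun s => exp (- (th * s) / 2) * Rpower s (- xi))
          (fun s => exp (- (th * s) / 2) * Rpower s (- xi))); auto; try lra.
        - intros; apply HE; lra.
        - intros; apply HE; lra.
        - intros. rewrite Rabs_pos_eq; [lra|]. nonneg. }
      pose proof (Rabs_pos (E a)). lra.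
    - assert (H : Rabs (R0 * W - E a) <= R0 * W - E a).
      { apply (primitive_le_infty E E (fun s => exp (- (th * s) / 2) * Rpower s (- xi))
          (fun s => exp (- (th * s) / 2) * Rpower s (- xi))); auto.
        - intros; apply HE; lra.
        - intros; apply HE; lra.
        - intros. rewrite Rabs_pos_eq; [lra|]. nonneg. }
      pose proof (Rabs_pos (R0 * W - E a)). lra. }
  assert (Hth3 : a ^ 3 <= th ^ 3).
  { unfold th. rewrite <- pow_mult. apply Rle_pow; [auto|lia]. }
  assert (H1 : Rabs (V a - D a) <= 432 / th ^ 3 * E a).
  { apply (primitive_le_0 (fun s => V s - D s) (fun s => 432 / th ^ 3 * E s)
      (fun s => exp (s ^ 3 / 3 - th * s) * Rpower s (- xi) - exp (- (th * s)) * Rpower s (- xi))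
      (fun s => 432 / th ^ 3 * (exp (- (th * s) / 2) * Rpower s (- xi)))); try lra.
    - intros s Hs. apply (is_derive_minus (V := R_NormedModule)); [apply HV|apply HD]; lra.
    - intros s Hs. apply (is_derive_scal E). apply HE; lra.
    - intros s Hs. rewrite <- Rmult_minus_distr_r, Rabs_mult, (Rabs_pos_eq (Rpower _ _))
        by nonneg.
      rewrite <- Rmult_assoc. mono_r.
      replace (s ^ 3 / 3 - th * s) with (s ^ 3 / 3 + - (th * s)) by ring.
      rewrite exp_plus.
      replace (exp (s ^ 3 / 3) * exp (- (th * s)) - exp (- (th * s)))
        with ((exp (s ^ 3 / 3) - 1) * exp (- (th * s))) by ring.
      rewrite Rabs_mult, (Rabs_pos_eq (exp (- (th * s))))
        by nonneg.
      assert (Hs3 : 0 < s ^ 3) by nonneg.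
      assert (Hsth : s ^ 3 <= th * s).
      { unfold th. replace (s ^ 3) with (s ^ 2 * s) by ring. mono_r.
        apply pow_incr; lra. }
      assert (Hu : 0 < th * s) by nra.
      assert (Hpw : (th * s / 6) ^ 3 <= 6 * exp (th * s / 6)).
      { pose proof (pow_le_fact_exp 3 (th * s / 6) ltac:(lra)) as Hf. simpl fact in Hf.
        simpl INR in Hf. lra. }
      apply Rle_trans with (s ^ 3 / 3 * exp (th * s / 3) * exp (- (th * s))).
      + mono_r.
        rewrite <- (Rabs_pos_eq (s ^ 3 / 3)) at 2 by lra. apply exp_minus_1_le; lra.
      + apply Rle_trans with (432 / th ^ 3 * exp (th * s / 6) * exp (th * s / 3) * exp (- (th * s))).
        * mono_r.
          mono_r.
          replace (s ^ 3 / 3) with (72 / th ^ 3 * (th * s / 6) ^ 3) by (field; lra).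
          replace (432 / th ^ 3 * exp (th * s / 6)) with (72 / th ^ 3 * (6 * exp (th * s / 6)))
            by (field; lra).
          apply Rmult_le_compat_l; auto. nonneg.
        * right. rewrite !Rmult_assoc, <- !exp_plus. do 2 f_equal. field.
    - apply (filterlim_lincomb_ext _ V D _ 0 0 1 (-1)); [intros; ring|ring|assumption|assumption].
    - apply (filterlim_scal_ext _ E _ 0 (432 / th ^ 3));
        [intros; ring|ring|assumption]. }
  assert (H2 : Rabs (R0 * Gamma (1 - xi) - D a)
    <= exp (- (a ^ 3 / 2)) * (R0 * W) - exp (- (a ^ 3 / 2)) * E a).
  { apply (primitive_le_infty D (fun s => exp (- (a ^ 3 / 2)) * E s)
      (fun s => exp (- (th * s)) * Rpower s (- xi))
      (fun s => exp (- (a ^ 3 / 2)) * (exp (- (th * s) / 2) * Rpower s (- xi)))); auto.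
    - intros; apply HD; lra.
    - intros s Hs. apply (is_derive_scal E). apply HE; lra.
    - intros s Hs. rewrite Rabs_pos_eq by nonneg.
      rewrite <- Rmult_assoc. mono_r.
      rewrite <- exp_plus. apply exp_le_compat. rewrite <- Hath. nra.
    - apply (filterlim_scal_ext _ E _ (R0 * W) (exp (- (a ^ 3 / 2))));
        [intros; ring|ring|assumption]. }
  assert (He : exp (- (a ^ 3 / 2)) <= 2 / a ^ 3).
  { replace (2 / a ^ 3) with (/ (a ^ 3 / 2)) by (field; lra). apply exp_neg_le_inv; lra. }
  assert (HRW : 0 < R0 * W) by nra.
  assert (H1' : 432 / th ^ 3 * E a <= 432 / a ^ 3 * (R0 * W)).
  { apply Rmult_le_compat; try lra.
    - nonneg.
    - unfold Rdiv. mono_l. apply Rinv_le_contravar; lra. }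
  assert (H2' : exp (- (a ^ 3 / 2)) * (R0 * W) - exp (- (a ^ 3 / 2)) * E a <= 2 / a ^ 3 * (R0 * W)).
  { pose proof (exp_pos (- (a ^ 3 / 2))).
    assert (exp (- (a ^ 3 / 2)) * (R0 * W) <= 2 / a ^ 3 * (R0 * W))
      by (apply Rmult_le_compat_r; lra).
    nra. }
  replace (V a - R0 * Gamma (1 - xi)) with ((V a - D a) + - (R0 * Gamma (1 - xi) - D a)) by ring.
  eapply Rle_trans; [apply Rabs_triang|]. rewrite Rabs_Ropp.
  replace (434 * W / a ^ 3 * R0) with (432 / a ^ 3 * (R0 * W) + 2 / a ^ 3 * (R0 * W)) by (field; lra).
  lra.
Qed.

Lemma Lc_pinf (xi : R) : 0 < xi < 1 -> exists K, forall a, 1 <= a ->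
  Rabs (Lc xi (a ^ 2) - sin (xi * PI) * Rpower (a ^ 2) (- (1 - xi)) * Gamma (1 - xi))
    <= K / a * Rpower (a ^ 2) (- (1 - xi)).
Proof.
  intros Hxi. destruct (exp_cubic_vertical xi Hxi) as [K [HK HV]].
  pose proof PI_RGT_0. pose proof PI_4.
  assert (Hsin : 0 < sin (xi * PI) <= 1).
  { split; [apply sin_gt_0; nra|apply SIN_bound]. }
  exists (K + 2 * (1 + 4 * (18 + 55 * 6))). intros a Ha.
  rewrite (proj2 (Lc_fresnel xi (a ^ 2) Hxi)).
  destruct (contour_up xi a (- (xi * PI / 2)) Hxi ltac:(lra)) as [B1 [B2 [HB1 [HB10 [HB2 [HL HE]]]]]].
  pose proof (line_up_laplace xi a _ _ B2 Hxi Ha HB2 HL) as HU.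
  fold (fresnel xi (- (xi * PI / 2)) (a ^ 2)) in HU.
  set (F := fresnel xi (- (xi * PI / 2)) (a ^ 2)) in *.
  replace (cos (- (xi * PI / 2) + (1 - xi) * (PI / 2))) with (sin (xi * PI)) in HB1.
  2: { rewrite <- cos_shift. f_equal. field. }
  set (R0 := Rpower (a ^ 2) (- (1 - xi))) in *. assert (HR0 : 0 < R0) by nonneg.
  set (M := Rpower a (- xi)) in *. assert (HM : 0 < M) by nonneg.
  assert (Hs : 0 < sqrt a) by nonneg.
  assert (Hs1 : 1 <= sqrt a) by (rewrite <- sqrt_1; apply sqrt_le_1; lra).
  assert (H1 : Rabs (B1 a - sin (xi * PI) * (R0 * Gamma (1 - xi))) <= K / a ^ 3 * R0).
  { specialize (HV a (fun s => / sin (xi * PI) * B1 s) Ha). cbv beta in HV. fold R0 in HV.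
    replace (B1 a - sin (xi * PI) * (R0 * Gamma (1 - xi)))
      with (sin (xi * PI) * (/ sin (xi * PI) * B1 a - R0 * Gamma (1 - xi))) by (field; lra).
    rewrite Rabs_mult, (Rabs_pos_eq (sin _)) by lra.
    assert (HV' : Rabs (/ sin (xi * PI) * B1 a - R0 * Gamma (1 - xi)) <= K / a ^ 3 * R0).
    { apply HV.
      - intros s Hs'. evar_last; [apply (is_derive_scal B1), HB1; auto|].
        rewrite <- Rmult_assoc, Rinv_l by lra. apply Rmult_1_l.
      - apply (filterlim_scal_ext _ B1 _ 0 (/ sin (xi * PI)));
          [intros; ring|ring|assumption]. }
    pose proof (Rabs_pos (/ sin (xi * PI) * B1 a - R0 * Gamma (1 - xi))). nra. }
  (* The saddle term is at most a constant times exp(-2a^3/3), hence O(a^(-3)), while R0 >= a^(-2). *)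
  set (Ka := 4 * (18 + 55 * 6)) in *.
  assert (HM1 : M <= 1) by (apply Rpower_le_1; lra).
  assert (Ha3 : 0 < a ^ 3) by nonneg.
  assert (Ha2 : 1 <= a ^ 2) by (apply pow_R1_Rle; lra).
  assert (HR0a : / a ^ 2 <= R0).
  { rewrite <- (Rpower_1 (a ^ 2)) at 1 by lra. rewrite <- Rpower_Ropp. apply Rle_Rpower; lra. }
  pose proof sqrt_PI_bounds as HPI.
  assert (H2 : Rabs ((F - B2 0) * exp (2 * a ^ 3 / 3)) <= 1 + Ka).
  { set (m := M / sqrt a * (cos (- (xi * PI / 2) - xi * PI / 2) * (sqrt PI / 2))) in *.
    replace ((F - B2 0) * exp (2 * a ^ 3 / 3)) with ((F - B2 0) * exp (2 * a ^ 3 / 3) - m + m) by ring.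
    eapply Rle_trans; [apply Rabs_triang|]. rewrite Rplus_comm. apply Rplus_le_compat.
    - unfold m. rewrite !Rabs_mult, (Rabs_pos_eq (sqrt PI / 2)), (Rabs_pos_eq (M / sqrt a))
        by nonneg.
      pose proof (Rabs_cos_le (- (xi * PI / 2) - xi * PI / 2)) as Hc.
      pose proof (Rabs_pos (cos (- (xi * PI / 2) - xi * PI / 2))).
      assert (M / sqrt a <= 1) by (apply Rle_div_l; lra).
      assert (0 < M / sqrt a) by nonneg.
      assert (Rabs (cos (- (xi * PI / 2) - xi * PI / 2)) * (sqrt PI / 2) <= 1) by nra.
      assert (0 <= Rabs (cos (- (xi * PI / 2) - xi * PI / 2)) * (sqrt PI / 2))
        by nonneg.
      nra.
    - eapply Rle_trans; [exact HU|]. unfold Ka. apply Rle_div_l; nra. }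
  assert (H3 : Rabs (F - B2 0) <= 2 * (1 + Ka) / a * R0).
  { set (e := exp (2 * a ^ 3 / 3)) in *. assert (Hep : 2 * a ^ 3 / 3 <= e).
    { unfold e. pose proof (exp_ineq1_le (2 * a ^ 3 / 3)). lra. }
    rewrite Rabs_mult, (Rabs_pos_eq e) in H2 by lra.
    apply Rle_trans with ((1 + Ka) / e).
    - apply Rle_div_r; [lra|auto].
    - apply Rle_trans with (2 * (1 + Ka) / a * / a ^ 2).
      + replace (2 * (1 + Ka) / a * / a ^ 2) with ((1 + Ka) * / (a ^ 3 / 2)) by (field; lra).
        apply Rmult_le_compat_l; [unfold Ka; lra|]. apply Rinv_le_contravar; lra.
      + apply Rmult_le_compat_l; [|auto]. left; apply Rdiv_lt_0_compat; unfold Ka; lra. }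
  assert (H4 : K / a ^ 3 * R0 <= K / a * R0).
  { mono_r. mono_l.
    apply Rinv_le_contravar; [lra|]. replace (a ^ 3) with (a * a ^ 2) by ring. nra. }
  rewrite HE in H3.
  replace (F - sin (xi * PI) * R0 * Gamma (1 - xi))
    with ((F - B1 a) + (B1 a - sin (xi * PI) * (R0 * Gamma (1 - xi)))) by ring.
  eapply Rle_trans; [apply Rabs_triang|].
  replace ((K + 2 * (1 + Ka)) / a * R0) with (2 * (1 + Ka) / a * R0 + K / a * R0) by (field; lra).
  lra.
Qed.

Lemma ratio_asymptotics (f g : R -> R) (K : R) :
  (forall a, 1 <= a -> 0 < g (a ^ 2) /\ Rabs (f (a ^ 2) - g (a ^ 2)) <= K / a * g (a ^ 2)) ->
  exists o : R -> R, is_lim o p_infty 0 /\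
     Rbar_locally p_infty (fun th => f th = g th * (1 + o th)).
Proof.
  intros H.
  assert (H' : forall th, 1 <= th -> 0 < g th /\ Rabs (f th - g th) <= K / sqrt th * g th).
  { intros th Hth. assert (Hs : 1 <= sqrt th) by (rewrite <- sqrt_1; apply sqrt_le_1; lra).
    specialize (H (sqrt th) Hs). rewrite pow2_sqrt in H by lra. exact H. }
  exists (fun th => f th / g th - 1). split.
  - apply is_lim_spec. intros eps. pose proof (cond_pos eps) as Heps. cbn beta.
    exists (Rmax 1 ((Rabs K / eps + 1) ^ 2)). intros th Hth.
    pose proof (Rmax_l 1 ((Rabs K / eps + 1) ^ 2)). pose proof (Rmax_r 1 ((Rabs K / eps + 1) ^ 2)).
    destruct (H' th ltac:(lra)) as [Hg Hf].
    rewrite Rminus_0_r. replace (f th / g th - 1) with ((f th - g th) / g th) by (field; lra).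
    rewrite Rabs_div, (Rabs_pos_eq (g th)) by lra.
    apply Rlt_div_l; auto. eapply Rle_lt_trans; [exact Hf|]. apply Rmult_lt_compat_r; auto.
    assert (HKe : 0 <= Rabs K / eps) by nonneg.
    assert (Hs : Rabs K / eps < sqrt th).
    { apply Rlt_le_trans with (Rabs K / eps + 1); [lra|].
      rewrite <- (sqrt_pow2 (Rabs K / eps + 1)) by lra. apply sqrt_le_1; try lra. apply pow2_ge_0. }
    apply Rlt_div_l; [lra|]. apply Rle_lt_trans with (Rabs K); [apply Rle_abs|].
    apply (Rmult_lt_compat_r eps) in Hs; auto. unfold Rdiv in Hs.
    rewrite Rmult_assoc, Rinv_l, Rmult_1_r in Hs by lra. lra.
  - exists 1. intros th Hth. destruct (H' th ltac:(lra)) as [Hg _]. field. lra.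
Qed.

Lemma Rpower_saddle (xi a : R) : 0 < a ->
  Rpower (a ^ 2) ((1 - xi) / 2 - 3 / 4) = Rpower a (- xi) / sqrt a.
Proof.
  intros Ha. replace ((1 - xi) / 2 - 3 / 4) with ((- xi + - / 2) / 2) by field.
  rewrite Rpower_sqr_half, Rpower_plus, (Rpower_Ropp a (/ 2)), Rpower_sqrt by auto. reflexivity.
Qed.

Lemma Rpower_three_halves (a : R) : 0 < a -> Rpower (a ^ 2) (3 / 2) = a ^ 3.
Proof.
  intros Ha. rewrite Rpower_sqr_half by auto. replace 3 with (INR 3) by (simpl; ring).
  now apply Rpower_pow.
Qed.

Lemma saddle_error (M a K : R) : 0 < M -> 1 <= a ->
  K * M / a ^ 2 <= Rabs K / a * (M / sqrt a).
Proof.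
  intros HM Ha.
  assert (Hs1 : 1 <= sqrt a) by (rewrite <- sqrt_1; apply sqrt_le_1; lra).
  assert (Hss : sqrt a * sqrt a = a) by (apply sqrt_sqrt; lra).
  apply Rle_trans with (Rabs K * M / a ^ 2).
  - mono_r. mono_r. apply Rle_abs.
  - replace (Rabs K / a * (M / sqrt a)) with (Rabs K * M * / (a * sqrt a)) by (field; lra).
    mono_l.
    apply Rinv_le_contravar; [nra|]. simpl. nra.
Qed.

Lemma scaled_exp_error (f e M a K c : R) : 0 < M -> 1 <= a -> 1 / 2 <= c ->
  Rabs (f * exp e - M / sqrt a * c) <= K * M / a ^ 2 ->
  Rabs (f - c * (M / sqrt a) * exp (- e)) <= 2 * Rabs K / a * (c * (M / sqrt a) * exp (- e)).
Proof.
  intros HM Ha Hc H.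
  assert (Hs1 : 1 <= sqrt a) by (rewrite <- sqrt_1; apply sqrt_le_1; lra).
  pose proof (saddle_error M a K HM Ha) as HE.
  pose proof (exp_pos e) as He. rewrite exp_Ropp.
  replace (f - c * (M / sqrt a) * / exp e) with ((f * exp e - M / sqrt a * c) * / exp e)
    by (field; lra).
  rewrite Rabs_mult, (Rabs_pos_eq (/ exp e)) by nonneg.
  rewrite <- !Rmult_assoc. rewrite Rmult_assoc. rewrite Rmult_assoc.
  rewrite <- (Rmult_assoc _ _ (/ exp e)), <- Rmult_assoc.
  mono_r.
  apply Rle_trans with (Rabs K / a * (M / sqrt a)); [lra|].
  assert (0 <= Rabs K / a * (M / sqrt a)) by nonneg.
  replace (2 * Rabs K / a * (c * (M / sqrt a))) with (2 * c * (Rabs K / a * (M / sqrt a)))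
    by (field; lra).
  nra.
Qed.

(** * Amplitude and phase at minus infinity *)

Lemma sqrt_2PI_gap : sqrt PI + 2 / 5 <= sqrt (2 * PI).
Proof.
  rewrite sqrt_mult by (pose proof PI_RGT_0; lra). pose proof sqrt_PI_bounds.
  assert (H2 : sqrt 2 * sqrt 2 = 2) by (apply sqrt_sqrt; lra).
  assert (H2p : 0 < sqrt 2) by nonneg.
  assert (7 / 5 <= sqrt 2) by nra. nra.
Qed.

(** The amplitude sqrt PI of the oscillation leaves room below sqrt (2 PI) for the error term. *)
Lemma fresnel_oscillation_bound (xi de : R) : 0 < xi < 1 -> exists a0, 1 <= a0 /\ forall a, a0 <= a ->
  Rabs (fresnel xi de (- a ^ 2) - cos (de - (1 - xi) * (PI / 2)) * La xi (- a ^ 2))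
    <= sqrt (2 * PI) * (Rpower a (- xi) / sqrt a).
Proof.
  intros Hxi. destruct (fresnel_minf xi Hxi) as [K [HK H]].
  exists (1 + 3 * K). split; [lra|]. intros a Ha. specialize (H a de ltac:(lra)).
  assert (HM : 0 < Rpower a (- xi)) by nonneg.
  pose proof (saddle_error _ a K HM ltac:(lra)) as HE. rewrite (Rabs_pos_eq K) in HE by lra.
  assert (Hs : 0 < sqrt a) by nonneg.
  set (m := Rpower a (- xi) / sqrt a) in *.
  assert (Hm : 0 < m) by nonneg.
  set (D := fresnel xi de (- a ^ 2) - cos (de - (1 - xi) * (PI / 2)) * La xi (- a ^ 2)) in *.
  set (c := cos (de + PI / 4 - 2 / 3 * a ^ 3)) in *.
  replace D with ((D - m * (sqrt PI * c)) + m * (sqrt PI * c)) by ring.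
  eapply Rle_trans; [apply Rabs_triang|].
  pose proof sqrt_PI_bounds. pose proof sqrt_2PI_gap.
  assert (Hc : Rabs (m * (sqrt PI * c)) <= m * sqrt PI).
  { rewrite !Rabs_mult, (Rabs_pos_eq m), (Rabs_pos_eq (sqrt PI)) by lra.
    pose proof (Rabs_cos_le (de + PI / 4 - 2 / 3 * a ^ 3)) as Hc. fold c in Hc.
    mono_l. nra. }
  assert (HKa : K / a <= 2 / 5) by (apply Rle_div_l; lra).
  assert (K / a * m <= 2 / 5 * m) by (apply Rmult_le_compat_r; lra).
  nra.
Qed.

(** Number of full turns, up to one, in the phase x. *)
Definition turns (x : R) : nat := Z.to_nat (up (x / (2 * PI))).

Lemma turns_spec (x : R) : 0 <= x -> Rabs (2 * INR (turns x) * PI - x) <= 2 * PI.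
Proof.
  intros Hx. pose proof PI_RGT_0. unfold turns.
  assert (Hy : 0 <= x / (2 * PI)) by nonneg.
  destruct (archimed (x / (2 * PI))) as [H1 H2].
  assert (Hz : (0 <= up (x / (2 * PI)))%Z) by (apply le_IZR; lra).
  rewrite INR_IZR_INZ, Z2Nat.id by auto.
  set (z := IZR (up (x / (2 * PI)))) in *.
  assert (Hx' : x = x / (2 * PI) * (2 * PI)) by (field; lra).
  set (y := x / (2 * PI)) in *. apply Rabs_le. split; nra.
Qed.

(** An arcsine gives a phase at which the sine takes the prescribed value; adding full turns
    brings this phase within a bounded distance of rho = 2/3 |th|^(3/2), that is, within a
    relative distance O(1/rho). *)
Lemma phase_absorption (xi phi : R) (F : R -> R) :
  (exists a0, 1 <= a0 /\ forall a, a0 <= a ->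
     Rabs (F (- a ^ 2)) <= sqrt (2 * PI) * (Rpower a (- xi) / sqrt a)) ->
  exists o1 o2 : R -> R, is_lim o1 m_infty 0 /\ is_lim o2 m_infty 0 /\
    Rbar_locally m_infty (fun th =>
      F th = sqrt (2 * PI) * Rpower (- th) ((1 - xi) / 2 - 3 / 4)
        * sin (2 / 3 * Rpower (- th) (3 / 2) * (1 + o1 th) + phi) * (1 + o2 th)).
Proof.
  intros [a0 [Ha0 HF]]. pose proof PI_RGT_0 as HPI. pose proof PI_4.
  set (rho := fun th => 2 / 3 * Rpower (- th) (3 / 2)).
  set (w := fun th => F th / (sqrt (2 * PI) * Rpower (- th) ((1 - xi) / 2 - 3 / 4))).
  set (x := fun th => asin (w th) + 2 * INR (turns (rho th)) * PI).
  assert (Hrho : forall th, th <= -1 -> - th / 3 <= rho th).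
  { intros th Hth. unfold rho.
    assert (Rpower (- th) 1 <= Rpower (- th) (3 / 2)) by (apply Rle_Rpower; lra).
    rewrite Rpower_1 in * by lra. lra. }
  exists (fun th => (x th - phi) / rho th - 1), (fun _ => 0). split; [|split].
  - apply is_lim_spec. intros eps. pose proof (cond_pos eps) as Heps. cbn beta.
    set (C := 12 + Rabs phi). assert (HC : 12 <= C) by (unfold C; pose proof (Rabs_pos phi); lra).
    exists (- (1 + 3 * C / eps)). intros th Hth.
    assert (HCe : 0 < C / eps) by nonneg.
    assert (Hth1 : th <= -1) by (unfold Rdiv in *; nra).
    pose proof (Hrho th Hth1) as Hr. rewrite Rminus_0_r.
    replace ((x th - phi) / rho th - 1) with ((x th - phi - rho th) / rho th) by (field; lra).
    rewrite Rabs_div, (Rabs_pos_eq (rho th)) by lra.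
    apply Rlt_div_l; [lra|].
    assert (Hx : Rabs (x th - phi - rho th) <= C).
    { unfold x, C. pose proof (asin_bound (w th)) as Has.
      pose proof (turns_spec (rho th) ltac:(lra)) as Ht.
      replace (asin (w th) + 2 * INR (turns (rho th)) * PI - phi - rho th)
        with (asin (w th) + (2 * INR (turns (rho th)) * PI - rho th) + - phi) by ring.
      eapply Rle_trans; [apply Rabs_triang|]. rewrite Rabs_Ropp.
      apply Rplus_le_compat_r. eapply Rle_trans; [apply Rabs_triang|].
      assert (Rabs (asin (w th)) <= 4) by (apply Rabs_le; lra). lra. }
    eapply Rle_lt_trans; [exact Hx|].
    assert (H3 : C = eps * (C / eps)) by (field; lra).
    rewrite H3 at 1. apply Rmult_lt_compat_l; auto.
    replace (3 * C / eps) with (3 * (C / eps)) in Hth by (field; lra). lra.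
  - apply is_lim_const.
  - exists (- a0 ^ 2). intros th Hth. pose proof (pow_R1_Rle a0 2 Ha0).
    set (a := sqrt (- th)).
    assert (Hath : th = - a ^ 2) by (unfold a; rewrite pow2_sqrt; lra).
    assert (Ha : a0 <= a).
    { rewrite <- (sqrt_pow2 a0) by lra. unfold a. apply sqrt_le_1; lra. }
    specialize (HF a Ha). rewrite <- Hath in HF.
    assert (Hth1 : th <= -1) by lra. pose proof (Hrho th Hth1) as Hr.
    assert (HA : Rpower (- th) ((1 - xi) / 2 - 3 / 4) = Rpower a (- xi) / sqrt a).
    { rewrite Hath, Ropp_involutive. apply Rpower_saddle; lra. }
    assert (Hs2 : 0 < sqrt (2 * PI)) by nonneg.
    assert (Hp : 0 < Rpower (- th) ((1 - xi) / 2 - 3 / 4)) by nonneg.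
    assert (Hw : -1 <= w th <= 1).
    { apply Rabs_le_between. unfold w. rewrite HA.
      rewrite Rabs_div, (Rabs_pos_eq (sqrt (2 * PI) * _)).
      - apply Rle_div_l; [rewrite <- HA; nra|]. lra.
      - rewrite <- HA; nra.
      - rewrite <- HA. nra. }
    fold (rho th).
    replace (rho th * (1 + ((x th - phi) / rho th - 1)) + phi) with (x th) by (field; lra).
    unfold x. rewrite sin_period, sin_asin by auto. unfold w. field. lra.
Qed.

(** * The solution space *)

Lemma langer_derivatives (xi : R) (y : R -> R) : langer_solution xi y ->
  forall t, is_derive y t (Derive y t) /\ is_derive (Derive y) t (Derive (Derive y) t) /\
    is_derive (Derive (Derive y)) t (t * Derive y t + (1 - xi) * y t).
Proof.
  intros H t. destruct (H t) as [Hk E]. split; [|split].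
  - apply Derive_correct. apply (Hk 1%nat). lia.
  - apply Derive_correct. apply (Hk 2%nat). lia.
  - rewrite <- E. simpl. apply Derive_correct. apply (Hk 3%nat). lia.
Qed.

(** Energy estimate: the derivative of E = u^2 + u'^2 + u''^2 is at most k E on [- |T|, |T|],
    so E(t) exp(- k |t|) cannot increase away from 0, where it vanishes. *)
Lemma cauchy_unique (xi : R) (u u1 u2 : R -> R) : 0 < xi < 1 ->
  (forall t, is_derive u t (u1 t)) -> (forall t, is_derive u1 t (u2 t)) ->
  (forall t, is_derive u2 t (t * u1 t + (1 - xi) * u t)) ->
  u 0 = 0 -> u1 0 = 0 -> u2 0 = 0 -> forall t, u t = 0.
Proof.
  intros Hxi H0 H1 H2 E0 E1 E2 T.
  set (k := Rabs T + 3).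
  set (E := fun t => u t ^ 2 + u1 t ^ 2 + u2 t ^ 2).
  set (dE := fun t => 2 * (u t * u1 t + u1 t * u2 t + u2 t * (t * u1 t + (1 - xi) * u t))).
  assert (HE : forall t, is_derive E t (dE t)).
  { intros t. unfold E, dE. evar_last.
    - apply (is_derive_plus (V := R_NormedModule) (fun t => u t ^ 2 + u1 t ^ 2) (fun t => u2 t ^ 2)).
      + apply (is_derive_plus (V := R_NormedModule) (fun t => u t ^ 2) (fun t => u1 t ^ 2)).
        * apply (is_derive_pow u 2). apply H0.
        * apply (is_derive_pow u1 2). apply H1.
      + apply (is_derive_pow u2 2). apply H2.
    - unfold plus; simpl. ring. }
  assert (HdE : forall t, Rabs t <= Rabs T -> Rabs (dE t) <= k * E t).
  { intros t Ht. apply Rabs_le_between in Ht. unfold dE, E, k.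
    set (x := u t). set (y := u1 t). set (z := u2 t).
    pose proof (pow2_ge_0 (x - y)). pose proof (pow2_ge_0 (x + y)).
    pose proof (pow2_ge_0 (z - y)). pose proof (pow2_ge_0 (z + y)).
    pose proof (pow2_ge_0 (x - z)). pose proof (pow2_ge_0 (x + z)).
    pose proof (pow2_ge_0 x). pose proof (pow2_ge_0 y). pose proof (pow2_ge_0 z).
    assert (A1 : Rabs (2 * (x * y)) <= x ^ 2 + y ^ 2) by (apply Rabs_le; simpl in *; lra).
    assert (A2 : Rabs (2 * (y * z)) <= y ^ 2 + z ^ 2) by (apply Rabs_le; simpl in *; lra).
    assert (A3 : Rabs (2 * (z * x)) <= z ^ 2 + x ^ 2) by (apply Rabs_le; simpl in *; lra).
    replace (2 * (x * y + y * z + z * (t * y + (1 - xi) * x)))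
      with (2 * (x * y) + 2 * (y * z) + (t * (2 * (y * z)) + (1 - xi) * (2 * (z * x)))) by ring.
    eapply Rle_trans; [apply Rabs_triang|].
    eapply Rle_trans; [apply Rplus_le_compat; apply Rabs_triang|].
    rewrite (Rabs_mult t), (Rabs_mult (1 - xi)), (Rabs_pos_eq (1 - xi)) by lra.
    assert (Ht' : Rabs t <= Rabs T) by now apply Rabs_le.
    assert (B1 : Rabs t * Rabs (2 * (y * z)) <= Rabs T * (y ^ 2 + z ^ 2))
      by (apply Rmult_le_compat; auto using Rabs_pos).
    assert (B2 : (1 - xi) * Rabs (2 * (z * x)) <= 1 * (z ^ 2 + x ^ 2))
      by (apply Rmult_le_compat; auto using Rabs_pos; lra).
    pose proof (Rabs_pos T).
    assert (0 <= Rabs T * x ^ 2) by now apply Rmult_le_pos.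
    lra. }
  assert (HET : E T <= 0).
  { assert (HE0 : E 0 = 0) by (unfold E; rewrite E0, E1, E2; ring).
    (* sg is the sign of T, so that one exponential factor treats both half-lines. *)
    set (sg := if Rle_dec 0 T then 1 else -1).
    assert (Hsg : sg * T = Rabs T /\ (sg = 1 \/ sg = -1)).
    { unfold sg. destruct (Rle_dec 0 T); split; auto.
      - rewrite Rabs_pos_eq; lra.
      - rewrite Rabs_left; lra. }
    destruct (mean_value (fun t => E t * exp (- (k * sg) * t))
      (fun t => (dE t - k * sg * E t) * exp (- (k * sg) * t)) 0 T) as [c [Hc Ec]].
    { intros t _. evar_last.
      - apply (is_derive_mult E (fun t => exp (- (k * sg) * t)) t (dE t)
          (- (k * sg) * exp (- (k * sg) * t))); [apply HE| |apply Rmult_comm].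
        auto_derive; auto. ring.
      - unfold plus, mult; simpl. ring. }
    rewrite HE0, Rmult_0_l, !Rminus_0_r in Ec.
    assert (Hcb : Rabs c <= Rabs T).
    { pose proof (Rabs_between _ _ _ Hc) as Hb. rewrite !Rminus_0_r in Hb. exact Hb. }
    specialize (HdE c Hcb). pose proof (exp_pos (- (k * sg) * T)) as HeT.
    pose proof (exp_pos (- (k * sg) * c)) as Hec.
    apply Rabs_le_between in HdE.
    assert (Hneg : (dE c - k * sg * E c) * T <= 0).
    { destruct Hsg as [Hs1 [Hs|Hs]]; rewrite Hs in *; pose proof (Rabs_pos T); nra. }
    assert (E T * exp (- (k * sg) * T) <= 0).
    { rewrite Ec.
      replace ((dE c - k * sg * E c) * exp (- (k * sg) * c) * T)
        with ((dE c - k * sg * E c) * T * exp (- (k * sg) * c)) by ring. nra. }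
    nra. }
  unfold E in HET. pose proof (pow2_ge_0 (u T)). pose proof (pow2_ge_0 (u1 T)).
  pose proof (pow2_ge_0 (u2 T)).
  assert (Hu : u T ^ 2 = 0) by lra. simpl in Hu. nra.
Qed.

(** The n-th derivative of a La + b Lb + c Lc. *)
Definition langer_comb (xi a b c : R) (n : nat) (th : R) : R :=
  a * ray_integral xi n 0 0 th
  + b * ray_integral xi n (2 * PI / 3)
      (xi * PI / 2 + (1 - xi) * (PI / 6) + INR n * (2 * PI / 3)) th
  + c * ray_integral xi n (2 * PI / 3)
      (- (xi * PI / 2) + (1 - xi) * (PI / 6) + INR n * (2 * PI / 3)) th.

Lemma langer_comb_0 (xi a b c th : R) : 0 < xi < 1 ->
  langer_comb xi a b c 0 th = a * La xi th + b * Lb xi th + c * Lc xi th.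
Proof.
  intros Hxi. unfold langer_comb. simpl INR.
  rewrite (proj2 (Lb_fresnel xi th Hxi)), (proj2 (Lc_fresnel xi th Hxi)), La_ray.
  unfold fresnel. rewrite !Rmult_0_l, !Rplus_0_r. reflexivity.
Qed.

Lemma is_derive_langer_comb (xi a b c : R) (n : nat) (th : R) : 0 < xi < 1 ->
  is_derive (langer_comb xi a b c n) th (langer_comb xi a b c (S n) th).
Proof.
  intros Hxi. unfold langer_comb. rewrite S_INR.
  replace (ray_integral xi (S n) 0 0 th) with (ray_integral xi (S n) 0 (0 + 0) th)
    by (f_equal; ring).
  replace ((INR n + 1) * (2 * PI / 3)) with (INR n * (2 * PI / 3) + 2 * PI / 3) by ring.
  rewrite <- !(Rplus_assoc _ (INR n * (2 * PI / 3))).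
  apply (is_derive_plus (V := R_NormedModule)); [apply (is_derive_plus (V := R_NormedModule))|].
  - apply (is_derive_scal (ray_integral xi n 0 0)). now apply is_derive_ray_integral.
  - apply (is_derive_scal (ray_integral xi n (2 * PI / 3) _)). now apply is_derive_ray_integral.
  - apply (is_derive_scal (ray_integral xi n (2 * PI / 3) _)). now apply is_derive_ray_integral.
Qed.

Lemma cos_sin_2PI : cos (3 * (2 * PI / 3)) = 1 /\ sin (3 * (2 * PI / 3)) = 0.
Proof.
  replace (3 * (2 * PI / 3)) with (2 * PI) by field. split; [apply cos_2PI|apply sin_2PI].
Qed.

Lemma langer_comb_ode (xi a b c th : R) : 0 < xi < 1 ->
  langer_comb xi a b c 3 th
    = th * langer_comb xi a b c 1 th + (1 - xi) * langer_comb xi a b c 0 th.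
Proof.
  intros Hxi. destruct cos_sin_2PI as [Hc Hs].
  pose proof (ray_integral_ode xi 0 0 th Hxi) as H0.
  rewrite Rmult_0_r, cos_0, sin_0, !Rplus_0_r in H0. specialize (H0 eq_refl eq_refl).
  assert (H : forall de, ray_integral xi 3 (2 * PI / 3) (de + INR 3 * (2 * PI / 3)) th
     = th * ray_integral xi 1 (2 * PI / 3) (de + INR 1 * (2 * PI / 3)) th
       + (1 - xi) * ray_integral xi 0 (2 * PI / 3) (de + INR 0 * (2 * PI / 3)) th).
  { intros de. pose proof (ray_integral_ode xi (2 * PI / 3) de th Hxi Hc Hs) as H.
    simpl INR. replace (de + (1 + 1 + 1) * (2 * PI / 3))
      with (de + 2 * PI / 3 + 2 * PI / 3 + 2 * PI / 3) by ring.
    rewrite Rmult_1_l, Rmult_0_l, Rplus_0_r. exact H. }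
  unfold langer_comb. rewrite !H, H0. ring.
Qed.

Definition moment (xi : R) (n : nat) : R := ray_integral xi n 0 0 0.

Lemma moment_pos (xi : R) (n : nat) : 0 < xi < 1 -> 0 < moment xi n.
Proof.
  intros Hxi. apply (has_integral_pos (ray_kernel xi n 0 0 0)).
  - apply (tame_has_integral xi); auto using tame_ray_kernel.
  - intros s Hs. unfold ray_kernel. rewrite sin_0, Rmult_0_r, Rplus_0_r, cos_0.
    nonneg.
Qed.

Lemma ray_integral_at_0 (xi om de : R) (n : nat) : 0 < xi < 1 ->
  ray_integral xi n om de 0 = cos de * moment xi n.
Proof.
  intros Hxi.
  pose proof (tame_has_integral xi _ Hxi (tame_ray_kernel xi n om de 0)) as H.
  pose proof (tame_has_integral xi _ Hxi (tame_ray_kernel xi n 0 0 0)) as H0.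
  apply (fun H => has_integral_lincomb _ _ _ _ (cos de) 0 H H) in H0.
  apply (has_integral_ext _ (ray_kernel xi n om de 0)) in H0.
  - pose proof (has_integral_unique _ _ _ H H0) as E. unfold ray_integral, moment.
    rewrite E. unfold ray_integral. ring.
  - intros s Hs. unfold ray_kernel. rewrite !Rmult_0_l, !Rplus_0_l, cos_0, !Rplus_0_r. ring.
Qed.

Lemma cos_third_turns (x : R) :
  cos (x + INR 1 * (2 * PI / 3)) = - / 2 * cos x - sqrt 3 / 2 * sin x /\
  cos (x + INR 2 * (2 * PI / 3)) = - / 2 * cos x + sqrt 3 / 2 * sin x.
Proof.
  assert (H3 : sqrt 3 * sqrt 3 = 3) by (apply sqrt_sqrt; lra).
  split.
  - simpl INR. rewrite Rmult_1_l, cos_plus, cos_third_turn, sin_third_turn. ring.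
  - simpl INR. replace (x + (1 + 1) * (2 * PI / 3)) with (x + 2 * PI / 3 + 2 * PI / 3) by ring.
    rewrite cos_plus, cos_plus, sin_plus, cos_third_turn, sin_third_turn.
    replace ((cos x * - / 2 - sin x * (sqrt 3 / 2)) * - / 2
      - (sin x * - / 2 + cos x * (sqrt 3 / 2)) * (sqrt 3 / 2))
      with (cos x / 4 - sqrt 3 * sqrt 3 / 4 * cos x + sqrt 3 / 2 * sin x) by field.
    rewrite H3. field.
Qed.

(** With Z = b exp(i al) + c exp(i be) = p + i q, the three values are the moments times a +
    Re(Z w^n), w = exp(2 i pi/3). *)
Lemma langer_comb_data (xi a b c : R) : 0 < xi < 1 ->
  let al := xi * PI / 2 + (1 - xi) * (PI / 6) in
  let be := - (xi * PI / 2) + (1 - xi) * (PI / 6) in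
  let p := b * cos al + c * cos be in
  let q := b * sin al + c * sin be in
  langer_comb xi a b c 0 0 = (a + p) * moment xi 0 /\
  langer_comb xi a b c 1 0 = (a - p / 2 - sqrt 3 / 2 * q) * moment xi 1 /\
  langer_comb xi a b c 2 0 = (a - p / 2 + sqrt 3 / 2 * q) * moment xi 2.
Proof.
  intros Hxi al be p q. unfold langer_comb. fold al be.
  rewrite !ray_integral_at_0 by auto. rewrite cos_0.
  destruct (cos_third_turns al) as [-> ->]. destruct (cos_third_turns be) as [-> ->].
  rewrite Rmult_0_l, !Rplus_0_r. unfold p, q. split; [|split]; field.
Qed.

(** Summing over the cube roots of unity isolates a; then Z is known, and b, c follow from it
    because sin(al - be) = sin(xi pi) is not 0. *)
Lemma langer_comb_spans (xi v0 v1 v2 : R) : 0 < xi < 1 -> exists a b c,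
  langer_comb xi a b c 0 0 = v0 /\ langer_comb xi a b c 1 0 = v1 /\ langer_comb xi a b c 2 0 = v2.
Proof.
  intros Hxi. pose proof PI_RGT_0.
  set (al := xi * PI / 2 + (1 - xi) * (PI / 6)). set (be := - (xi * PI / 2) + (1 - xi) * (PI / 6)).
  assert (Hd : 0 < sin (al - be)).
  { replace (al - be) with (xi * PI) by (unfold al, be; field). apply sin_gt_0; nra. }
  assert (H3 : 0 < sqrt 3) by nonneg.
  pose proof (moment_pos xi 0 Hxi). pose proof (moment_pos xi 1 Hxi). pose proof (moment_pos xi 2 Hxi).
  set (t0 := v0 / moment xi 0). set (t1 := v1 / moment xi 1). set (t2 := v2 / moment xi 2).
  set (a := (t0 + t1 + t2) / 3). set (p := t0 - a). set (q := (t2 - t1) / sqrt 3).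
  exists a, ((q * cos be - p * sin be) / sin (al - be)), ((p * sin al - q * cos al) / sin (al - be)).
  destruct (langer_comb_data xi a ((q * cos be - p * sin be) / sin (al - be))
    ((p * sin al - q * cos al) / sin (al - be)) Hxi) as [-> [-> ->]].
  fold al be.
  assert (Ep : (q * cos be - p * sin be) / sin (al - be) * cos al
    + (p * sin al - q * cos al) / sin (al - be) * cos be = p).
  { rewrite sin_minus in *. field. lra. }
  assert (Eq : (q * cos be - p * sin be) / sin (al - be) * sin al
    + (p * sin al - q * cos al) / sin (al - be) * sin be = q).
  { rewrite sin_minus in *. field. lra. }
  rewrite Ep, Eq. unfold p, q, a, t0, t1, t2. split; [|split]; field; lra.
Qed.

Lemma langer_comb_injective (xi a b c : R) : 0 < xi < 1 ->
  langer_comb xi a b c 0 0 = 0 -> langer_comb xi a b c 1 0 = 0 -> langer_comb xi a b c 2 0 = 0 ->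
  a = 0 /\ b = 0 /\ c = 0.
Proof.
  intros Hxi H0 H1 H2. pose proof PI_RGT_0.
  destruct (langer_comb_data xi a b c Hxi) as [E0 [E1 E2]].
  set (al := xi * PI / 2 + (1 - xi) * (PI / 6)) in *.
  set (be := - (xi * PI / 2) + (1 - xi) * (PI / 6)) in *.
  assert (Hd : 0 < sin (al - be)).
  { replace (al - be) with (xi * PI) by (unfold al, be; field). apply sin_gt_0; nra. }
  assert (H3 : 0 < sqrt 3) by nonneg.
  set (p := b * cos al + c * cos be) in *. set (q := b * sin al + c * sin be) in *.
  rewrite H0 in E0. rewrite H1 in E1. rewrite H2 in E2.
  assert (Z : forall x n, 0 = x * moment xi n -> x = 0).
  { intros x n Hx. pose proof (moment_pos xi n Hxi). symmetry in Hx.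
    apply Rmult_integral in Hx. destruct Hx; lra. }
  apply Z in E0. apply Z in E1. apply Z in E2.
  assert (Hp : p = 0) by lra. assert (Ha : a = 0) by lra.
  assert (Hq : q = 0).
  { assert (Hq3 : sqrt 3 * q = 0) by lra. apply Rmult_integral in Hq3. destruct Hq3; lra. }
  assert (Hb : b * sin (al - be) = 0).
  { rewrite sin_minus.
    replace (b * (sin al * cos be - cos al * sin be)) with (q * cos be - p * sin be)
      by (unfold p, q; ring). rewrite Hp, Hq. ring. }
  assert (Hc : c * sin (al - be) = 0).
  { rewrite sin_minus.
    replace (c * (sin al * cos be - cos al * sin be)) with (p * sin al - q * cos al)
      by (unfold p, q; ring). rewrite Hp, Hq. ring. }
  apply Rmult_integral in Hb. apply Rmult_integral in Hc.
  split; [auto|]. split; [destruct Hb|destruct Hc]; lra.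
Qed.

Lemma langer_independent (xi a b c : R) : 0 < xi < 1 ->
  (forall th, a * La xi th + b * Lb xi th + c * Lc xi th = 0) -> a = 0 /\ b = 0 /\ c = 0.
Proof.
  intros Hxi H.
  assert (HD : forall n, (forall th, langer_comb xi a b c n th = 0) ->
     forall th, langer_comb xi a b c (S n) th = 0).
  { intros n Hn th. rewrite <- (is_derive_unique _ _ _ (is_derive_langer_comb xi a b c n th Hxi)).
    rewrite (Derive_ext _ (fun _ => 0)) by auto. apply Derive_const. }
  assert (H0 : forall th, langer_comb xi a b c 0 th = 0).
  { intros th. rewrite langer_comb_0; auto. }
  pose proof (HD 0%nat H0) as H1. pose proof (HD 1%nat H1) as H2.
  now apply (langer_comb_injective xi).
Qed.

Lemma langer_span (xi : R) (y : R -> R) : 0 < xi < 1 -> langer_solution xi y ->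
  exists a b c, forall th, y th = a * La xi th + b * Lb xi th + c * Lc xi th.
Proof.
  intros Hxi Hy. pose proof (langer_derivatives xi y Hy) as HD.
  destruct (langer_comb_spans xi (y 0) (Derive y 0) (Derive (Derive y) 0) Hxi) as [a [b [c [E0 [E1 E2]]]]].
  exists a, b, c. intros th. rewrite <- langer_comb_0 by auto.
  apply Rminus_diag_uniq.
  apply (cauchy_unique xi (fun t => y t - langer_comb xi a b c 0 t)
    (fun t => Derive y t - langer_comb xi a b c 1 t)
    (fun t => Derive (Derive y) t - langer_comb xi a b c 2 t)); auto; try (cbv beta; lra).
  - intros t. apply (is_derive_minus (V := R_NormedModule)); [apply HD|now apply is_derive_langer_comb].
  - intros t. apply (is_derive_minus (V := R_NormedModule)); [apply HD|now apply is_derive_langer_comb].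
  - intros t. evar_last.
    + apply (is_derive_minus (V := R_NormedModule)); [apply HD|now apply is_derive_langer_comb].
    + rewrite langer_comb_ode by auto. unfold minus, plus, opp; simpl. ring.
Qed.

(** * Oscillation of combinations *)

(** Shape of the oscillating part of b Lb + c Lc near -oo, as a function of the phase x. *)
Definition oscillation (xi b c x : R) : R := b * cos (x + xi * PI / 2) + c * cos (x - xi * PI / 2).

(** The phase 2/3 a^3 advances by half a turn from a to a'. *)
Definition half_period (a a' : R) : Prop := 2 / 3 * a' ^ 3 = 2 / 3 * a ^ 3 + PI.

(** In terms of th = - a^2 the half periods have bounded length. *)
Lemma half_period_sqr (a a' : R) : 1 <= a -> 0 < a' -> half_period a a' -> a < a' /\ a' ^ 2 - a ^ 2 <= 6.
Proof.
  intros Ha Ha' H. unfold half_period in H. pose proof PI_RGT_0. pose proof PI_4.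
  assert (Hlt : a < a').
  { destruct (Rlt_dec a a'); auto. exfalso.
    assert (a' ^ 3 <= a ^ 3) by (apply pow_incr; lra). lra. }
  split; auto.
  assert (Hd : (a' - a) * (a' ^ 2 + a' * a + a ^ 2) = 3 / 2 * PI).
  { replace ((a' - a) * (a' ^ 2 + a' * a + a ^ 2)) with (a' ^ 3 - a ^ 3) by ring. lra. }
  assert ((a' - a) * (a' + a) <= (a' - a) * (a' ^ 2 + a' * a + a ^ 2)).
  { mono_l. nra. }
  replace (a' ^ 2 - a ^ 2) with ((a' - a) * (a' + a)) by ring. lra.
Qed.

Lemma La_increment (xi : R) : 0 < xi < 1 -> exists K, 0 <= K /\ forall a a', 1 <= a -> 0 < a' ->
  half_period a a' -> Rabs (La xi (- a' ^ 2) - La xi (- a ^ 2)) <= K / a ^ 2.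
Proof.
  intros Hxi. set (W := int_pos (weight xi)).
  assert (HW : 0 < W) by now apply int_pos_weight_pos.
  exists (12 * W). split; [lra|]. intros a a' Ha Ha' H.
  destruct (half_period_sqr a a' Ha Ha' H) as [Hlt Hd].
  assert (Ha2 : 1 <= a ^ 2) by (apply pow_R1_Rle; auto).
  assert (Hle : a ^ 2 <= a' ^ 2) by (apply pow_incr; lra).
  destruct (mean_value (La xi) (ray_integral xi 1 0 0) (- a ^ 2) (- a' ^ 2)) as [c [Hc E]].
  { intros t _. replace (La xi) with (ray_integral xi 0 0 0).
    - pose proof (is_derive_ray_integral xi 0 0 0 t Hxi) as HD. now rewrite Rplus_0_r in HD.
    - apply functional_extensionality. intros u. now rewrite La_ray. }
  rewrite E, Rabs_mult. rewrite Rmin_right, Rmax_left in Hc by lra.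
  pose proof (La_derivative_bound xi (- c) Hxi ltac:(lra)) as HB. rewrite Ropp_involutive in HB.
  fold W in HB.
  replace (12 * W / a ^ 2) with (2 / a ^ 2 * W * 6) by (field; lra).
  apply Rmult_le_compat; auto using Rabs_pos.
  - eapply Rle_trans; [exact HB|]. mono_r.
    mono_l. apply Rinv_le_contravar; lra.
  - rewrite Rabs_left1; lra.
Qed.

Lemma comb_minf (xi al b c : R) : 0 < xi < 1 -> exists K al', 0 <= K /\ forall a, 1 <= a ->
  Rabs (al * La xi (- a ^ 2) + b * Lb xi (- a ^ 2) + c * Lc xi (- a ^ 2) - al' * La xi (- a ^ 2)
        - Rpower a (- xi) / sqrt a * (sqrt PI * oscillation xi b c (PI / 4 - 2 / 3 * a ^ 3)))
    <= K / a * (Rpower a (- xi) / sqrt a).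
Proof.
  intros Hxi. destruct (fresnel_minf xi Hxi) as [K [HK H]].
  set (kb := cos (xi * PI / 2 - (1 - xi) * (PI / 2))).
  set (kc := cos (- (xi * PI / 2) - (1 - xi) * (PI / 2))).
  exists ((Rabs b + Rabs c) * K), (al + b * kb + c * kc).
  pose proof (Rabs_pos b). pose proof (Rabs_pos c).
  split; [apply Rmult_le_pos; lra|]. intros a Ha.
  pose proof (H a (xi * PI / 2) Ha) as Hb. pose proof (H a (- (xi * PI / 2)) Ha) as Hc.
  fold kb in Hb. fold kc in Hc.
  rewrite (proj2 (Lb_fresnel xi _ Hxi)), (proj2 (Lc_fresnel xi _ Hxi)).
  assert (HM : 0 < Rpower a (- xi)) by nonneg.
  pose proof (saddle_error _ a K HM Ha) as HE. rewrite (Rabs_pos_eq K) in HE by lra.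
  set (m := Rpower a (- xi) / sqrt a) in *. unfold oscillation.
  replace (PI / 4 - 2 / 3 * a ^ 3 + xi * PI / 2) with (xi * PI / 2 + PI / 4 - 2 / 3 * a ^ 3) by ring.
  replace (PI / 4 - 2 / 3 * a ^ 3 - xi * PI / 2) with (- (xi * PI / 2) + PI / 4 - 2 / 3 * a ^ 3) by ring.
  set (xb := cos (xi * PI / 2 + PI / 4 - 2 / 3 * a ^ 3)) in *.
  set (xc := cos (- (xi * PI / 2) + PI / 4 - 2 / 3 * a ^ 3)) in *.
  set (Fb := fresnel xi (xi * PI / 2) (- a ^ 2)) in *.
  set (Fc := fresnel xi (- (xi * PI / 2)) (- a ^ 2)) in *.
  set (l := La xi (- a ^ 2)) in *.
  replace (al * l + b * Fb + c * Fc - (al + b * kb + c * kc) * l - m * (sqrt PI * (b * xb + c * xc)))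
    with (b * (Fb - kb * l - m * (sqrt PI * xb)) + c * (Fc - kc * l - m * (sqrt PI * xc))) by ring.
  eapply Rle_trans; [apply Rabs_triang|]. rewrite !Rabs_mult.
  replace ((Rabs b + Rabs c) * K / a * m) with (Rabs b * (K / a * m) + Rabs c * (K / a * m))
    by (field; lra).
  apply Rplus_le_compat; apply Rmult_le_compat_l; lra.
Qed.

Lemma oscillation_shift (xi b c x : R) (k : nat) :
  oscillation xi b c (x - PI) = - oscillation xi b c x /\
  oscillation xi b c (x - 2 * INR k * PI) = oscillation xi b c x.
Proof.
  assert (H1 : forall y, cos (y - PI) = - cos y).
  { intros y. rewrite cos_minus, cos_PI, sin_PI. ring. }
  assert (H2 : forall y, cos (y - 2 * INR k * PI) = cos y).
  { intros y. rewrite <- (cos_period (y - 2 * INR k * PI) k). f_equal. ring. }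
  unfold oscillation. split.
  - replace (x - PI + xi * PI / 2) with (x + xi * PI / 2 - PI) by ring.
    replace (x - PI - xi * PI / 2) with (x - xi * PI / 2 - PI) by ring. rewrite !H1. ring.
  - replace (x - 2 * INR k * PI + xi * PI / 2) with (x + xi * PI / 2 - 2 * INR k * PI) by ring.
    replace (x - 2 * INR k * PI - xi * PI / 2) with (x - xi * PI / 2 - 2 * INR k * PI) by ring.
    now rewrite !H2.
Qed.

Lemma cube_root (z : R) : 0 < z -> exists a, 0 < a /\ 2 / 3 * a ^ 3 = z.
Proof.
  intros Hz. exists (Rpower (3 / 2 * z) (/ 3)). split; [apply exp_pos|].
  rewrite <- (Rpower_pow 3) by nonneg. rewrite Rpower_mult.
  replace (/ 3 * INR 3) with 1 by (simpl; field). rewrite Rpower_1 by lra. field.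
Qed.

(** At phases where one of the two cosines vanishes the other equals sin(xi pi) up to sign. *)
Lemma oscillation_nonzero (xi b c : R) : 0 < xi < 1 -> b <> 0 \/ c <> 0 ->
  exists x, oscillation xi b c x <> 0.
Proof.
  intros Hxi Hbc. pose proof PI_RGT_0.
  assert (Hsin : 0 < sin (xi * PI)) by (apply sin_gt_0; nra).
  unfold oscillation. destruct Hbc as [Hb|Hc].
  - exists (xi * PI / 2 - PI / 2).
    replace (xi * PI / 2 - PI / 2 + xi * PI / 2) with (- (PI / 2 - xi * PI)) by field.
    replace (xi * PI / 2 - PI / 2 - xi * PI / 2) with (- (PI / 2)) by field.
    rewrite !cos_neg, cos_shift, cos_PI2, Rmult_0_r, Rplus_0_r.
    apply Rmult_integral_contrapositive. split; lra.
  - exists (PI / 2 - xi * PI / 2).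
    replace (PI / 2 - xi * PI / 2 + xi * PI / 2) with (PI / 2) by field.
    replace (PI / 2 - xi * PI / 2 - xi * PI / 2) with (PI / 2 - xi * PI) by field.
    rewrite cos_shift, cos_PI2, Rmult_0_r, Rplus_0_l.
    apply Rmult_integral_contrapositive. split; lra.
Qed.

(** Over a half period the oscillating part goes from g to - g times the amplitude, while the
    error terms and the increment of La are smaller than the amplitude by a factor a^(-1/2). *)
Lemma oscillation_step (xi al b c G : R) : 0 < xi < 1 -> 0 < G -> exists N, 1 <= N /\
  forall a a', N <= a -> 0 < a' -> half_period a a' ->
  let y := fun th => al * La xi th + b * Lb xi th + c * Lc xi th in
  let g := oscillation xi b c (PI / 4 - 2 / 3 * a ^ 3) in
  (G <= g -> y (- a' ^ 2) < y (- a ^ 2)) /\ (g <= - G -> y (- a ^ 2) < y (- a' ^ 2)).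
Proof.
  intros Hxi HG. destruct (comb_minf xi al b c Hxi) as [K [al' [HK H]]].
  destruct (La_increment xi Hxi) as [K' [HK' HL]].
  set (C := (2 * K + Rabs al' * K') / G). pose proof (Rabs_pos al') as Hal.
  assert (HC : 0 <= C).
  { unfold C. nonneg. }
  exists ((C + 1) ^ 2). split; [apply pow_R1_Rle; lra|].
  intros a a' HN Ha' Hh y g.
  assert (Ha : 1 <= a) by (pose proof (pow_R1_Rle (C + 1) 2 ltac:(lra)); lra).
  destruct (half_period_sqr a a' Ha Ha' Hh) as [Hlt _].
  pose proof (H a Ha) as H1. pose proof (H a' ltac:(lra)) as H2.
  specialize (HL a a' Ha Ha' Hh).
  fold (y (- a ^ 2)) in H1. fold (y (- a' ^ 2)) in H2. fold g in H1.
  replace (PI / 4 - 2 / 3 * a' ^ 3) with (PI / 4 - 2 / 3 * a ^ 3 - PI) in H2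
    by (unfold half_period in Hh; lra).
  rewrite (proj1 (oscillation_shift xi b c _ 0)) in H2. fold g in H2.
  assert (Hs : 0 < sqrt a) by nonneg.
  assert (Hs1 : 1 <= sqrt a) by (rewrite <- sqrt_1; apply sqrt_le_1; lra).
  assert (Hss : sqrt a * sqrt a = a) by (apply sqrt_sqrt; lra).
  assert (HsC : C < sqrt a).
  { apply Rlt_le_trans with (C + 1); [lra|]. rewrite <- (sqrt_pow2 (C + 1)) by lra.
    apply sqrt_le_1; try lra. apply pow2_ge_0. }
  set (m := Rpower a (- xi) / sqrt a) in *. set (m' := Rpower a' (- xi) / sqrt a') in *.
  assert (Hm : 0 < m) by nonneg.
  assert (Hm' : 0 < m') by nonneg.
  (* Each error is at most a multiple of (m + m') / sqrt a. *)
  assert (E1 : K / a * m <= K / sqrt a * m).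
  { mono_r. mono_l.
    apply Rinv_le_contravar; nra. }
  assert (E2 : K / a' * m' <= K / sqrt a * m').
  { mono_r. mono_l.
    apply Rinv_le_contravar; nra. }
  assert (E3 : K' / a ^ 2 <= K' / sqrt a * m).
  { unfold m. replace (K' / sqrt a * (Rpower a (- xi) / sqrt a))
      with (K' * (Rpower a (- xi) / (sqrt a * sqrt a)))
      by (field; lra). rewrite Hss.
    mono_l.
    assert (HMa : / a <= Rpower a (- xi)).
    { rewrite <- (Rpower_1 a) at 1 by lra. rewrite <- Rpower_Ropp. apply Rle_Rpower; lra. }
    replace (/ a ^ 2) with (/ a * / a) by (field; lra).
    apply Rmult_le_compat_r; [nonneg|auto]. }
  assert (E4 : Rabs (al' * (La xi (- a' ^ 2) - La xi (- a ^ 2))) <= Rabs al' * K' / sqrt a * m).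
  { rewrite Rabs_mult. replace (Rabs al' * K' / sqrt a * m) with (Rabs al' * (K' / sqrt a * m))
      by (field; lra). apply Rmult_le_compat_l; lra. }
  assert (Hsmall : (2 * K + Rabs al' * K') / sqrt a < G).
  { apply Rlt_div_l; auto. replace (2 * K + Rabs al' * K') with (G * C) by (unfold C; field; lra).
    apply Rmult_lt_compat_l; lra. }
  assert (Hsum : K / sqrt a * m + K / sqrt a * m' + Rabs al' * K' / sqrt a * m < G * (m + m')).
  { apply Rle_lt_trans with ((2 * K + Rabs al' * K') / sqrt a * (m + m')).
    - replace ((2 * K + Rabs al' * K') / sqrt a * (m + m'))
        with (2 * (K / sqrt a * m) + 2 * (K / sqrt a * m') + Rabs al' * K' / sqrt a * m
             + Rabs al' * K' / sqrt a * m') by (field; lra).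
      assert (0 <= K / sqrt a * m) by nonneg. assert (0 <= K / sqrt a * m') by nonneg.
      assert (0 <= Rabs al' * K' / sqrt a * m') by nonneg.
      lra.
    - apply Rmult_lt_compat_r; lra. }
  pose proof sqrt_PI_bounds as HPI.
  apply Rabs_le_between in H1. apply Rabs_le_between in H2. apply Rabs_le_between in E4.
  assert (Hexp : al' * (La xi (- a' ^ 2) - La xi (- a ^ 2))
     = al' * La xi (- a' ^ 2) - al' * La xi (- a ^ 2)) by ring. rewrite Hexp in E4.
  assert (Hmm : m * (sqrt PI * g) + m' * (sqrt PI * g) = sqrt PI * g * (m + m')) by ring.
  replace (m' * (sqrt PI * - g)) with (- (m' * (sqrt PI * g))) in H2 by ring.
  split; intros Hg.
  - assert (G * (m + m') <= sqrt PI * g * (m + m')).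
    { mono_r. nra. }
    lra.
  - assert (sqrt PI * g * (m + m') <= - G * (m + m')).
    { mono_r. nra. }
    lra.
Qed.

(** Two consecutive half periods near -oo carry increments of opposite signs. *)
Lemma comb_oscillates (xi al b c : R) : 0 < xi < 1 -> b <> 0 \/ c <> 0 ->
  ~ non_oscillatory_minf (fun th => al * La xi th + b * Lb xi th + c * Lc xi th).
Proof.
  intros Hxi Hbc [M HM]. pose proof PI_RGT_0 as HPI.
  destruct (oscillation_nonzero xi b c Hxi Hbc) as [x0 Hx0].
  set (g0 := oscillation xi b c x0) in *.
  destruct (oscillation_step xi al b c (Rabs g0) Hxi (Rabs_pos_lt _ Hx0)) as [N [HN Hstep]].
  cbv zeta in Hstep.
  set (y := fun th => al * La xi th + b * Lb xi th + c * Lc xi th) in *.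
  set (Z := 2 / 3 * (N + Rabs M) ^ 3 + Rabs (PI / 4 - x0)).
  pose proof (Rabs_pos M) as HMp. pose proof (Rabs_pos (PI / 4 - x0)).
  assert (HN3 : 0 < (N + Rabs M) ^ 3) by nonneg.
  destruct (INR_unbounded Z) as [k Hk].
  assert (Hk2 : Z < 2 * INR k * PI).
  { pose proof PI2_1. assert (0 < Z) by (unfold Z; lra).
    apply Rlt_trans with (INR k * 1); [lra|].
    replace (2 * INR k * PI) with (INR k * (2 * PI)) by ring. apply Rmult_lt_compat_l; lra. }
  (* The phase z differs from PI/4 - x0 by full turns; it is so large that a exceeds N and |M|. *)
  set (z := PI / 4 - x0 + 2 * INR k * PI).
  assert (Hz : 2 / 3 * (N + Rabs M) ^ 3 < z).
  { unfold z. unfold Z in Hk2. pose proof (Rle_abs (- (PI / 4 - x0))) as Hab.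
    rewrite Rabs_Ropp in Hab. lra. }
  destruct (cube_root z ltac:(lra)) as [a [Ha Ea]].
  destruct (cube_root (z + PI) ltac:(lra)) as [a1 [Ha1 Ea1]].
  destruct (cube_root (z + PI + PI) ltac:(lra)) as [a2 [Ha2 Ea2]].
  assert (HaN : N + Rabs M <= a).
  { destruct (Rle_dec (N + Rabs M) a); auto. exfalso.
    assert (a ^ 3 <= (N + Rabs M) ^ 3) by (apply pow_incr; lra). lra. }
  assert (Hh1 : half_period a a1) by (unfold half_period; lra).
  assert (Hh2 : half_period a1 a2) by (unfold half_period; lra).
  destruct (half_period_sqr a a1 ltac:(lra) Ha1 Hh1) as [Hlt1 _].
  destruct (half_period_sqr a1 a2 ltac:(lra) Ha2 Hh2) as [Hlt2 _].
  assert (Hsq1 : a ^ 2 <= a1 ^ 2) by (apply pow_incr; lra).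
  assert (Hsq2 : a1 ^ 2 <= a2 ^ 2) by (apply pow_incr; lra).
  assert (HaM : - a ^ 2 <= M).
  { pose proof (Rle_abs (- M)) as Hab. rewrite Rabs_Ropp in Hab.
    assert (a * 1 <= a * a) by (apply Rmult_le_compat_l; lra). simpl; lra. }
  pose proof (Hstep a a1 ltac:(lra) Ha1 Hh1) as S1.
  pose proof (Hstep a1 a2 ltac:(lra) Ha2 Hh2) as S2.
  replace (PI / 4 - 2 / 3 * a ^ 3) with (x0 - 2 * INR k * PI) in S1 by (unfold z in Ea; lra).
  replace (PI / 4 - 2 / 3 * a1 ^ 3) with (x0 - 2 * INR k * PI - PI) in S2 by (unfold z in Ea1; lra).
  rewrite (proj1 (oscillation_shift xi b c (x0 - 2 * INR k * PI) k)) in S2.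
  rewrite (proj2 (oscillation_shift xi b c x0 k)) in S1, S2. fold g0 in S1, S2.
  destruct S1 as [S1p S1n]. destruct S2 as [S2p S2n].
  destruct (Rle_dec 0 g0) as [Hg|Hg].
  - rewrite (Rabs_pos_eq g0) in * by auto.
    specialize (S1p ltac:(lra)). specialize (S2n ltac:(lra)).
    destruct HM as [HM|HM].
    + specialize (HM (- a2 ^ 2) (- a1 ^ 2) ltac:(lra) ltac:(lra)). unfold y in *; lra.
    + specialize (HM (- a1 ^ 2) (- a ^ 2) ltac:(lra) ltac:(lra)). unfold y in *; lra.
  - rewrite (Rabs_left g0) in * by lra.
    specialize (S1n ltac:(lra)). specialize (S2p ltac:(lra)).
    destruct HM as [HM|HM].
    + specialize (HM (- a1 ^ 2) (- a ^ 2) ltac:(lra) ltac:(lra)). unfold y in *; lra.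
    + specialize (HM (- a2 ^ 2) (- a1 ^ 2) ltac:(lra) ltac:(lra)). unfold y in *; lra.
Qed.

Lemma non_oscillatory_solution (xi : R) (y : R -> R) : 0 < xi < 1 ->
  langer_solution xi y -> non_oscillatory_minf y -> exists a, forall th, y th = a * La xi th.
Proof.
  intros Hxi Hy Hno. destruct (langer_span xi y Hxi Hy) as [a [b [c E]]].
  exists a. replace y with (fun th => a * La xi th + b * Lb xi th + c * Lc xi th) in Hno
    by (apply functional_extensionality; auto).
  destruct (Req_dec b 0) as [Hb|Hb]; [destruct (Req_dec c 0) as [Hc|Hc]|].
  - intros th. rewrite E, Hb, Hc. ring.
  - destruct (comb_oscillates xi a b c Hxi (or_intror Hc) Hno).
  - destruct (comb_oscillates xi a b c Hxi (or_introl Hb) Hno).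
Qed.

(** * Langer's equation *)

Theorem lemma3 (xi : R) (hxi : 0 < xi < 1) :
  (forall th : R,
     converges_pos (La_integrand xi th) /\
     converges_pos (Lb_integrand xi th) /\
     converges_pos (Lc_integrand xi th)) /\
  (langer_solution xi (La xi) /\
   langer_solution xi (Lb xi) /\
   langer_solution xi (Lc xi)) /\
  (forall a b c : R,
     (forall th : R, a * La xi th + b * Lb xi th + c * Lc xi th = 0) ->
     a = 0 /\ b = 0 /\ c = 0) /\
  (forall y : R -> R, langer_solution xi y ->
     exists a b c : R,
       forall th : R, y th = a * La xi th + b * Lb xi th + c * Lc xi th) /\
  (forall y : R -> R, langer_solution xi y -> non_oscillatory_minf y ->
     exists a : R, forall th : R, y th = a * La xi th) /\
  (exists E2 : R -> R,
     (forall th : R, th < 0 ->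
        La xi th = Rpower (- th) (- (1 - xi)) * E2 (/ (- th) ^ 3)) /\
     (forall x : R, 0 < x -> real_analytic_at E2 x) /\
     smooth_nonneg E2 /\
     E2 0 = Gamma (1 - xi)) /\
  (exists o : R -> R, is_lim o p_infty 0 /\
     Rbar_locally p_infty (fun th =>
       La xi th =
         sqrt PI * Rpower th ((1 - xi) / 2 - 3 / 4)
           * exp (2 * Rpower th (3 / 2) / 3) * (1 + o th))) /\
  (exists o : R -> R, is_lim o p_infty 0 /\
     Rbar_locally p_infty (fun th =>
       Lb xi th =
         sqrt PI / 2 * Rpower th ((1 - xi) / 2 - 3 / 4)
           * exp (- 2 * Rpower th (3 / 2) / 3) * (1 + o th))) /\
  (exists o : R -> R, is_lim o p_infty 0 /\
     Rbar_locally p_infty (fun th =>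
       Lc xi th =
         sin (xi * PI) * Rpower th (- (1 - xi)) * Gamma (1 - xi)
           * (1 + o th))) /\
  (exists (r : R -> R) (K : R),
     Rbar_locally m_infty (fun th => Rabs (r th) <= K * Rabs (/ th ^ 3)) /\
     Rbar_locally m_infty (fun th =>
       La xi th =
         Rpower (- th) (- (1 - xi)) * Gamma (1 - xi) * (1 + r th))) /\
  (exists o1 o2 : R -> R, is_lim o1 m_infty 0 /\ is_lim o2 m_infty 0 /\
     Rbar_locally m_infty (fun th =>
       Lb xi th =
         sqrt (2 * PI) * Rpower (- th) ((1 - xi) / 2 - 3 / 4)
           * sin (2 / 3 * Rpower (- th) (3 / 2) * (1 + o1 th)
                  + PI / 4 - xi * PI / 2)
           * (1 + o2 th)
         + sin (xi * PI) * La xi th)) /\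
  (exists o1 o2 : R -> R, is_lim o1 m_infty 0 /\ is_lim o2 m_infty 0 /\
     Rbar_locally m_infty (fun th =>
       Lc xi th =
         sqrt (2 * PI) * Rpower (- th) ((1 - xi) / 2 - 3 / 4)
           * sin (2 / 3 * Rpower (- th) (3 / 2) * (1 + o1 th)
                  + PI / 4 + xi * PI / 2)
           * (1 + o2 th))).
Proof.
  rename hxi into Hxi. destruct cos_sin_2PI as [Hc3 Hs3].
  split; [|split; [|split; [|split; [|split; [|split; [|split; [|split; [|split; [|split; [|split]]]]]]]]]].
  - intros th. split; [|split].
    + apply (has_integral_correct _ (La xi th)).
      apply (tame_has_integral xi); auto using tame_La.
    + now apply Lb_fresnel.
    + now apply Lc_fresnel.
  - split; [|split].
    + replace (La xi) with (ray_integral xi 0 0 0).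
      * apply ray_integral_langer; auto; rewrite Rmult_0_r; [apply cos_0|apply sin_0].
      * apply functional_extensionality. intros th. now rewrite La_ray.
    + replace (Lb xi) with (fresnel xi (xi * PI / 2)).
      * now apply ray_integral_langer.
      * apply functional_extensionality. intros th. symmetry. now apply Lb_fresnel.
    + replace (Lc xi) with (fresnel xi (- (xi * PI / 2))).
      * now apply ray_integral_langer.
      * apply functional_extensionality. intros th. symmetry. now apply Lc_fresnel.
  - intros a b c. now apply langer_independent.
  - intros y. now apply langer_span.
  - intros y. now apply non_oscillatory_solution.
  - exists (E2_deriv xi 0). split; [|split; [|split]].
    + intros th. now apply La_eq_E2.
    + intros x. now apply E2_analytic.
    + now apply E2_smooth.
    + apply E2_deriv_0.
  - { destruct (La_laplace xi Hxi) as [K HK].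
    apply ratio_asymptotics with (K := 2 * Rabs K). intros a Ha.
    pose proof sqrt_PI_bounds.
    rewrite Rpower_saddle, Rpower_three_halves by lra.
    assert (HM : 0 < Rpower a (- xi)) by nonneg.
    split.
    - nonneg.
    - pose proof (scaled_exp_error _ _ _ a K (sqrt PI) HM Ha ltac:(lra) (HK a Ha)) as H'.
      rewrite Ropp_involutive in H'. exact H'. }
  - { destruct (Lb_pinf xi Hxi) as [K HK].
    apply ratio_asymptotics with (K := 2 * Rabs K). intros a Ha.
    pose proof sqrt_PI_bounds.
    rewrite Rpower_saddle, Rpower_three_halves by lra.
    assert (HM : 0 < Rpower a (- xi)) by nonneg.
    split.
    - nonneg.
    - pose proof (scaled_exp_error _ _ _ a K (sqrt PI / 2) HM Ha ltac:(lra) (HK a Ha)) as H'.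
      replace (-2 * a ^ 3 / 3) with (- (2 * a ^ 3 / 3)) by field. exact H'. }
  - { destruct (Lc_pinf xi Hxi) as [K HK].
    pose proof (Gamma_pos xi Hxi) as HG. pose proof PI_RGT_0.
    assert (Hsin : 0 < sin (xi * PI)) by (apply sin_gt_0; nra).
    apply ratio_asymptotics with (K := K / (sin (xi * PI) * Gamma (1 - xi))). intros a Ha.
    assert (HR : 0 < Rpower (a ^ 2) (- (1 - xi))) by nonneg.
    split; [repeat apply Rmult_lt_0_compat; auto|].
    eapply Rle_trans; [now apply HK|]. right. field. lra. }
  - { destruct (La_asymptotics_minf xi Hxi) as [r [K HK]].
    exists r, K. split; exists (-1); intros th Hth; now apply HK. }
  - { destruct (phase_absorption xi (PI / 4 - xi * PI / 2)
      (fun th => Lb xi th - sin (xi * PI) * La xi th)) as [o1 [o2 [H1 [H2 H3]]]].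
    - destruct (fresnel_oscillation_bound xi (xi * PI / 2) Hxi) as [a0 [Ha0 H]].
      exists a0. split; auto. intros a Ha. specialize (H a Ha).
      rewrite (proj2 (Lb_fresnel xi _ Hxi)).
      replace (sin (xi * PI)) with (cos (xi * PI / 2 - (1 - xi) * (PI / 2))); auto.
      rewrite <- cos_shift, <- (cos_neg (PI / 2 - _)). f_equal. field.
    - exists o1, o2. split; [|split]; auto.
      eapply filter_imp; [|exact H3]. intros th Hth. cbv beta in Hth |- *.
      unfold Rminus in Hth at 4. unfold Rminus at 3. rewrite Rplus_assoc.
      replace (PI / 4 + - (xi * PI / 2)) with (PI / 4 - xi * PI / 2) in * by ring. lra. }
  - { destruct (phase_absorption xi (PI / 4 + xi * PI / 2) (Lc xi)) as [o1 [o2 [H1 [H2 H3]]]].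
    - destruct (fresnel_oscillation_bound xi (- (xi * PI / 2)) Hxi) as [a0 [Ha0 H]].
      exists a0. split; auto. intros a Ha. specialize (H a Ha).
      rewrite (proj2 (Lc_fresnel xi _ Hxi)).
      replace (cos (- (xi * PI / 2) - (1 - xi) * (PI / 2))) with 0 in H.
      + rewrite Rmult_0_l, Rminus_0_r in H. exact H.
      + rewrite <- cos_PI2, <- cos_neg. f_equal. field.
    - exists o1, o2. split; [|split]; auto.
      eapply filter_imp; [|exact H3]. intros th Hth. cbv beta in Hth |- *.
      now rewrite Rplus_assoc. }
Qed.
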